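(* Consider the piecewise holomorphic systems $$\dot z=\tfrac{\mathrm i}{2}(z^2-1)+\epsilon R_m^\pm(z)\ \text{ when } \pm\operatorname{Im}(z)>0,$$ where $R_m^+$ and $R_m^-$ are complex polynomials in $z$ of degree $m$ and $\epsilon>0$ is small. For $m\in\{1,2\}$ there are such (quadratic) systems having two limit cycles with configuration $[[1,1]]$. For $m=3$ there are such (cubic) systems having limit cycles in two nests with configurations of each of the types $[[1,1]]$, $[[2,1]]$, $[[3,1]]$ and $[[2,2]]$.
   Context: The unperturbed equation $\dot z=\mathrm i(z^2-1)/2$ has centers at $-1$ and $1$. Orbits on $\operatorname{Im}(z)=0$ are defined by the Filippov convention. Write $R_m^\pm(z)=\sum_{l=0}^m\overline{a}^{\,\pm}_{0,l}z^l$, with $a^\pm_{0,l}\in\mathbb C$ and the bar denoting complex conjugation. First order averaged function at $-1$: let $\phi(z)=\frac{1+z}{1-z}$ and, for $r\in(0,1)$, $M_1(r)=M_1^+(r)-M_1^-(r)$ with $$M_1^\pm(r)=-\operatorname{Im}\left(\int_0^{\pm\pi}\overline{\phi'\big(\phi^{-1}(re^{\mathrm i\theta})\big)R_m^\pm\big(\phi^{-1}(re^{\mathrm i\theta})\big)}\,\mathrm i e^{\mathrm i\theta}d\theta\right).$$ First order averaged function at $1$: $N_1(r)$ is obtained from $M_1(r)$ by replacing every $a^{\pm}_{0,l}$ by $(-1)^l a^{\mp}_{0,l}$. The system presents the configuration $[i,j]$ of limit cycles if $M_1$ and $N_1$ have simultaneously $i$ and $j$ simple zeros in $(0,1)$,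 respectively; then, for $\epsilon$ small enough, the system has $i$ limit cycles surrounding $-1$ and $j$ limit cycles surrounding $1$ (two nests when $i,j\geq 1$). By symmetry $[i,j]$ occurs if and only if $[j,i]$ occurs, and one writes $[[i,j]]$ for either of them. *)

(* Defs.v *)
(* Stdlib reals with Coquelicot. *)
From Stdlib Require Import Reals List Lra.
From Coquelicot Require Import Coquelicot.
Open Scope R_scope.

(** * The piecewise holomorphic system *)

(* Only a 0, ..., a m matter; the polynomial has degree m when a m <> 0. *)
Definition Rpoly (m : nat) (a : nat -> C) (z : C) : C :=
  sum_n (G := C_AbelianMonoid) (fun l => (Cconj (a l) * z ^ l)%C) m.

Definition vfield (m : nat) (eps : R) (a : nat -> C) (z : C) : C :=
  (Ci / 2 * (z ^ 2 - 1) + RtoC eps * Rpoly m a z)%C.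

(** * Orbits of a planar field with discontinuity line Im z = 0 *)

(* Filippov's set-valued field: the convex hull of the two one-sided values on
   the discontinuity line. *)
Definition filippov (Xp Xm : C -> C) (z v : C) : Prop :=
  (0 < Im z /\ v = Xp z) \/
  (Im z < 0 /\ v = Xm z) \/
  (Im z = 0 /\ exists lam : R, 0 <= lam <= 1 /\
     v = (RtoC lam * Xp z + RtoC (1 - lam) * Xm z)%C).

(* Continuous concatenations of regular and sliding arcs: on each bounded time
   interval, the inclusion may fail only at finitely many (switching) times.
   On a sliding arc the velocity is real, which selects the sliding field. *)
Definition filippov_solution (Xp Xm : C -> C) (g : R -> C) : Prop :=
  (forall t, continuous (U := C_R_NormedModule) g t) /\
  (forall a b : R, exists s : list R, forall t, a <= t <= b -> ~ In t s ->
     exists v : C,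
       is_derive (K := R_AbsRing) (V := C_R_NormedModule) g t v /\
       filippov Xp Xm (g t) v).

Definition closed_orbit (Xp Xm : C -> C) (K : C -> Prop) : Prop :=
  exists (g : R -> C) (T : R),
    filippov_solution Xp Xm g /\
    0 < T /\ (forall t, g (t + T) = g t) /\
    (exists t, g t <> g 0) /\
    (forall z, K z <-> exists t, g t = z).

Definition same_set (K K' : C -> Prop) : Prop := forall z, K z <-> K' z.

Definition limit_cycle (Xp Xm : C -> C) (K : C -> Prop) : Prop :=
  closed_orbit Xp Xm K /\
  exists delta : R, 0 < delta /\
    forall K' : C -> Prop, closed_orbit Xp Xm K' ->
      (forall z, K' z -> exists w, K w /\ Cmod (z - w)%C < delta) ->
      same_set K K'.

(* p lies in a bounded component of the complement of K.  For closed K, the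
   components of the complement are the path components. *)
Definition surrounds (K : C -> Prop) (p : C) : Prop :=
  ~ K p /\
  exists B : R, forall path : R -> C,
    (forall t, continuous (U := C_R_NormedModule) path t) ->
    path 0 = p ->
    (forall t, 0 <= t <= 1 -> ~ K (path t)) ->
    Cmod (path 1) <= B.

(* A nest of (at least) n limit cycles around p, none of them around q. *)
Definition has_nest (Xp Xm : C -> C) (p q : C) (n : nat) : Prop :=
  exists K : nat -> C -> Prop,
    (forall k, (k < n)%nat ->
       limit_cycle Xp Xm (K k) /\ surrounds (K k) p /\ ~ surrounds (K k) q) /\
    (forall k l, (k < n)%nat -> (l < n)%nat -> k <> l ->
       ~ same_set (K k) (K l)).

(** * First order averaged functions *)

Definition phi (z : C) : C := ((1 + z) / (1 - z))%C.
Definition phi_inv (w : C) : C := ((w - 1) / (w + 1))%C.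

Lemma phi_phi_inv (w : C) : (w + 1)%C <> 0%C -> phi (phi_inv w) = w.
Proof.
assert (H2 : RtoC 2 <> 0%C) by (intros H; apply RtoC_inj in H; lra).
intros Hw; unfold phi, phi_inv; field; split; trivial.
replace (w + 1 - (w - 1))%C with (RtoC 2); [exact H2 | ring].
Qed.

Lemma phi_inv_phi (z : C) : (1 - z)%C <> 0%C -> phi_inv (phi z) = z.
Proof.
assert (H2 : RtoC 2 <> 0%C) by (intros H; apply RtoC_inj in H; lra).
intros Hz; unfold phi, phi_inv; field; split; trivial.
replace (1 + z + (1 - z))%C with (RtoC 2); [exact H2 | ring].
Qed.

Definition cis (theta : R) : C := (cos theta, sin theta).

(* M1_half m a (+PI) and M1_half m a (-PI) are the contributions M_1^+ and
   M_1^- of the two half-planes. *)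
Definition M1_half (m : nat) (a : nat -> C) (alpha r : R) : R :=
  - Im (RInt (V := C_R_CompleteNormedModule)
          (fun theta : R =>
             let z := phi_inv (RtoC r * cis theta)%C in
             (Cconj (C_derive phi z * Rpoly m a z) * (Ci * cis theta))%C)
          0 alpha).

Definition M1 (m : nat) (ap am : nat -> C) (r : R) : R :=
  M1_half m ap PI r - M1_half m am (- PI) r.

Definition N1 (m : nat) (ap am : nat -> C) : R -> R :=
  M1 m (fun l => (RtoC (-1) ^ l * am l)%C) (fun l => (RtoC (-1) ^ l * ap l)%C).

Definition simple_zero (f : R -> R) (r : R) : Prop :=
  f r = 0 /\
  exists d : R, is_derive (K := R_AbsRing) (V := R_NormedModule) f r d /\ d <> 0.

(* Exactly n simple zeros in (0,1). *)
Definition has_simple_zeros (f : R -> R) (n : nat) : Prop :=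
  exists s : list R, NoDup s /\ length s = n /\
    forall r, In r s <-> (0 < r < 1 /\ simple_zero f r).

(** * Configurations of limit cycles *)

Definition averaged_configuration (m : nat) (ap am : nat -> C) (i j : nat) :
    Prop :=
  has_simple_zeros (M1 m ap am) i /\ has_simple_zeros (N1 m ap am) j.

Definition has_limit_cycles (m : nat) (ap am : nat -> C) (i j : nat) : Prop :=
  exists eps0 : R, 0 < eps0 /\ forall eps : R, 0 < eps < eps0 ->
    has_nest (vfield m eps ap) (vfield m eps am) (RtoC (-1)) (RtoC 1) i /\
    has_nest (vfield m eps ap) (vfield m eps am) (RtoC 1) (RtoC (-1)) j.

(* [i,j]: the averaged functions have i and j simple zeros, and the system
   itself has the corresponding limit cycles for every small eps > 0. *)
Definition configuration (m : nat) (ap am : nat -> C) (i j : nat) : Prop :=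
  averaged_configuration m ap am i j /\ has_limit_cycles m ap am i j.

(* [[i,j]]: either of [i,j] and [j,i]. *)
Definition configuration_sym (m : nat) (ap am : nat -> C) (i j : nat) : Prop :=
  configuration m ap am i j \/ configuration m ap am j i.

Definition configuration_occurs (m i j : nat) : Prop :=
  exists ap am : nat -> C,
    ap m <> RtoC 0 /\ am m <> RtoC 0 /\ configuration_sym m ap am i j.

(* Main.v *)
(* In the coordinate w = phi z the unperturbed system is w' = -i w, and in polar
   coordinates each half of the perturbed system becomes an ODE
   dr/dx = eps G(r, x) on 0 <= x <= PI.  Its two half-flows from a common initial
   radius differ at x = PI by eps M1 + O(eps^2), so a simple zero of M1 gives, by
   the intermediate value theorem, a closed orbit near it.  Isolation: the
   derivative of M1 at the zero is the average of the linearised growth of the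
   distance to the orbit; weighting this distance to make the growth rate constant
   gives a function that is strictly monotone along every Filippov solution off
   the orbit, so a periodic solution in a small annulus lies on the orbit.
   N1 is M1 for the system obtained by z -> -z and time reversal.

   In closed form M1 = k0 + k1 r + k2 r^2 + k3 r ln ((1-r)/(1+r)) with arbitrary
   real k0, ..., k3 (k3 = 0 if m < 3), and N1 exchanges k0 and k2.  The numerator
   of the derivative of M1 / r is quadratic in r^2, which makes the zeros easy to
   count. *)
Require Import Defs.
From Stdlib Require Import Reals Ranalysis5 ZArith List Lra Lia ClassicalEpsilon.
From Coquelicot Require Import Coquelicot.
Open Scope R_scope.
Set Bullet Behavior "Strict Subproofs".

(** Isolation is shaped by the definition of a limit cycle: the competitors are all nearby periodic
    Filippov solutions, which need not be unique, may fail to be differentiable at switching times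
    and might slide. A Lyapunov function therefore takes the place of a return map. Sliding is
    excluded by rotation: in the coordinate w both fields turn clockwise, hence so does every convex
    combination of them, and a solution that meets the real axis leaves it at once. Corners of the
    Lyapunov function on the axis then do no harm. The growth constant is [c = d / (2 PI)], where
    [d] is the derivative of M1 at the zero. Each half carries its own weight, and the two must
    agree on both real half-axes; agreement at angle PI forces this value, and simplicity of the
    zero makes it nonzero. Existence needs no smooth dependence on initial data: the half-flows are
    Lipschitz in the initial radius, and the derivative of M1 is read off from a quadratic Taylor
    remainder of the perturbation. The annulus is fixed before eps, so it does not shrink with
    eps. *)

Notation is_derive_C := (is_derive (K := R_AbsRing) (V := C_R_NormedModule)).

Notation continuous_C := (continuous (U := C_R_NormedModule)).

(** * Calculus of complex-valued curves *)

Lemma continuous_Rplus {U : UniformSpace} (f g : U -> R) (t : U) :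
  continuous f t -> continuous g t -> continuous (fun s => f s + g s) t.
Proof. exact (continuous_plus (V := R_NormedModule) f g t). Qed.

Lemma continuous_Rminus {U : UniformSpace} (f g : U -> R) (t : U) :
  continuous f t -> continuous g t -> continuous (fun s => f s - g s) t.
Proof. exact (continuous_minus (V := R_NormedModule) f g t). Qed.

Lemma continuous_Rmult {U : UniformSpace} (f g : U -> R) (t : U) :
  continuous f t -> continuous g t -> continuous (fun s => f s * g s) t.
Proof. exact (continuous_mult (K := R_AbsRing) f g t). Qed.

Lemma C_eq (z w : C) : Re z = Re w -> Im z = Im w -> z = w.
Proof. destruct z, w; simpl. now intros -> ->. Qed.

Lemma is_derive_C_components (f : R -> C) (t : R) (v : C) :
  is_derive_C f t v <->
  is_derive (fun s => Re (f s)) t (Re v) /\ is_derive (fun s => Im (f s)) t (Im v).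
Proof.
split.
- intros H; split.
  + apply (filterdiff_ext_lin _ (fun y : R => fst (scal (V := C_R_NormedModule) y v))).
    * apply (filterdiff_comp' f (fun z : C_R_NormedModule => fst z) t _ _ H).
      apply filterdiff_linear. apply is_linear_fst.
    * reflexivity.
  + apply (filterdiff_ext_lin _ (fun y : R => snd (scal (V := C_R_NormedModule) y v))).
    * apply (filterdiff_comp' f (fun z : C_R_NormedModule => snd z) t _ _ H).
      apply filterdiff_linear. apply is_linear_snd.
    * reflexivity.
- intros [H1 H2].
  apply (filterdiff_ext (fun s => (Re (f s), Im (f s)) : C_R_NormedModule)).
  { intros s; destruct (f s); reflexivity. }
  apply (filterdiff_ext_lin _ (fun y : R => (scal y (Re v), scal y (Im v)) : C_R_NormedModule)).
  2: { intros y; reflexivity. }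
  apply (filterdiff_comp'_2 (U := R_NormedModule) (V := R_NormedModule) (W := C_R_NormedModule)
    (fun s => Re (f s)) (fun s => Im (f s)) (fun x y => (x, y) : C_R_NormedModule) t
    (fun y => scal y (Re v)) (fun y => scal y (Im v)) (fun x y => (x, y) : C_R_NormedModule)); trivial.
  apply (filterdiff_ext (fun z : C_R_NormedModule => z)).
  { intros [x y]; reflexivity. }
  apply (filterdiff_ext_lin _ (fun z : C_R_NormedModule => z)).
  { apply filterdiff_id. }
  intros [x y]; reflexivity.
Qed.

Lemma is_derive_C_continuous (f : R -> C) t v :
  is_derive_C f t v -> continuous_C f t.
Proof.
intros H. apply (ex_derive_continuous (V := C_R_NormedModule)). now exists v.
Qed.

Lemma continuous_C_components {U : UniformSpace} (f : U -> C) (t : U) :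
  continuous_C f t <->
  continuous (fun s => Re (f s)) t /\ continuous (fun s => Im (f s)) t.
Proof.
split.
- intros H; split.
  + apply (continuous_comp f (fun z : C_R_NormedModule => fst z) t H).
    destruct (f t) as [x y]. apply continuous_fst.
  + apply (continuous_comp f (fun z : C_R_NormedModule => snd z) t H).
    destruct (f t) as [x y]. apply continuous_snd.
- intros [H1 H2].
  apply (continuous_ext (fun s => (Re (f s), Im (f s)) : C_R_NormedModule)).
  { intros s; destruct (f s); reflexivity. }
  apply (continuous_comp_2 (V := R_UniformSpace) (W := R_UniformSpace) (X := C_R_NormedModule)
    (fun s => Re (f s)) (fun s => Im (f s)) (fun x y => (x, y))); trivial.
  apply (continuous_ext (fun z : C_R_NormedModule => z)).
  { intros [x y]; reflexivity. }
  apply continuous_id.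
Qed.

Lemma is_derive_C_mult (f g : R -> C) t u v :
  is_derive_C f t u -> is_derive_C g t v ->
  is_derive_C (fun s => f s * g s)%C t (u * g t + f t * v)%C.
Proof.
rewrite !is_derive_C_components. intros [H1 H2] [H3 H4]; split.
- apply (is_derive_ext (fun s => Re (f s) * Re (g s) - Im (f s) * Im (g s))); [reflexivity|].
  evar_last. { apply (is_derive_minus (V := R_NormedModule)); apply (is_derive_mult (K := R_AbsRing)); eauto; intros; apply Rmult_comm. }
  simpl. unfold minus, plus, mult, opp, Re, Im; simpl. ring.
- apply (is_derive_ext (fun s => Re (f s) * Im (g s) + Im (f s) * Re (g s))); [reflexivity|].
  evar_last. { apply (is_derive_plus (V := R_NormedModule)); apply (is_derive_mult (K := R_AbsRing)); eauto; intros; apply Rmult_comm. }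
  simpl. unfold minus, plus, mult, opp, Re, Im; simpl. ring.
Qed.

Lemma is_derive_C_plus (f g : R -> C) t u v :
  is_derive_C f t u -> is_derive_C g t v ->
  is_derive_C (fun s => f s + g s)%C t (u + v)%C.
Proof. intros H1 H2; exact (is_derive_plus (V := C_R_NormedModule) f g t u v H1 H2). Qed.

Lemma is_derive_C_const (c : C) t : is_derive_C (fun _ => c) t (RtoC 0).
Proof. exact (is_derive_const (V := C_R_NormedModule) c t). Qed.

Lemma C_neq_0_norm2 (z : C) : z <> RtoC 0 -> fst z ^ 2 + snd z ^ 2 <> 0.
Proof.
intros Hz H. apply Hz. destruct z as [x y]; simpl in *. unfold RtoC.
f_equal; nra.
Qed.

Lemma is_derive_C_inv (f : R -> C) t u :
  is_derive_C f t u -> f t <> RtoC 0 ->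
  is_derive_C (fun s => / f s)%C t (- u / (f t * f t))%C.
Proof.
rewrite !is_derive_C_components. intros [H1 H2] H0.
assert (Hn := C_neq_0_norm2 _ H0).
destruct u as [a b]. simpl in H1, H2.
assert (E1 := is_derive_unique _ _ _ H1).
assert (E2 := is_derive_unique _ _ _ H2).
assert (D1 : ex_derive (fun s => Re (f s)) t) by (eexists; exact H1).
assert (D2 : ex_derive (fun s => Im (f s)) t) by (eexists; exact H2).
set (p := fun s => Re (f s)) in *. set (q := fun s => Im (f s)) in *.
change (p t ^ 2 + q t ^ 2 <> 0) in Hn.
(* The squared modulus of [f t * f t], the denominator that appears once the quotient by the complex
   square is unfolded. *)
assert (Hm : (p t * p t - q t * q t) ^ 2 + (p t * q t + q t * p t) ^ 2 <> 0).
{ replace ((p t * p t - q t * q t) ^ 2 + (p t * q t + q t * p t) ^ 2)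
    with ((p t ^ 2 + q t ^ 2) ^ 2) by ring.
  now apply pow_nonzero. }
split.
- apply (is_derive_ext (fun s => p s / (p s ^ 2 + q s ^ 2))); [reflexivity|].
  change (is_derive (fun s => p s / (p s ^ 2 + q s ^ 2)) t
    (- a * ((p t * p t - q t * q t) / ((p t * p t - q t * q t) ^ 2 + (p t * q t + q t * p t) ^ 2))
     - - b * (- (p t * q t + q t * p t) / ((p t * p t - q t * q t) ^ 2 + (p t * q t + q t * p t) ^ 2)))).
  auto_derive; [repeat split; trivial|].
  change (Derive (fun x : R => p x) t) with (Derive p t). rewrite (E1 : Derive p t = a), (E2 : Derive (fun x : R => q x) t = b). field.
  split; intros Hx; [apply Hm|apply Hn]; rewrite <- Hx; ring.
- apply (is_derive_ext (fun s => - q s / (p s ^ 2 + q s ^ 2))); [reflexivity|].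
  change (is_derive (fun s => - q s / (p s ^ 2 + q s ^ 2)) t
    (- a * (- (p t * q t + q t * p t) / ((p t * p t - q t * q t) ^ 2 + (p t * q t + q t * p t) ^ 2))
     + - b * ((p t * p t - q t * q t) / ((p t * p t - q t * q t) ^ 2 + (p t * q t + q t * p t) ^ 2)))).
  auto_derive; [repeat split; trivial|].
  change (Derive (fun x : R => p x) t) with (Derive p t). rewrite (E1 : Derive p t = a), (E2 : Derive (fun x : R => q x) t = b). field.
  split; intros Hx; [apply Hm|apply Hn]; rewrite <- Hx; ring.
Qed.

Lemma continuous_C_mult {U : UniformSpace} (f g : U -> C) t :
  continuous_C f t -> continuous_C g t ->
  continuous_C (fun s => f s * g s)%C t.
Proof.
rewrite !continuous_C_components. intros [H1 H2] [H3 H4]; split.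
- apply continuous_Rminus;
  now apply continuous_Rmult.
- apply continuous_Rplus;
  now apply continuous_Rmult.
Qed.

Lemma continuous_C_plus {U : UniformSpace} (f g : U -> C) t :
  continuous_C f t -> continuous_C g t ->
  continuous_C (fun s => f s + g s)%C t.
Proof. exact (continuous_plus (V := C_R_NormedModule) f g t). Qed.

Lemma continuous_Rinv_comp' {U : UniformSpace} (f : U -> R) t :
  continuous f t -> f t <> 0 -> continuous (fun s => / f s) t.
Proof.
intros H H0. apply (continuous_comp f Rinv); trivial.
apply continuity_pt_filterlim. apply continuity_pt_inv; [|exact H0].
apply derivable_continuous_pt, derivable_pt_id.
Qed.

Lemma continuous_C_inv {U : UniformSpace} (f : U -> C) t :
  continuous_C f t -> f t <> RtoC 0 ->
  continuous_C (fun s => / f s)%C t.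
Proof.
rewrite !continuous_C_components. intros [H1 H2] H0.
assert (Hn := C_neq_0_norm2 _ H0).
assert (Hd : continuous (fun s => / (fst (f s) ^ 2 + snd (f s) ^ 2)) t).
{ apply (continuous_Rinv_comp' (fun s => fst (f s) ^ 2 + snd (f s) ^ 2)); trivial.
  apply continuous_Rplus.
  - apply (continuous_ext (fun s => Re (f s) * Re (f s))); [intros; simpl; unfold Re; ring|].
    now apply continuous_Rmult.
  - apply (continuous_ext (fun s => Im (f s) * Im (f s))); [intros; simpl; unfold Im; ring|].
    now apply continuous_Rmult. }
split.
- apply continuous_Rmult; trivial.
- apply continuous_Rmult; trivial.
  now apply (continuous_opp (V := R_NormedModule) (fun s => Im (f s))).
Qed.

Lemma continuous_Cmod (z : C) : continuous (T := C_R_NormedModule) (U := R_UniformSpace) Cmod z.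
Proof.
unfold Cmod. apply (continuous_comp (fun w : C => fst w ^ 2 + snd w ^ 2) sqrt).
- destruct (continuous_C_components (fun w : C_R_NormedModule => w) z) as [H _].
  destruct (H (continuous_id _)) as [H1 H2].
  apply continuous_Rplus.
  + apply (continuous_ext (fun s : C_R_NormedModule => Re s * Re s)); [intros; simpl; unfold Re; ring|].
    now apply continuous_Rmult.
  + apply (continuous_ext (fun s : C_R_NormedModule => Im s * Im s)); [intros; simpl; unfold Im; ring|].
    now apply continuous_Rmult.
- apply continuity_pt_filterlim. apply continuity_pt_sqrt.
  destruct z; simpl; nra.
Qed.

Lemma is_derive_C_comp (f : R -> C) (u : R -> R) (t l : R) (v : C) :
  is_derive_C f (u t) v -> is_derive u t l -> is_derive_C (fun s => f (u s)) t (RtoC l * v)%C.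
Proof.
intros Hf Hu. evar_last; [exact (is_derive_comp (V := C_R_NormedModule) f u t v l Hf Hu)|].
apply C_eq; unfold scal; simpl; unfold scal; simpl; unfold mult, Re, Im; simpl; ring.
Qed.

Lemma continuous_R_iff (h : R -> R) (t : R) :
  continuous h t <->
  forall e, 0 < e -> exists d, 0 < d /\ forall s, Rabs (s - t) < d -> Rabs (h s - h t) < e.
Proof.
split.
- intros H e He. destruct (proj1 (filterlim_locally h (h t)) H (mkposreal e He)) as [d Hd].
  exists d; split; [apply cond_pos|]. intros s Hs. exact (Hd s Hs).
- intros H. apply filterlim_locally. intros e.
  destruct (H e (cond_pos e)) as [d [Hd Hd']]. exists (mkposreal d Hd). exact Hd'.
Qed.

(** * Monotonicity off finitely many points *)

Lemma right_gap (S : list R) (a : R) :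
  exists c, a < c /\ forall t, a < t < c -> ~ In t S.
Proof.
induction S as [|s S [c [Hc H]]].
- exists (a + 1); split; [lra | simpl; tauto].
- destruct (Rlt_dec a s) as [Hs|Hs].
  + exists (Rmin c s); split; [now apply Rmin_glb_lt|].
    intros t Ht. assert (t < c /\ t < s) as [H1 H2].
    { split; eapply Rlt_le_trans; try apply Ht; [apply Rmin_l | apply Rmin_r]. }
    intros [E|E]; [lra | revert E; apply H; lra].
  + exists c; split; [trivial|]. intros t Ht [E|E]; [lra | revert E; apply H; lra].
Qed.

(** Continuous induction: the supremum of the times up to which [h] stays below its starting value
    cannot lie before [b]. The local hypothesis is one-sided because an orbit is controlled only
    just after it leaves the switching line. *)
Lemma right_locally_nonincreasing (h : R -> R) (a b : R) :
  a <= b -> (forall t, a <= t <= b -> continuous h t) ->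
  (forall t, a < t < b -> exists eta, 0 < eta /\ forall t', t < t' < t + eta -> h t' <= h t) ->
  h b <= h a.
Proof.
intros Hab Hc Hl.
destruct (Req_dec a b) as [->|Hne]; [lra|].
(* Nothing is assumed to the right of [a] itself, so the argument starts at an interior point;
   continuity at [a] finishes the proof. *)
assert (H1 : forall a1, a < a1 < b -> h b <= h a1).
{ intros a1 Ha1.
  set (E := fun t => a1 <= t <= b /\ forall s, a1 <= s <= t -> h s <= h a1).
  assert (E1 : E a1). { split; [lra|]. intros s Hs. replace s with a1 by lra. lra. }
  destruct (completeness E) as [m [Hm1 Hm2]].
  { exists b. intros t [Ht _]. lra. }
  { now exists a1. }
  assert (Ham : a1 <= m) by now apply Hm1.
  assert (Hmb : m <= b). { apply Hm2. intros t [Ht _]; lra. }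
  assert (Hlt : forall s, a1 <= s < m -> h s <= h a1).
  { intros s Hs. destruct (classic (exists t, E t /\ s < t)) as [[t [[_ Ht] Hst]]|Hn].
    - apply Ht; lra.
    - exfalso. assert (m <= s); [|lra]. apply Hm2. intros t Ht.
      destruct (Rle_dec t s); trivial. exfalso; apply Hn; exists t; split; trivial; lra. }
  assert (Hmm : h m <= h a1).
  { destruct (Req_dec m a1) as [->|Hma]; [lra|].
    destruct (Rle_dec (h m) (h a1)) as [|Hgt]; trivial. exfalso.
    destruct (proj1 (continuous_R_iff h m) (Hc m ltac:(lra)) ((h m - h a1)) ltac:(lra)) as [d [Hd Hd']].
    set (s := Rmax a1 (m - d / 2)).
    assert (a1 <= s) by apply Rmax_l. assert (m - d / 2 <= s) by apply Rmax_r.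
    assert (s < m). { unfold s; apply Rmax_lub_lt; lra. }
    assert (Hs := Hlt s ltac:(lra)).
    assert (K := Hd' s). rewrite Rabs_left in K by lra. specialize (K ltac:(lra)).
    apply Rabs_def2 in K. lra. }
  destruct (Req_dec m b) as [->|Hmb']; trivial. exfalso.
  destruct (Hl m ltac:(lra)) as [eta [He He']].
  set (t := Rmin b (m + eta / 2)).
  assert (t <= b) by apply Rmin_l. assert (t <= m + eta / 2) by apply Rmin_r.
  assert (m < t). { unfold t; apply Rmin_glb_lt; lra. }
  assert (Et : E t).
  { split; [lra|]. intros s Hs. destruct (Rlt_dec m s).
    - specialize (He' s ltac:(lra)). lra.
    - destruct (Req_dec s m) as [->|]; trivial. apply Hlt; lra. }
  specialize (Hm1 t Et). lra. }
destruct (Rle_dec (h b) (h a)) as [|Hgt]; trivial. exfalso.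
destruct (proj1 (continuous_R_iff h a) (Hc a ltac:(lra)) ((h b - h a)) ltac:(lra)) as [d [Hd Hd']].
set (s := Rmin (a + (b - a) / 2) (a + d / 2)).
assert (s <= a + (b - a) / 2) by apply Rmin_l. assert (s <= a + d / 2) by apply Rmin_r.
assert (a < s). { unfold s; apply Rmin_glb_lt; lra. }
specialize (H1 s ltac:(lra)).
assert (K := Hd' s). rewrite Rabs_right in K by lra. specialize (K ltac:(lra)).
apply Rabs_def2 in K. lra.
Qed.

Lemma nonincreasing_off_finite (h : R -> R) (S : list R) (a b : R) :
  a <= b -> (forall t, a <= t <= b -> continuous h t) ->
  (forall t, a < t < b -> ~ In t S ->
     exists eta, 0 < eta /\ forall t', t < t' < t + eta -> h t' <= h t) ->
  h b <= h a.
Proof.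
revert a b; induction S as [|s S IH]; intros a b Hab Hc Hl.
- apply right_locally_nonincreasing; trivial. intros t Ht. apply Hl; trivial. simpl; tauto.
- destruct (Rlt_dec a s); [destruct (Rlt_dec s b)|].
  + apply Rle_trans with (h s); apply IH; try lra.
    * intros t Ht; apply Hc; lra.
    * intros t Ht Hn. apply Hl; [lra|]. intros [E|E]; [lra|tauto].
    * intros t Ht; apply Hc; lra.
    * intros t Ht Hn. apply Hl; [lra|]. intros [E|E]; [lra|tauto].
  + apply IH; trivial. intros t Ht Hn. apply Hl; [lra|]. intros [E|E]; [lra|tauto].
  + apply IH; trivial. intros t Ht Hn. apply Hl; [lra|]. intros [E|E]; [lra|tauto].
Qed.

(** One strict drop suffices: weak monotonicity holds on the whole interval, and a strict decrease
    occurs in an exception-free gap to the right of [a]. *)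
Lemma decreasing_off_finite (h : R -> R) (S : list R) (a b : R) :
  a < b -> (forall t, a <= t <= b -> continuous h t) ->
  (forall t, a < t < b -> ~ In t S ->
     exists eta, 0 < eta /\ forall t', t < t' < t + eta -> h t' < h t) ->
  h b < h a.
Proof.
intros Hab Hc Hl.
assert (Hw : forall a' b', a <= a' -> a' <= b' -> b' <= b -> h b' <= h a').
{ intros a' b' H1 H2 H3. apply (nonincreasing_off_finite h S); trivial.
  - intros t Ht; apply Hc; lra.
  - intros t Ht Hn. destruct (Hl t ltac:(lra) Hn) as [eta [He He']].
    exists eta; split; trivial. intros t' Ht'. left; now apply He'. }
destruct (right_gap S a) as [c [Hac Hc']].
set (t := Rmin ((a + b) / 2) ((a + c) / 2)).
assert (t <= (a + b) / 2) by apply Rmin_l. assert (t <= (a + c) / 2) by apply Rmin_r.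
assert (a < t). { unfold t; apply Rmin_glb_lt; lra. }
destruct (Hl t ltac:(lra) (Hc' t ltac:(lra))) as [eta [He He']].
set (t' := Rmin b (t + eta / 2)).
assert (t' <= b) by apply Rmin_l. assert (t' <= t + eta / 2) by apply Rmin_r.
assert (t < t'). { unfold t'; apply Rmin_glb_lt; lra. }
assert (h t' < h t) by (apply He'; lra).
assert (h b <= h t') by (apply Hw; lra).
assert (h t <= h a) by (apply Hw; lra).
lra.
Qed.

Lemma derive_neg_right (h : R -> R) (t l : R) :
  is_derive h t l -> l < 0 ->
  exists eta, 0 < eta /\ forall t', t < t' < t + eta -> h t' < h t.
Proof.
intros H Hl. apply is_derive_Reals in H.
destruct (H (- l / 2) ltac:(lra)) as [d Hd].
exists d; split; [apply cond_pos|]. intros t' Ht'.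
specialize (Hd (t' - t) ltac:(lra)).
rewrite Rabs_right in Hd by lra. specialize (Hd ltac:(lra)).
replace (t + (t' - t)) with t' in Hd by ring.
apply Rabs_def2 in Hd. destruct Hd as [Hd _].
assert (Hq : (h t' - h t) / (t' - t) < 0) by lra.
assert (h t' - h t = (h t' - h t) / (t' - t) * (t' - t)) by (field; lra).
nra.
Qed.

Lemma decreasing_derive_off_finite (h h' : R -> R) (S : list R) (a b : R) :
  a < b -> (forall t, a <= t <= b -> continuous h t) ->
  (forall t, a < t < b -> ~ In t S -> is_derive h t (h' t) /\ h' t < 0) ->
  h b < h a.
Proof.
intros Hab Hc Hd. apply (decreasing_off_finite h S); trivial.
intros t Ht Hn. destruct (Hd t Ht Hn) as [H1 H2]. exact (derive_neg_right h t _ H1 H2).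
Qed.

Lemma continuous_if_le {U V : UniformSpace} (s : U -> R) (f g : U -> V) (x : U) :
  continuous s x -> continuous f x -> continuous g x -> (s x = 0 -> f x = g x) ->
  continuous (fun y => if Rle_dec 0 (s y) then f y else g y) x.
Proof.
intros Hs Hf Hg He. apply filterlim_locally. intros e.
assert (Kf := proj1 (filterlim_locally f (f x)) Hf e).
assert (Kg := proj1 (filterlim_locally g (g x)) Hg e).
destruct (Rtotal_order (s x) 0) as [H|[H|H]].
- assert (Ks : locally x (fun y => s y < 0)).
  { apply (Hs (fun r => r < 0)). apply (open_lt 0 (s x) H). }
  generalize (filter_and _ _ Kg Ks). apply filter_imp. intros y [H1 H2].
  destruct (Rle_dec 0 (s x)); [lra|]. destruct (Rle_dec 0 (s y)); [lra|]. exact H1.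
- specialize (He H). generalize (filter_and _ _ Kf Kg). apply filter_imp. intros y [H1 H2].
  destruct (Rle_dec 0 (s x)); [|lra]. destruct (Rle_dec 0 (s y)); [trivial|].
  rewrite He. trivial.
- assert (Ks : locally x (fun y => 0 < s y)).
  { apply (Hs (fun r => 0 < r)). apply (open_gt 0 (s x) H). }
  generalize (filter_and _ _ Kf Ks). apply filter_imp. intros y [H1 H2].
  destruct (Rle_dec 0 (s x)); [|lra]. destruct (Rle_dec 0 (s y)); [|lra]. exact H1.
Qed.

(** Connectedness through monotonicity: the indicator of the complement of [A] is continuous and
    locally constant on [0, 1], so it cannot rise from 0 to 1. *)
Lemma unit_interval_connected (A B : R -> Prop) :
  (forall t, 0 <= t <= 1 -> A t \/ B t) -> (forall t, A t -> B t -> False) ->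
  (forall t, 0 <= t <= 1 -> A t -> locally t A) ->
  (forall t, 0 <= t <= 1 -> B t -> locally t B) ->
  A 0 -> A 1.
Proof.
intros Hor Hand HA HB H0.
set (h := fun t => if excluded_middle_informative (A t) then 0 else 1).
assert (Hh : h 1 <= h 0).
{ apply right_locally_nonincreasing; [lra| |].
  - intros t Ht. destruct (Hor t Ht) as [K|K].
    + apply (continuous_ext_loc _ (fun _ => 0)); [|apply continuous_const].
      generalize (HA t Ht K). apply filter_imp. intros s Hs. unfold h.
      destruct (excluded_middle_informative (A s)); tauto.
    + apply (continuous_ext_loc _ (fun _ => 1)); [|apply continuous_const].
      generalize (HB t Ht K). apply filter_imp. intros s Hs. unfold h.
      destruct (excluded_middle_informative (A s)) as [Hs'|]; [destruct (Hand s Hs' Hs)|reflexivity].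
  - intros t Ht. destruct (Hor t ltac:(lra)) as [K|K].
    + destruct (HA t ltac:(lra) K) as [d Hd]. exists d; split; [apply cond_pos|].
      intros t' Ht'. unfold h.
      destruct (excluded_middle_informative (A t')); destruct (excluded_middle_informative (A t)); try lra; try tauto.
      exfalso; apply n, Hd. change (Rabs (t' - t) < d). rewrite Rabs_right; lra.
    + exists 1; split; [lra|]. intros t' Ht'. unfold h.
      destruct (excluded_middle_informative (A t)) as [K'|]; [destruct (Hand t K' K)|].
      destruct (excluded_middle_informative (A t')); lra. }
unfold h in Hh. destruct (excluded_middle_informative (A 0)); [|tauto].
destruct (excluded_middle_informative (A 1)); [trivial|lra].
Qed.

(** * Angular coordinates *)

(* The argument on the plane slit along the negative real axis, by the
   half-angle formula. *)
Definition slit_arg (x y : R) : R := 2 * atan (y / (sqrt (x ^ 2 + y ^ 2) + x)).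

Lemma slit_pos (x y : R) : y <> 0 \/ 0 < x -> 0 < sqrt (x ^ 2 + y ^ 2) + x.
Proof.
intros H. destruct (Rlt_dec 0 x) as [Hx|Hx].
- assert (0 <= sqrt (x ^ 2 + y ^ 2)) by apply sqrt_pos. lra.
- destruct H as [H|H]; [|lra].
  assert (sqrt ((- x) ^ 2) < sqrt (x ^ 2 + y ^ 2)).
  { apply sqrt_lt_1; nra. }
  rewrite sqrt_pow2 in H0 by lra. lra.
Qed.

Lemma sqrt_polar (r x : R) : 0 < r -> sqrt ((r * cos x) ^ 2 + (r * sin x) ^ 2) = r.
Proof.
intros Hr. replace ((r * cos x) ^ 2 + (r * sin x) ^ 2) with (r ^ 2).
- now apply sqrt_pow2; lra.
- assert (H := sin2_cos2 x). unfold Rsqr in H. nra.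
Qed.

Lemma slit_arg_polar (r x : R) : 0 < r -> - PI < x < PI ->
  slit_arg (r * cos x) (r * sin x) = x.
Proof.
intros Hr Hx. unfold slit_arg. rewrite sqrt_polar by trivial.
assert (Hc : 0 < cos (x / 2)) by (apply cos_gt_0; lra).
assert (Ex : x = 2 * (x / 2)) by field.
replace (r * sin x / (r + r * cos x)) with (tan (x / 2)).
- rewrite atan_tan by lra. lra.
- rewrite Ex at 2 3. rewrite sin_2a, cos_2a_cos. unfold tan. field. split; [|lra].
  replace (r + r * (2 * cos (x / 2) * cos (x / 2) - 1)) with (2 * r * (cos (x / 2) * cos (x / 2))) by ring.
  assert (0 < cos (x / 2) * cos (x / 2)) by nra. apply Rgt_not_eq, Rmult_lt_0_compat; lra.
Qed.

Lemma cos_sin_slit_arg (x y : R) : y <> 0 \/ 0 < x ->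
  x = sqrt (x ^ 2 + y ^ 2) * cos (slit_arg x y) /\
  y = sqrt (x ^ 2 + y ^ 2) * sin (slit_arg x y).
Proof.
intros H. assert (Hp := slit_pos x y H).
set (R0 := sqrt (x ^ 2 + y ^ 2)) in *.
assert (HR : R0 * R0 = x ^ 2 + y ^ 2) by (apply sqrt_def; nra).
assert (HR0 : 0 < R0). { assert (0 <= R0) by apply sqrt_pos. destruct H; nra. }
unfold slit_arg. fold R0. set (b := y / (R0 + x)).
(* The squared cosine of the half-angle is [(R0 + x) / (2 R0)]; this is its inverse. *)
assert (Hb : 1 + b ^ 2 = 2 * R0 / (R0 + x)).
{ unfold b. field_simplify_eq; [|lra]. replace (y ^ 2) with (R0 * R0 - x ^ 2) by lra. ring. }
assert (Hs : sqrt (1 + Rsqr b) * sqrt (1 + Rsqr b) = 2 * R0 / (R0 + x)).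
{ rewrite sqrt_def; unfold Rsqr; nra. }
assert (Hs0 : 0 < sqrt (1 + Rsqr b)) by (apply sqrt_lt_R0; unfold Rsqr; nra).
rewrite cos_2a_cos, sin_2a, cos_atan, sin_atan.
set (q := sqrt (1 + Rsqr b)) in *.
assert (Hq : 1 / q * (1 / q) = (R0 + x) / (2 * R0)).
{ replace (1 / q * (1 / q)) with (/ (q * q)) by (field; lra). rewrite Hs. field. lra. }
split.
- replace (2 * (1 / q) * (1 / q)) with (2 * (1 / q * (1 / q))) by ring. rewrite Hq. field. lra.
- replace (2 * (b / q) * (1 / q)) with (2 * b * (1 / q * (1 / q))) by (field; lra).
  rewrite Hq. unfold b. field. lra.
Qed.

Lemma continuous_slit_arg {U : UniformSpace} (f g : U -> R) (t : U) :
  continuous f t -> continuous g t -> g t <> 0 \/ 0 < f t ->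
  continuous (fun s => slit_arg (f s) (g s)) t.
Proof.
intros Hf Hg H. assert (Hp := slit_pos _ _ H).
apply continuous_Rmult; [apply continuous_const|].
apply (continuous_comp (fun s => g s / (sqrt (f s ^ 2 + g s ^ 2) + f s)) atan).
- apply continuous_Rmult; [trivial|].
  apply (continuous_Rinv_comp' (fun s => sqrt (f s ^ 2 + g s ^ 2) + f s)); [|lra].
  apply continuous_Rplus; trivial.
  apply (continuous_comp (fun s => f s ^ 2 + g s ^ 2) sqrt).
  + apply continuous_Rplus.
    * apply (continuous_ext (fun s => f s * f s)); [intros; simpl; ring|].
      now apply continuous_Rmult.
    * apply (continuous_ext (fun s => g s * g s)); [intros; simpl; ring|].
      now apply continuous_Rmult.
  + apply continuity_pt_filterlim, continuity_pt_sqrt. nra.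
- apply continuity_pt_filterlim. apply derivable_continuous_pt, derivable_pt_atan.
Qed.

Lemma is_derive_slit_arg (X Y : R -> R) (t a b : R) :
  is_derive X t a -> is_derive Y t b -> Y t <> 0 \/ 0 < X t ->
  is_derive (fun s => slit_arg (X s) (Y s)) t ((X t * b - Y t * a) / (X t ^ 2 + Y t ^ 2)).
Proof.
intros HX HY H. assert (Hp := slit_pos _ _ H).
assert (Hn : 0 < X t ^ 2 + Y t ^ 2) by (destruct H; nra).
unfold slit_arg.
assert (EX := is_derive_unique _ _ _ HX). assert (EY := is_derive_unique _ _ _ HY).
auto_derive.
- repeat split; try (now exists a); try (now exists b); simpl in *; lra.
- change (Derive (fun x : R => X x) t) with (Derive X t).
  change (Derive (fun x : R => Y x) t) with (Derive Y t). rewrite EX, EY.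
  simpl in Hp, Hn.
  set (R0 := sqrt (X t * (X t * 1) + Y t * (Y t * 1))) in *.
  assert (HR : R0 ^ 2 = X t ^ 2 + Y t ^ 2).
  { simpl. rewrite Rmult_1_r. unfold R0. rewrite sqrt_def; lra. }
  assert (HR0 : 0 < R0) by (apply sqrt_lt_R0; lra).
  set (x := X t) in *. set (y := Y t) in *.
  rewrite <- HR.
  assert (Hden : (R0 + x) ^ 2 + y ^ 2 = 2 * R0 * (R0 + x)) by (replace (y ^ 2) with (R0 ^ 2 - x ^ 2) by lra; ring).
  unfold Rsqr.
  replace (1 + y * / (R0 + x) * (y * / (R0 + x) * 1)) with (2 * R0 / (R0 + x)).
  2:{ apply (Rmult_eq_reg_r ((R0 + x) ^ 2)); [|apply pow_nonzero; lra]. field_simplify; try lra. }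
  field_simplify_eq; [|split; lra].
  replace (y ^ 2) with (R0 ^ 2 - x ^ 2) by lra. ring.
Qed.

(* The argument folded to [0, PI]: it takes the same value at [w] and [Cconj w]. *)
Definition ang (w : C) : R := PI / 2 - slit_arg (Rabs (Im w)) (Re w).

(** With the coordinates exchanged, [(|Im w|, Re w)] lies in the closed right half-plane, off the
    slit for every nonzero [w]. This is why [ang] is continuous across the negative real axis
    too. *)
Lemma C_nonzero_slit (w : C) : w <> RtoC 0 -> Re w <> 0 \/ 0 < Rabs (Im w).
Proof.
intros H. destruct (Req_dec (Re w) 0) as [E|E]; [|now left]. right.
apply Rabs_pos_lt. intros E'. apply H. destruct w; simpl in *; subst; reflexivity.
Qed.

Lemma ang_polar_abs (w : C) (r x : R) : 0 < r -> 0 <= x <= PI ->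
  Re w = r * cos x -> Rabs (Im w) = r * sin x -> ang w = x.
Proof.
intros Hr Hx H1 H2. unfold ang. rewrite H1, H2.
replace (r * sin x) with (r * cos (PI / 2 - x)) by now rewrite cos_shift.
replace (r * cos x) with (r * sin (PI / 2 - x)) by now rewrite sin_shift.
assert (HP := PI_RGT_0). rewrite slit_arg_polar; lra.
Qed.

Lemma Cmod_sqrt_abs (w : C) : sqrt (Rabs (Im w) ^ 2 + Re w ^ 2) = Cmod w.
Proof. unfold Cmod. f_equal. rewrite pow2_abs. unfold Re, Im. ring. Qed.

Lemma ang_spec (w : C) : w <> RtoC 0 ->
  0 <= ang w <= PI /\ Re w = Cmod w * cos (ang w) /\ Rabs (Im w) = Cmod w * sin (ang w).
Proof.
intros H. assert (H' := C_nonzero_slit w H).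
destruct (cos_sin_slit_arg (Rabs (Im w)) (Re w) H') as [H1 H2].
rewrite Cmod_sqrt_abs in H1, H2.
assert (Hm : 0 < Cmod w) by now apply Cmod_gt_0.
assert (Hr : - PI < slit_arg (Rabs (Im w)) (Re w) < PI).
{ unfold slit_arg. match goal with |- context [atan ?u] => destruct (atan_bound u) end. lra. }
unfold ang. set (s := slit_arg (Rabs (Im w)) (Re w)) in *.
assert (Hc : 0 <= cos s). { assert (0 <= Rabs (Im w)) by apply Rabs_pos. nra. }
split; [|split].
- destruct (Rlt_dec (PI / 2) s) as [K|K].
  { assert (cos s < 0) by (apply cos_lt_0; lra). lra. }
  destruct (Rlt_dec s (- (PI / 2))) as [K'|K'].
  { assert (cos (- s) < 0) by (apply cos_lt_0; lra). rewrite cos_neg in H0. lra. }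
  lra.
- now rewrite cos_shift.
- now rewrite sin_shift.
Qed.

Lemma polar_upper (w : C) : w <> RtoC 0 -> 0 <= Im w -> w = (RtoC (Cmod w) * cis (ang w))%C.
Proof.
intros H Hi. destruct (ang_spec w H) as [_ [H1 H2]]. rewrite Rabs_right in H2 by lra.
destruct w as [x y]; simpl in H1, H2, Hi. unfold cis, Cmult. simpl. f_equal; lra.
Qed.

Lemma polar_lower (w : C) : w <> RtoC 0 -> Im w <= 0 -> w = (RtoC (Cmod w) * cis (- ang w))%C.
Proof.
intros H Hi. destruct (ang_spec w H) as [_ [H1 H2]]. rewrite Rabs_left1 in H2 by lra.
destruct w as [x y]; simpl in H1, H2, Hi. unfold cis, Cmult. simpl.
rewrite cos_neg, sin_neg. f_equal; lra.
Qed.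

Lemma continuous_ang {U : UniformSpace} (f : U -> C) (t : U) :
  continuous_C f t -> f t <> RtoC 0 -> continuous (fun s => ang (f s)) t.
Proof.
intros Hf H0. apply continuous_C_components in Hf. destruct Hf as [H1 H2].
apply continuous_Rminus; [apply continuous_const|].
apply (continuous_slit_arg (fun s => Rabs (Im (f s))) (fun s => Re (f s))); trivial.
- now apply (continuous_comp (fun s => Im (f s)) Rabs); [|apply continuous_Rabs].
- now apply C_nonzero_slit.
Qed.

Lemma is_derive_ang (f : R -> C) (t : R) (v : C) : is_derive_C f t v -> Im (f t) <> 0 ->
  is_derive (fun s => ang (f s)) t (sign (Im (f t)) * (Im (v * Cconj (f t))%C / Cmod (f t) ^ 2)).
Proof.
intros Hf H0. assert (Hc := is_derive_C_continuous _ _ _ Hf).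
apply continuous_C_components in Hc. destruct Hc as [_ Hc].
apply is_derive_C_components in Hf. destruct Hf as [H1 H2].
rewrite Cmod2_alt.
assert (Hn : Re (f t) ^ 2 + Im (f t) ^ 2 <> 0) by nra.
destruct (Rlt_dec 0 (Im (f t))) as [K|K].
- rewrite sign_eq_1 by trivial.
  apply (is_derive_ext_loc (fun s => PI / 2 - slit_arg (Im (f s)) (Re (f s)))).
  { apply (filter_imp (fun s => 0 < Im (f s))).
    - intros s Hs. unfold ang. now rewrite (Rabs_right (Im (f s))) by lra.
    - apply (Hc (fun r => 0 < r)), (open_gt 0 _ K). }
  evar_last.
  { apply (is_derive_minus (V := R_NormedModule)); [apply is_derive_const|].
    apply (is_derive_slit_arg (fun s => Im (f s)) (fun s => Re (f s)) t _ _ H2 H1). now right. }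
  unfold minus, plus, opp, zero, Re, Im in *; simpl in *. field. nra.
- rewrite sign_eq_m1 by lra.
  apply (is_derive_ext_loc (fun s => PI / 2 - slit_arg (- Im (f s)) (Re (f s)))).
  { apply (filter_imp (fun s => Im (f s) < 0)).
    - intros s Hs. unfold ang. now rewrite (Rabs_left (Im (f s))) by lra.
    - apply (Hc (fun r => r < 0)), (open_lt 0 (Im (f t))). lra. }
  evar_last.
  { apply (is_derive_minus (V := R_NormedModule)); [apply is_derive_const|].
    apply (is_derive_slit_arg (fun s => - Im (f s)) (fun s => Re (f s)) t (- Im v) (Re v)).
    - apply (is_derive_opp (V := R_NormedModule) _ _ _ H2).
    - exact H1.
    - right; lra. }
  unfold minus, plus, opp, zero, Re, Im in *; simpl in *. field. nra.
Qed.

(** * Picard iteration on an interval *)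

Lemma ex_RInt_cont (f : R -> R) (a b : R) : (forall x, continuous f x) -> ex_RInt f a b.
Proof. intros H. apply (ex_RInt_continuous (V := R_CompleteNormedModule)). intros; apply H. Qed.

Lemma RInt_close (f g : R -> R) (c M : R) :
  (forall x, continuous f x) -> (forall x, continuous g x) -> 0 <= c ->
  (forall x, 0 <= x <= c -> Rabs (f x - g x) <= M) ->
  Rabs (RInt f 0 c - RInt g 0 c) <= c * M.
Proof.
intros Hf Hg Hc H.
change (RInt f 0 c - RInt g 0 c) with (minus (RInt f 0 c) (RInt g 0 c)).
rewrite <- (RInt_minus (V := R_CompleteNormedModule)) by now apply ex_RInt_cont.
replace (c * M) with ((c - 0) * M) by ring.
apply abs_RInt_le_const; trivial.
apply (ex_RInt_minus (V := R_NormedModule)); now apply ex_RInt_cont.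
Qed.

Lemma is_derive_RInt_cont (f : R -> R) (a x : R) : (forall x, continuous f x) ->
  is_derive (fun y => RInt f a y) x (f x).
Proof.
intros H. apply (is_derive_RInt (V := R_NormedModule) f (fun y => RInt f a y) a x).
- exists (mkposreal 1 Rlt_0_1). intros y _.
  apply (RInt_correct (V := R_CompleteNormedModule)). now apply ex_RInt_cont.
- apply H.
Qed.

Lemma continuous_RInt_cont (f : R -> R) (a x : R) : (forall x, continuous f x) ->
  continuous (fun y => RInt f a y) x.
Proof.
intros H. apply (ex_derive_continuous (V := R_NormedModule)).
exists (f x). now apply is_derive_RInt_cont.
Qed.

(** The tail of the geometric series, [2 A / 2^n], is subtracted to obtain an increasing sequence
    and added to obtain a decreasing one. The limit lies between them, which also yields the error
    bound. *)
Lemma geometric_limit (u : nat -> R) (A : R) :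
  (forall n, Rabs (u (S n) - u n) <= A * (/ 2) ^ n) ->
  exists l : R, is_lim_seq u l /\ forall n, Rabs (l - u n) <= 2 * A * (/ 2) ^ n.
Proof.
intros H.
assert (Hb : forall n, - (A * (/ 2) ^ n) <= u (S n) - u n <= A * (/ 2) ^ n) by (intros n; now apply Rabs_le_between).
set (v := fun n => u n - 2 * A * (/ 2) ^ n). set (w := fun n => u n + 2 * A * (/ 2) ^ n).
assert (Hv : forall n, v n <= v (S n)) by (intros n; specialize (Hb n); unfold v; simpl; lra).
assert (Hw : forall n, w (S n) <= w n) by (intros n; specialize (Hb n); unfold w; simpl; lra).
assert (HA : forall n, 0 <= A * (/ 2) ^ n) by (intros n; specialize (Hb n); lra).
assert (Hvw : forall n, v n <= w 0%nat).
{ intros n. apply Rle_trans with (w n); [specialize (HA n); unfold v, w; lra|].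
  induction n as [|n IH]; [lra|]. specialize (Hw n). lra. }
destruct (ex_finite_lim_seq_incr v (w 0%nat) Hv Hvw) as [l Hl].
assert (Hz : is_lim_seq (fun n => 2 * A * (/ 2) ^ n) (2 * A * 0)).
{ apply (is_lim_seq_scal_l _ (2 * A) 0), is_lim_seq_geom. rewrite Rabs_right; lra. }
assert (Hu : is_lim_seq u l).
{ replace (Finite l) with (Finite (l + 2 * A * 0)) by (f_equal; ring).
  apply (is_lim_seq_ext (fun n => v n + 2 * A * (/ 2) ^ n)); [intros n; unfold v; ring|].
  now apply is_lim_seq_plus'. }
assert (Hlw : is_lim_seq w l).
{ replace (Finite l) with (Finite (l + 2 * A * 0)) by (f_equal; ring). now apply is_lim_seq_plus'. }
exists l. split; [trivial|]. intros n. apply Rabs_le.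
assert (K1 := is_lim_seq_incr_compare v l Hl Hv n). assert (K2 := is_lim_seq_decr_compare w l Hlw Hw n).
unfold v, w in K1, K2. lra.
Qed.

(** Clamping the time makes the Picard iterates continuous on the whole line; clamping the radius
    makes the field globally bounded and Lipschitz. Neither changes the solution in the range where
    it is used. *)
Definition clamp (a b x : R) : R := Rmax a (Rmin b x).

Lemma clamp_range a b x : a <= b -> a <= clamp a b x <= b.
Proof. intros H. unfold clamp. split; [apply Rmax_l|]. apply Rmax_lub; trivial. apply Rmin_l. Qed.

Lemma clamp_id a b x : a <= x <= b -> clamp a b x = x.
Proof. intros H. unfold clamp. rewrite Rmin_right, Rmax_right; lra. Qed.

Lemma clamp_lipschitz a b x y : Rabs (clamp a b x - clamp a b y) <= Rabs (x - y).
Proof.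
unfold clamp, Rmax, Rmin.
destruct (Rle_dec b x); destruct (Rle_dec b y);
repeat match goal with |- context [Rle_dec ?u ?v] => destruct (Rle_dec u v) end;
unfold Rabs; repeat match goal with |- context [Rcase_abs ?u] => destruct (Rcase_abs u) end; lra.
Qed.

Lemma lipschitz_continuous (f : R -> R) (L : R) (x : R) :
  (forall x y, Rabs (f x - f y) <= L * Rabs (x - y)) -> continuous f x.
Proof.
intros H. apply continuous_R_iff. intros e He.
assert (HL : 0 <= L). { assert (K := H 1 0). assert (K0 := Rabs_pos (f 1 - f 0)). rewrite (Rabs_right (1 - 0)) in K by lra. lra. }
exists (e / (L + 1)). split; [apply Rdiv_lt_0_compat; lra|].
intros s Hs. eapply Rle_lt_trans; [apply H|].
assert (Hs' : Rabs (s - x) * (L + 1) < e).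
{ apply (Rmult_lt_reg_r (/ (L + 1))); [apply Rinv_0_lt_compat; lra|].
  rewrite Rmult_assoc, Rinv_r, Rmult_1_r by lra. exact Hs. }
assert (0 <= Rabs (s - x)) by apply Rabs_pos. lra.
Qed.

Section Picard.

Variables (G : R -> R -> R) (L B l : R).
Hypothesis Hl : 0 < l.
Hypothesis HL : l * L <= / 2.
Hypothesis Glip : forall r r' x, Rabs (G r x - G r' x) <= L * Rabs (r - r').
Hypothesis Gbound : forall r x, Rabs (G r x) <= B.
Hypothesis Gcont : forall y : R -> R, (forall x, continuous y x) ->
  forall x, continuous (fun x => G (y x) x) x.

Fixpoint picard_iter (n : nat) (xi x : R) : R :=
  match n with
  | O => xi
  | S n => xi + RInt (fun t => G (picard_iter n xi t) t) 0 (clamp 0 l x)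
  end.

Lemma picard_integral_continuous (y : R -> R) (xi x : R) : (forall x, continuous y x) ->
  continuous (fun x => xi + RInt (fun t => G (y t) t) 0 (clamp 0 l x)) x.
Proof.
intros Hy. apply continuous_Rplus; [apply continuous_const|].
apply (continuous_comp (fun x => clamp 0 l x) (fun y0 => RInt (fun t => G (y t) t) 0 y0)).
- apply (lipschitz_continuous _ 1). intros. rewrite Rmult_1_l. apply clamp_lipschitz.
- apply continuous_RInt_cont. now apply Gcont.
Qed.

Lemma picard_iter_continuous n xi x : continuous (picard_iter n xi) x.
Proof.
revert x; induction n as [|n IH]; intros x.
- apply continuous_const.
- now apply picard_integral_continuous.
Qed.

Lemma picard_integrand_continuous n xi x : continuous (fun t => G (picard_iter n xi t) t) x.
Proof. apply Gcont. apply picard_iter_continuous. Qed.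

Lemma picard_L_nonneg : 0 <= L.
Proof. assert (K := Glip 1 0 0). assert (K0 := Rabs_pos (G 1 0 - G 0 0)). rewrite (Rabs_right (1 - 0)) in K by lra. lra. Qed.

(** [l * L <= 1/2] makes the integral operator a contraction on all of [0, l]. The Lipschitz
    constant of the half-system is of order eps, so [0, PI] needs no subdivision. *)
Lemma picard_step (f g : R -> R) (M x : R) :
  (forall x, continuous f x) -> (forall x, continuous g x) ->
  (forall x, Rabs (f x - g x) <= M) ->
  Rabs (RInt (fun t => G (f t) t) 0 (clamp 0 l x) - RInt (fun t => G (g t) t) 0 (clamp 0 l x)) <= M / 2.
Proof.
intros Hf Hg HM. assert (HL0 := picard_L_nonneg).
assert (HM0 : 0 <= M) by (generalize (HM 0) (Rabs_pos (f 0 - g 0)); lra).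
assert (Hr := clamp_range 0 l x ltac:(lra)).
eapply Rle_trans.
- apply (RInt_close _ _ _ (L * M)); [now apply Gcont|now apply Gcont|lra|].
  intros t _. eapply Rle_trans; [apply Glip|]. apply Rmult_le_compat_l; trivial.
- assert (0 <= L * M) by nra. nra.
Qed.

Lemma picard_iter_step n xi x :
  Rabs (picard_iter (S n) xi x - picard_iter n xi x) <= (l * B) * (/ 2) ^ n.
Proof.
revert x; induction n as [|n IH]; intros x.
- simpl picard_iter. assert (E : forall a b : R, a + b - a = b) by (intros; ring). rewrite E. clear E.
  assert (Hr := clamp_range 0 l x ltac:(lra)).
  eapply Rle_trans.
  + apply (abs_RInt_le_const _ _ _ B); [lra| |intros; apply Gbound].
    apply ex_RInt_cont. apply (picard_integrand_continuous 0 xi).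
  + assert (0 <= B) by (generalize (Gbound 0 0) (Rabs_pos (G 0 0)); lra). simpl. nra.
- change (Rabs ((xi + RInt (fun t => G (picard_iter (S n) xi t) t) 0 (clamp 0 l x))
   - (xi + RInt (fun t => G (picard_iter n xi t) t) 0 (clamp 0 l x))) <= l * B * (/ 2) ^ S n).
  assert (E : forall a b c : R, a + b - (a + c) = b - c) by (intros; ring). rewrite E. clear E.
  eapply Rle_trans.
  + apply (picard_step _ _ (l * B * (/ 2) ^ n)); trivial; apply picard_iter_continuous.
  + simpl. lra.
Qed.

Definition picard (xi x : R) : R := real (Lim_seq (fun n => picard_iter n xi x)).

Lemma picard_lim xi x : is_lim_seq (fun n => picard_iter n xi x) (picard xi x) /\
  forall n, Rabs (picard xi x - picard_iter n xi x) <= 2 * (l * B) * (/ 2) ^ n.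
Proof.
destruct (geometric_limit (fun n => picard_iter n xi x) (l * B)) as [r [H1 H2]].
- intros n; apply picard_iter_step.
- assert (E : picard xi x = r) by (unfold picard; now rewrite (is_lim_seq_unique _ _ H1)).
  rewrite E. now split.
Qed.

Lemma picard_continuous xi x : continuous (picard xi) x.
Proof.
apply continuous_R_iff. intros e He.
destruct (proj1 (is_lim_seq_Reals (fun n => 2 * (l * B) * (/ 2) ^ n) (2 * (l * B) * 0))) with (e / 3) as [N HN].
{ apply (is_lim_seq_scal_l _ (2 * (l * B)) 0). apply is_lim_seq_geom. rewrite Rabs_right; lra. }
{ lra. }
specialize (HN N (le_n _)). unfold Rdist in HN. rewrite Rmult_0_r, Rminus_0_r in HN.
assert (HN' := Rle_lt_trans _ _ _ (Rle_abs _) HN).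
destruct (proj1 (continuous_R_iff _ _) (picard_iter_continuous N xi x) (e / 3) ltac:(lra)) as [d [Hd Hd']].
exists d; split; trivial. intros s Hs. specialize (Hd' s Hs).
destruct (picard_lim xi s) as [_ Ks]. destruct (picard_lim xi x) as [_ Kx].
specialize (Ks N). specialize (Kx N).
replace (picard xi s - picard xi x) with
  ((picard xi s - picard_iter N xi s) + (picard_iter N xi s - picard_iter N xi x) + - (picard xi x - picard_iter N xi x)) by ring.
eapply Rle_lt_trans; [apply Rabs_triang|]. rewrite Rabs_Ropp.
assert (T := Rabs_triang (picard xi s - picard_iter N xi s) (picard_iter N xi s - picard_iter N xi x)). lra.
Qed.

Lemma picard_equation xi x :
  picard xi x = xi + RInt (fun t => G (picard xi t) t) 0 (clamp 0 l x).
Proof.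
set (v := xi + RInt (fun t => G (picard xi t) t) 0 (clamp 0 l x)).
assert (Hv : is_lim_seq (fun n => picard_iter (S n) xi x) v).
{ apply (is_lim_seq_le_le (fun n => v - l * B * (/ 2) ^ n) _ (fun n => v + l * B * (/ 2) ^ n)).
  - intros n.
    assert (K := picard_step (picard xi) (picard_iter n xi) (2 * (l * B) * (/ 2) ^ n) x
      (picard_continuous xi) (picard_iter_continuous n xi)
      (fun y => proj2 (picard_lim xi y) n)).
    apply Rabs_le_between in K. simpl picard_iter. unfold v. lra.
  - replace (Finite v) with (Finite (v - l * B * 0)) by (f_equal; ring).
    apply is_lim_seq_minus'; [apply is_lim_seq_const|].
    apply (is_lim_seq_scal_l _ (l * B) 0). apply is_lim_seq_geom. rewrite Rabs_right; lra.
  - replace (Finite v) with (Finite (v + l * B * 0)) by (f_equal; ring).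
    apply is_lim_seq_plus'; [apply is_lim_seq_const|].
    apply (is_lim_seq_scal_l _ (l * B) 0). apply is_lim_seq_geom. rewrite Rabs_right; lra. }
assert (Hp := proj1 (is_lim_seq_incr_1 _ _) (proj1 (picard_lim xi x))).
apply is_lim_seq_unique in Hv. apply is_lim_seq_unique in Hp.
rewrite Hp in Hv. now injection Hv.
Qed.

Lemma picard_range xi x : Rabs (picard xi x - xi) <= l * B.
Proof.
assert (Hr := clamp_range 0 l x ltac:(lra)).
assert (HB : 0 <= B) by (generalize (Gbound 0 0) (Rabs_pos (G 0 0)); lra).
rewrite picard_equation.
assert (E : forall a b : R, a + b - a = b) by (intros; ring). rewrite E. clear E.
eapply Rle_trans.
- apply (abs_RInt_le_const _ _ _ B); [lra| |intros; apply Gbound].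
  apply ex_RInt_cont. apply Gcont, picard_continuous.
- nra.
Qed.

Lemma is_derive_picard xi x : 0 < x < l -> is_derive (picard xi) x (G (picard xi x) x).
Proof.
intros Hx.
apply (is_derive_ext_loc (fun y => xi + RInt (fun t => G (picard xi t) t) 0 y)).
- apply (filter_imp (fun y => 0 < y /\ y < l)).
  + intros y Hy. rewrite (picard_equation xi y), clamp_id by lra. reflexivity.
  + apply filter_and; [apply (open_gt 0)|apply (open_lt l)]; lra.
- evar_last.
  + apply (is_derive_plus (V := R_NormedModule)); [apply is_derive_const|].
    apply (is_derive_RInt_cont (fun t => G (picard xi t) t)). apply Gcont, picard_continuous.
  + unfold plus, zero; simpl. ring.
Qed.

(** The constant 2 is stable under iteration: the initial difference plus half of twice itself is
    twice itself. Lipschitz dependence is all that the intermediate value theorem asks for. *)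
Lemma picard_lipschitz_initial xi xi' x :
  Rabs (picard xi x - picard xi' x) <= 2 * Rabs (xi - xi').
Proof.
assert (H : forall n x, Rabs (picard_iter n xi x - picard_iter n xi' x) <= 2 * Rabs (xi - xi')).
{ assert (H0 := Rabs_pos (xi - xi')).
  intros n; induction n as [|n IH]; intros y.
  - simpl. lra.
  - simpl picard_iter.
    assert (K := picard_step _ _ _ y (picard_iter_continuous n xi) (picard_iter_continuous n xi') IH).
    assert (E : forall a b c d : R, a + b - (c + d) = (a - c) + (b - d)) by (intros; ring). rewrite E. clear E.
    eapply Rle_trans; [apply Rabs_triang|]. lra. }
assert (Hl' : is_lim_seq (fun n => Rabs (picard_iter n xi x - picard_iter n xi' x)) (Rabs (picard xi x - picard xi' x))).
{ apply (is_lim_seq_abs _ (picard xi x - picard xi' x)).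
  apply is_lim_seq_minus'; apply picard_lim. }
apply (is_lim_seq_le _ (fun _ => 2 * Rabs (xi - xi')) (Rabs (picard xi x - picard xi' x)) (2 * Rabs (xi - xi')) (fun n => H n x)); trivial.
apply is_lim_seq_const.
Qed.

End Picard.

(** * The unit circle and the modulus *)

Lemma cis_mul_neg (x : R) : (cis x * cis (- x))%C = RtoC 1.
Proof.
assert (H := sin2_cos2 x). unfold Rsqr in H.
apply C_eq; simpl; rewrite cos_neg, sin_neg; lra.
Qed.

Lemma Cconj_cis (x : R) : Cconj (cis x) = cis (- x).
Proof. apply C_eq; simpl; now rewrite ?cos_neg, ?sin_neg. Qed.

Lemma Cmod_cis (x : R) : Cmod (cis x) = 1.
Proof.
assert (H := sin2_cos2 x). unfold Rsqr in H. unfold Cmod, cis; simpl.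
transitivity (sqrt 1); [f_equal; lra|apply sqrt_1].
Qed.

Lemma Cmod_polar (r x : R) : 0 <= r -> Cmod (RtoC r * cis x)%C = r.
Proof. intros Hr. rewrite Cmod_mult, Cmod_cis, Cmod_R, Rabs_right; lra. Qed.

Lemma is_derive_Cmod (f : R -> C) (t : R) (v : C) : is_derive_C f t v -> f t <> RtoC 0 ->
  is_derive (fun s => Cmod (f s)) t (Re (v * Cconj (f t))%C / Cmod (f t)).
Proof.
intros Hf H0. assert (Hn := C_neq_0_norm2 _ H0).
apply is_derive_C_components in Hf. destruct Hf as [H1 H2].
assert (Hp : 0 < fst (f t) ^ 2 + snd (f t) ^ 2) by nra.
unfold Cmod. evar_last.
{ apply (is_derive_sqrt (fun s => fst (f s) ^ 2 + snd (f s) ^ 2)); [|exact Hp].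
  apply (is_derive_plus (V := R_NormedModule)).
  - apply (is_derive_pow (fun s => fst (f s)) 2 _ _ H1).
  - apply (is_derive_pow (fun s => snd (f s)) 2 _ _ H2). }
assert (Hs : 0 < sqrt (fst (f t) ^ 2 + snd (f t) ^ 2)) by now apply sqrt_lt_R0.
unfold scal, plus; simpl; unfold mult, Re, Im; simpl. field. simpl in Hs; lra.
Qed.

(** * One half-plane in polar coordinates *)

(* Both halves are written as rotation_field eps Q on 0 <= arg <= PI: for the
   upper one Q is minus the perturbation and time is reversed, the lower one is
   reflected by complex conjugation. *)
Definition polar_part (Q : C -> C) (r x : R) : C := (Q (RtoC r * cis x) * cis (- x))%C.

(* The orbits satisfy dr/dx = eps * radial and dt/dx = angle_time. *)
Definition radial (eps : R) (Q : C -> C) (r x : R) : R :=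
  r * Re (polar_part Q r x) / (r + eps * Im (polar_part Q r x)).

Definition angle_time (eps : R) (Q : C -> C) (r x : R) : R :=
  r / (r + eps * Im (polar_part Q r x)).

Definition rotation_field (eps : R) (Q : C -> C) (w : C) : C := (Ci * w + RtoC eps * Q w)%C.

Lemma rotation_field_polar eps Q (r x : R) :
  rotation_field eps Q (RtoC r * cis x)%C =
  ((RtoC (eps * Re (polar_part Q r x)) + Ci * RtoC (r + eps * Im (polar_part Q r x))) * cis x)%C.
Proof.
unfold rotation_field.
assert (E : Q (RtoC r * cis x)%C = (polar_part Q r x * cis x)%C).
{ unfold polar_part. rewrite <- Cmult_assoc, (Cmult_comm (cis (- x))), cis_mul_neg. ring. }
rewrite E. destruct (polar_part Q r x) as [u v]. apply C_eq; simpl; ring.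
Qed.

(** For a velocity [w'] the product [w' * Cconj w] has real part [r r'] and imaginary part
    [r^2 theta'], so both polar components are read off without dividing. *)
Lemma rotation_field_conj eps Q (r x : R) : 0 < r ->
  Re (rotation_field eps Q (RtoC r * cis x) * Cconj (RtoC r * cis x))%C = r * (eps * Re (polar_part Q r x)) /\
  Im (rotation_field eps Q (RtoC r * cis x) * Cconj (RtoC r * cis x))%C = r * (r + eps * Im (polar_part Q r x)).
Proof.
intros Hr. rewrite rotation_field_polar.
set (p := polar_part Q r x).
assert (E : ((RtoC (eps * Re p) + Ci * RtoC (r + eps * Im p)) * cis x * Cconj (RtoC r * cis x) =
  RtoC r * (RtoC (eps * Re p) + Ci * RtoC (r + eps * Im p)))%C).
{ rewrite Cmult_conj, Cconj_cis. replace (Cconj (RtoC r)) with (RtoC r) by (apply C_eq; simpl; ring).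
  transitivity (RtoC r * (RtoC (eps * Re p) + Ci * RtoC (r + eps * Im p)) * (cis x * cis (- x)))%C; [ring|].
  rewrite cis_mul_neg. ring. }
rewrite E. destruct p as [u v]. simpl. split; ring.
Qed.

Section Half.

Variables (eps ra rb L : R) (Q : C -> C).
Hypothesis Heps : 0 < eps.
Hypothesis Hra : 0 < ra.
Hypothesis HQ : forall w, ra <= Cmod w <= rb -> Cmod (Q w) <= L.
Hypothesis HL : eps * L <= ra / 2.

Lemma polar_part_bound r x : ra <= r <= rb -> Cmod (polar_part Q r x) <= L.
Proof.
intros Hr. unfold polar_part. rewrite Cmod_mult, Cmod_cis, Rmult_1_r. apply HQ.
rewrite Cmod_polar; lra.
Qed.

Lemma im_polar_part_bound r x : ra <= r <= rb -> Rabs (eps * Im (polar_part Q r x)) <= ra / 2.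
Proof.
intros Hr. rewrite Rabs_mult, (Rabs_right eps) by lra.
assert (H := polar_part_bound r x Hr).
assert (H' := Rmax_Cmod (polar_part Q r x)).
assert (H'' := Rmax_r (Rabs (fst (polar_part Q r x))) (Rabs (snd (polar_part Q r x)))).
unfold Im. nra.
Qed.

(** The perturbation changes the angular speed by at most half, so the angle can serve as the
    independent variable. *)
Lemma angle_speed_pos r x : ra <= r <= rb -> r / 2 <= r + eps * Im (polar_part Q r x) <= 3 / 2 * r.
Proof. intros Hr. assert (H := im_polar_part_bound r x Hr). apply Rabs_le_between in H. lra. Qed.

Lemma angle_time_bound r x : ra <= r <= rb -> 2 / 3 <= angle_time eps Q r x <= 2.
Proof.
intros Hr. assert (H := angle_speed_pos r x Hr). unfold angle_time.
set (d := r + _) in *. assert (0 < d) by lra.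
split; apply (Rmult_le_reg_r d); trivial; unfold Rdiv; rewrite ?(Rmult_assoc r), Rinv_l by lra; lra.
Qed.

(** [sg] is the direction of time: -1 on the upper half, 1 on the conjugated lower half. It rescales
    both polar velocities, so the slope dr/dx does not depend on it, while the angular velocity
    takes its sign. *)
Lemma is_derive_half_polar (W : R -> C) (t sg : R) :
  is_derive_C W t (RtoC sg * rotation_field eps Q (W t))%C -> 0 < Im (W t) ->
  ra <= Cmod (W t) <= rb ->
  exists x1, is_derive (fun s => ang (W s)) t x1 /\
    is_derive (fun s => Cmod (W s)) t (eps * radial eps Q (Cmod (W t)) (ang (W t)) * x1) /\
    (sg <> 0 -> 0 < sg * x1).
Proof.
intros HW HI Hr.
assert (H0 : W t <> RtoC 0). { intros E. rewrite E in HI. simpl in HI. lra. }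
assert (HA := is_derive_ang _ _ _ HW ltac:(lra)).
assert (HM := is_derive_Cmod _ _ _ HW H0).
rewrite sign_eq_1, Rmult_1_l in HA by trivial.
set (r := Cmod (W t)) in *. set (x := ang (W t)) in *.
assert (E : W t = (RtoC r * cis x)%C) by (apply polar_upper; [trivial|lra]).
destruct (rotation_field_conj eps Q r x ltac:(lra)) as [K1 K2]. rewrite <- E in K1, K2.
assert (S1 : forall u : C, Re (RtoC sg * u)%C = sg * Re u) by (intros [? ?]; simpl; ring).
assert (S2 : forall u : C, Im (RtoC sg * u)%C = sg * Im u) by (intros [? ?]; simpl; ring).
rewrite <- Cmult_assoc, S2, K2 in HA. rewrite <- Cmult_assoc, S1, K1 in HM.
assert (Hs := angle_speed_pos r x Hr).
eexists; split; [exact HA|split].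
- evar_last; [exact HM|]. unfold radial. field. lra.
- intros Hsg. set (d := r + _) in *.
  replace (sg * (sg * (r * d) / r ^ 2)) with (sg ^ 2 * (d / r)) by (field; lra).
  apply Rmult_lt_0_compat; [nra|]. apply Rdiv_lt_0_compat; lra.
Qed.

Lemma is_derive_polar_arc (rho : R -> R) (x : R) :
  is_derive rho x (eps * radial eps Q (rho x) x) -> ra <= rho x <= rb ->
  is_derive_C (fun y => RtoC (rho y) * cis y)%C x
    (RtoC (angle_time eps Q (rho x) x) * rotation_field eps Q (RtoC (rho x) * cis x))%C.
Proof.
intros H Hr. assert (Hs := angle_speed_pos (rho x) x Hr).
rewrite rotation_field_polar.
assert (H1 : is_derive_C (fun y => RtoC (rho y)) x (RtoC (eps * radial eps Q (rho x) x))).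
{ apply is_derive_C_components; split; simpl; [exact H|apply (is_derive_const (V := R_NormedModule))]. }
assert (H2 : is_derive_C cis x (Ci * cis x)%C).
{ apply is_derive_C_components; split; simpl; auto_derive; trivial; ring. }
evar_last; [apply (is_derive_C_mult _ _ _ _ _ H1 H2)|].
unfold radial, angle_time. set (d := rho x + _) in *. set (u := Re _).
assert (Hd : d <> 0) by lra.
apply C_eq; simpl; field; trivial.
Qed.

End Half.

(* Along an orbit the derivative of the distance to [rho] is, up to the factor
   [eps * x'], [(a x + O(kappa)) * (r - rho x)]; the exponential weight replaces
   [a] by the constant [c]. *)
Lemma lyapunov_half (G : R -> R -> R) (rho a A r x : R -> R) (eps c kappa t x1 : R) :
  0 < eps -> kappa < Rabs c ->
  is_derive x t x1 -> is_derive r t (eps * G (r t) (x t) * x1) ->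
  is_derive rho (x t) (eps * G (rho (x t)) (x t)) ->
  is_derive A (x t) (a (x t) - c) ->
  Rabs (G (r t) (x t) - G (rho (x t)) (x t) - a (x t) * (r t - rho (x t)))
    <= kappa * Rabs (r t - rho (x t)) ->
  r t - rho (x t) <> 0 -> x1 <> 0 ->
  exists l, is_derive (fun s => ((r s - rho (x s)) * exp (- eps * A (x s))) ^ 2) t l /\
    0 < l * (c * x1).
Proof.
intros He Hk Hx Hr Hrho HA HG Hd Hx1.
set (d := r t - rho (x t)) in *.
set (g := G (r t) (x t) - G (rho (x t)) (x t) - a (x t) * d) in *.
exists (2 * eps * x1 * exp (- eps * A (x t)) ^ 2 * d * (g + c * d)). split.
- assert (H1 : is_derive (fun s => rho (x s)) t (x1 * (eps * G (rho (x t)) (x t)))).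
  { apply (is_derive_comp rho x t _ _ Hrho Hx). }
  assert (H2 : is_derive (fun s => A (x s)) t (x1 * (a (x t) - c))).
  { apply (is_derive_comp A x t _ _ HA Hx). }
  assert (H3 : is_derive (fun s => exp (- eps * A (x s))) t (- eps * (x1 * (a (x t) - c)) * exp (- eps * A (x t)))).
  { evar_last.
    - apply (is_derive_comp exp (fun s => - eps * A (x s))); [apply is_derive_exp|].
      apply (is_derive_scal _ _ (- eps) _ H2).
    - unfold scal; simpl; unfold mult; simpl; ring. }
  evar_last.
  + apply (is_derive_pow (fun s => (r s - rho (x s)) * exp (- eps * A (x s))) 2).
    apply (is_derive_mult (K := R_AbsRing)).
    * apply (is_derive_minus (V := R_NormedModule) _ _ _ _ _ Hr H1).
    * exact H3.
    * intros; apply Rmult_comm.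
  + unfold g, d, minus; repeat (unfold plus, opp, mult; simpl). ring.
(* [|g| <= kappa |d| < |c| |d|], so [c * d] decides the sign of [g + c * d]. *)
- assert (Hgd : 0 < c * d * (g + c * d)).
  { assert (Hdd : 0 < Rabs d) by now apply Rabs_pos_lt.
    assert (Hg : Rabs (g * (c * d)) <= kappa * Rabs d * (Rabs c * Rabs d)).
    { rewrite !Rabs_mult. apply Rmult_le_compat_r; [|exact HG].
      apply Rmult_le_pos; apply Rabs_pos. }
    assert (Hc : 0 < Rabs c). { assert (0 <= Rabs c) by apply Rabs_pos.
      destruct (Req_dec (Rabs c) 0) as [E|E]; [|lra].
      assert (0 <= kappa * Rabs d). { eapply Rle_trans; [apply Rabs_pos|exact HG]. } nra. }
    assert (Ec : (c * d) * (c * d) = (Rabs c * Rabs d) * (Rabs c * Rabs d)).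
    { rewrite <- Rabs_mult. destruct (Rcase_abs (c * d)) as [K|K];
      [rewrite Rabs_left by trivial|rewrite Rabs_right by trivial]; ring. }
    assert (0 < Rabs c * Rabs d) by now apply Rmult_lt_0_compat.
    assert (kappa * Rabs d * (Rabs c * Rabs d) < (Rabs c * Rabs d) * (Rabs c * Rabs d)).
    { apply Rmult_lt_compat_r; trivial. apply Rmult_lt_compat_r; trivial. }
    apply Rabs_le_between in Hg. nra. }
  assert (0 < exp (- eps * A (x t)) ^ 2) by (apply pow_lt, exp_pos).
  replace (2 * eps * x1 * exp (- eps * A (x t)) ^ 2 * d * (g + c * d) * (c * x1)) with
    (2 * eps * (exp (- eps * A (x t)) ^ 2) * (x1 * x1) * (c * d * (g + c * d))) by ring.
  assert (0 < x1 * x1) by nra.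
  apply Rmult_lt_0_compat; [|trivial]. apply Rmult_lt_0_compat; [|trivial]. apply Rmult_lt_0_compat; lra.
Qed.

(** * The Moebius map [phi] *)

Lemma RtoC_2_neq_0 : RtoC 2 <> RtoC 0.
Proof. intros H. apply RtoC_inj in H. lra. Qed.

Lemma phi_plus_1 (z : C) : (1 - z)%C <> RtoC 0 -> (phi z + 1 = 2 / (1 - z))%C.
Proof. intros H. unfold phi. field. exact H. Qed.

Lemma plus_1_neq_0 (w : C) : Cmod w < 1 -> (w + 1)%C <> RtoC 0.
Proof.
intros H E. assert (E' : w = RtoC (-1)).
{ transitivity (w + 1 - 1)%C; [ring|]. rewrite E. apply C_eq; simpl; ring. }
rewrite E', Cmod_R, Rabs_left in H; lra.
Qed.

Lemma one_minus_phi_inv (w : C) : (w + 1)%C <> RtoC 0 -> (1 - phi_inv w)%C = (2 / (w + 1))%C.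
Proof. intros H. unfold phi_inv. field. exact H. Qed.

Lemma one_minus_phi_inv_neq_0 (w : C) : (w + 1)%C <> RtoC 0 -> (1 - phi_inv w)%C <> RtoC 0.
Proof.
intros H E. rewrite one_minus_phi_inv in E by trivial. apply RtoC_2_neq_0.
transitivity (2 / (w + 1) * (w + 1))%C; [field; exact H|]. rewrite E. ring.
Qed.

(** [phi] has real coefficients and preserves the real axis and both half-planes, so the switching
    line is the same in both coordinates. *)
Lemma Im_phi (z : C) : (1 - z)%C <> RtoC 0 -> Im (phi z) * Cmod (1 - z)%C ^ 2 = 2 * Im z.
Proof.
intros H. assert (Hn := C_neq_0_norm2 _ H). rewrite Cmod2_alt. unfold phi.
destruct z as [x y]. simpl in *. field. intros E; apply Hn; etransitivity; [|exact E]; ring.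
Qed.

Lemma Im_phi_pos (z : C) : (1 - z)%C <> RtoC 0 -> (0 < Im (phi z) <-> 0 < Im z).
Proof.
intros H. assert (E := Im_phi z H). assert (Hp : 0 < Cmod (1 - z)%C ^ 2).
{ apply pow_lt. now apply Cmod_gt_0. }
split; intros; nra.
Qed.

Lemma Im_phi_neg (z : C) : (1 - z)%C <> RtoC 0 -> (Im (phi z) < 0 <-> Im z < 0).
Proof.
intros H. assert (E := Im_phi z H). assert (Hp : 0 < Cmod (1 - z)%C ^ 2).
{ apply pow_lt. now apply Cmod_gt_0. }
split; intros; nra.
Qed.

Lemma continuous_C_const {U : UniformSpace} (k : C) (t : U) :
  continuous_C (fun _ => k) t.
Proof. apply continuous_const. Qed.

Lemma continuous_C_minus {U : UniformSpace} (f g : U -> C) t :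
  continuous_C f t -> continuous_C g t ->
  continuous_C (fun s => f s - g s)%C t.
Proof. exact (continuous_minus (V := C_R_NormedModule) f g t). Qed.

Lemma continuous_phi {U : UniformSpace} (f : U -> C) (t : U) :
  continuous_C f t -> (1 - f t)%C <> RtoC 0 ->
  continuous_C (fun s => phi (f s)) t.
Proof.
intros Hf H. unfold phi, Cdiv. apply continuous_C_mult.
- apply continuous_C_plus; trivial. apply continuous_C_const.
- apply (continuous_C_inv (fun s => 1 - f s)%C); trivial.
  apply continuous_C_minus; trivial. apply continuous_C_const.
Qed.

Lemma continuous_phi_inv {U : UniformSpace} (f : U -> C) (t : U) :
  continuous_C f t -> (f t + 1)%C <> RtoC 0 ->
  continuous_C (fun s => phi_inv (f s)) t.
Proof.
intros Hf H. unfold phi_inv, Cdiv. apply continuous_C_mult.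
- apply continuous_C_minus; trivial. apply continuous_C_const.
- apply (continuous_C_inv (fun s => f s + 1)%C); trivial.
  apply continuous_C_plus; trivial. apply continuous_C_const.
Qed.

Lemma is_derive_C_minus (f g : R -> C) t u v :
  is_derive_C f t u -> is_derive_C g t v ->
  is_derive_C (fun s => f s - g s)%C t (u - v)%C.
Proof. intros H1 H2; exact (is_derive_minus (V := C_R_NormedModule) f g t u v H1 H2). Qed.

(** [phi'(z) = 2 / (1 - z)^2 = (w + 1)^2 / 2] at [w = phi z]. The second form lets the transported
    field be written in [w] alone. *)
Lemma is_derive_phi (g : R -> C) (t : R) (v : C) : is_derive_C g t v -> (1 - g t)%C <> RtoC 0 ->
  is_derive_C (fun s => phi (g s)) t ((phi (g t) + 1) * (phi (g t) + 1) / 2 * v)%C.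
Proof.
intros Hg H. rewrite phi_plus_1 by trivial. unfold phi.
evar_last.
- apply is_derive_C_mult; [apply (is_derive_C_plus _ _ _ _ _ (is_derive_C_const 1 t) Hg)|].
  apply is_derive_C_inv; [apply (is_derive_C_minus _ _ _ _ _ (is_derive_C_const 1 t) Hg)|exact H].
- cbv beta. field. exact H.
Qed.

Lemma is_derive_phi_inv (W : R -> C) (t : R) (v : C) : is_derive_C W t v -> (W t + 1)%C <> RtoC 0 ->
  is_derive_C (fun s => phi_inv (W s)) t (2 / ((W t + 1) * (W t + 1)) * v)%C.
Proof.
intros Hg H. unfold phi_inv.
evar_last.
- apply is_derive_C_mult; [apply (is_derive_C_minus _ _ _ _ _ Hg (is_derive_C_const 1 t))|].
  apply is_derive_C_inv; [apply (is_derive_C_plus _ _ _ _ _ Hg (is_derive_C_const 1 t))|exact H].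
- cbv beta. field. exact H.
Qed.

Lemma is_derive_C_conj (f : R -> C) t v : is_derive_C f t v -> is_derive_C (fun s => Cconj (f s)) t (Cconj v).
Proof.
rewrite !is_derive_C_components. intros [H1 H2]; split; simpl.
- exact H1.
- exact (is_derive_opp (V := R_NormedModule) _ _ _ H2).
Qed.

(** * Functions of the folded angle *)

Lemma ang_conj (w : C) : ang (Cconj w) = ang w.
Proof. unfold ang. simpl. now rewrite Rabs_Ropp. Qed.

Lemma Cconj_neq_0 (w : C) : w <> RtoC 0 -> Cconj w <> RtoC 0.
Proof. intros H. apply Cmod_gt_0. rewrite Cmod_conj. now apply Cmod_gt_0. Qed.

Lemma polar_form (w : C) : w <> RtoC 0 -> exists x, w = (RtoC (Cmod w) * cis x)%C.
Proof.
intros H. destruct (Rle_dec 0 (Im w)).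
- exists (ang w). now apply polar_upper.
- exists (- ang w). apply polar_lower; [trivial|lra].
Qed.

Lemma cis_neq_0 (x : R) : cis x <> RtoC 0.
Proof. apply Cmod_gt_0. rewrite Cmod_cis. lra. Qed.

Lemma continuous_cis (x : R) : continuous_C cis x.
Proof.
apply continuous_C_components; split; simpl.
- apply continuous_cos.
- apply continuous_sin.
Qed.

Lemma ang_scale (r x : R) : 0 < r -> ang (RtoC r * cis x)%C = ang (cis x).
Proof.
intros Hr. destruct (ang_spec (cis x) (cis_neq_0 x)) as [H1 [H2 H3]].
rewrite Cmod_cis, Rmult_1_l in H2, H3. simpl in H2, H3.
apply (ang_polar_abs _ r); trivial; simpl.
- rewrite <- H2. ring.
- rewrite <- H3. replace (r * sin x + 0 * cos x) with (r * sin x) by ring.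
  rewrite Rabs_mult, (Rabs_right r); lra.
Qed.

Lemma cis_period (x : R) : cis (x + 2 * PI) = cis x.
Proof.
apply C_eq; simpl.
- replace (x + 2 * PI) with (x + 2 * INR 1 * PI) by (simpl; ring). apply cos_period.
- replace (x + 2 * PI) with (x + 2 * INR 1 * PI) by (simpl; ring). apply sin_period.
Qed.

(** The cycle is parametrised by its angle, so zeros of the sine are its crossings of the real axis;
    a Filippov solution may have finitely many of them on a bounded time interval. *)
Lemma sin_zeros_finite (a b : R) :
  exists S : list R, forall x, a <= x <= b -> sin x = 0 -> In x S.
Proof.
assert (HP := PI_RGT_0).
assert (HN : exists N : nat, Rabs a + Rabs b < INR N * PI).
{ destruct (INR_unbounded ((Rabs a + Rabs b) / PI)) as [N HN]. exists N.
  apply (Rmult_lt_reg_r (/ PI)); [now apply Rinv_0_lt_compat|].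
  rewrite Rmult_assoc, Rinv_r, Rmult_1_r by lra. exact HN. }
destruct HN as [N HN].
exists (map (fun k => (INR k - INR N) * PI) (seq 0 (2 * N + 1))).
intros x Hx Hs. destruct (sin_eq_0_0 x Hs) as [k Hk].
assert (Hb : - (INR N * PI) < x < INR N * PI).
{ unfold Rabs in HN. destruct (Rcase_abs a), (Rcase_abs b); lra. }
assert (Hkb : (- Z.of_nat N < k < Z.of_nat N)%Z).
{ split; apply lt_IZR; rewrite ?opp_IZR, <- INR_IZR_INZ; nra. }
apply in_map_iff. exists (Z.to_nat (k + Z.of_nat N)). split.
- rewrite INR_IZR_INZ, Z2Nat.id by lia. rewrite plus_IZR, <- INR_IZR_INZ. rewrite Hk. ring.
- apply in_seq. lia.
Qed.

Lemma ang_real (w : C) : w <> RtoC 0 -> Im w = 0 -> ang w = 0 \/ ang w = PI.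
Proof.
intros H Hi. destruct (ang_spec w H) as [H1 [_ H2]].
assert (Hm : 0 < Cmod w) by now apply Cmod_gt_0.
rewrite Hi, Rabs_R0 in H2.
assert (Hs : sin (ang w) = 0) by nra.
assert (HP := PI_RGT_0).
destruct (sin_eq_O_2PI_0 (ang w)) as [K|[K|K]]; try lra; auto.
Qed.

Lemma rho_glue (f g : R -> R) (w : C) : f 0 = g 0 -> f PI = g PI ->
  w <> RtoC 0 -> Im w = 0 -> f (ang w) = g (ang w).
Proof. intros E0 E1 H Hi. destruct (ang_real w H Hi) as [-> | ->]; trivial. Qed.

(** Away from the origin the two half-planes meet only at folded angles 0 and PI, so agreement there
    suffices. *)
Lemma continuous_glue {U : UniformSpace} (f g : R -> R) (F : U -> C) (t : U) :
  f 0 = g 0 -> f PI = g PI -> (forall x, continuous f x) -> (forall x, continuous g x) ->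
  continuous_C F t -> F t <> RtoC 0 ->
  continuous (fun s => if Rle_dec 0 (Im (F s)) then f (ang (F s)) else g (ang (F s))) t.
Proof.
intros E0 E1 Hf Hg HF H. assert (Ha := continuous_ang F t HF H).
apply (continuous_if_le (fun s => Im (F s)) (fun s => f (ang (F s))) (fun s => g (ang (F s)))).
- now apply continuous_C_components in HF.
- now apply (continuous_comp (fun s => ang (F s)) f).
- now apply (continuous_comp (fun s => ang (F s)) g).
- now apply rho_glue.
Qed.

Lemma ang_cis_range x : sin x <> 0 -> 0 < ang (cis x) < PI.
Proof.
intros Hs. destruct (ang_spec (cis x) (cis_neq_0 x)) as [H1 [_ H2]].
rewrite Cmod_cis, Rmult_1_l in H2. simpl in H2.
assert (Hp : 0 < sin (ang (cis x))). { rewrite <- H2. now apply Rabs_pos_lt. }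
split.
- destruct (Req_dec (ang (cis x)) 0) as [E|]; [rewrite E, sin_0 in Hp; lra|lra].
- destruct (Req_dec (ang (cis x)) PI) as [E|]; [rewrite E, sin_PI in Hp; lra|lra].
Qed.

Lemma is_derive_cis x : is_derive_C cis x (Ci * cis x)%C.
Proof. apply is_derive_C_components; split; simpl; auto_derive; trivial; ring. Qed.

(** [ang (cis x)] is the triangular wave of period 2 PI. *)
Lemma is_derive_fold x : sin x <> 0 -> is_derive (fun y => ang (cis y)) x (sign (sin x)).
Proof.
intros Hs. evar_last; [apply (is_derive_ang cis x _ (is_derive_cis x) Hs)|].
rewrite Cmod_cis. simpl.
assert (H := sin2_cos2 x). unfold Rsqr in H.
replace ((0 * cos x - 1 * sin x) * - sin x + (0 * sin x + 1 * cos x) * cos x) with 1 by nra. field.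
Qed.

Lemma ang_upper_half (w : C) : 0 < Im w -> 0 < ang w < PI.
Proof.
intros HI. assert (H0 : w <> RtoC 0) by (intros E; rewrite E in HI; simpl in HI; lra).
destruct (polar_form _ H0) as [x Ex]. rewrite Ex, ang_scale by now apply Cmod_gt_0.
apply ang_cis_range. intros Es. rewrite Ex in HI. simpl in HI. rewrite Es in HI. lra.
Qed.

Lemma lyapunov_curve (eps ra rb L : R) (Q : C -> C) (rho a A : R -> R) (c kappa sg : R) (W : R -> C) (t : R) :
  0 < eps -> 0 < ra -> (forall w, ra <= Cmod w <= rb -> Cmod (Q w) <= L) -> eps * L <= ra / 2 ->
  (forall x, ra <= rho x <= rb) ->
  (forall x, 0 < x < PI -> is_derive rho x (eps * radial eps Q (rho x) x)) ->
  (forall x, is_derive A x (a x - c)) -> kappa < Rabs c ->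
  (forall r r' x, ra <= r <= rb -> ra <= r' <= rb ->
    Rabs (radial eps Q r x - radial eps Q r' x - a x * (r - r')) <= kappa * Rabs (r - r')) ->
  sg <> 0 -> is_derive_C W t (RtoC sg * rotation_field eps Q (W t))%C -> 0 < Im (W t) ->
  ra <= Cmod (W t) <= rb -> Cmod (W t) - rho (ang (W t)) <> 0 ->
  exists l, is_derive (fun s => ((Cmod (W s) - rho (ang (W s))) * exp (- eps * A (ang (W s)))) ^ 2) t l /\
    0 < l * (c * sg).
Proof.
intros Heps Hra HQ HL Hrange Hrho HA Hk Hlin Hsg HW HI Hr Hn.
destruct (is_derive_half_polar eps ra rb L Q Heps Hra HQ HL W t sg HW HI Hr) as [x1 [Hx [HM Hx1]]].
specialize (Hx1 Hsg).
destruct (lyapunov_half (radial eps Q) rho a A (fun s => Cmod (W s)) (fun s => ang (W s))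
  eps c kappa t x1) as [l [Hl Hl']]; trivial.
- apply Hrho. now apply ang_upper_half.
- apply Hlin; trivial.
- intros E. rewrite E in Hx1. lra.
- exists l. split; [trivial|].
  (* Multiplying by [sg * x1 > 0] exchanges the sign of the angular velocity for the direction of
     time. *)
  assert (K : 0 < l * (c * x1) * (sg * x1)) by now apply Rmult_lt_0_compat.
  replace (l * (c * x1) * (sg * x1)) with (l * (c * sg) * (x1 * x1)) in K by ring.
  assert (0 <= x1 * x1) by apply Rle_0_sqr. nra.
Qed.

(** Here [|1 + z| >= |1 - z|]. The cycles have [|phi z| < 1], so they lie left of the imaginary
    axis, away from 1. *)
Lemma Cmod_phi_right (z : C) : (1 - z)%C <> RtoC 0 -> 0 <= Re z -> 1 <= Cmod (phi z).
Proof.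
intros H Hz.
assert (Hn : Cmod (1 - z)%C <= Cmod (1 + z)%C).
{ unfold Cmod. apply sqrt_le_1_alt. destruct z as [x y]. simpl in *. nra. }
assert (Hm : 0 < Cmod (1 - z)%C) by now apply Cmod_gt_0.
unfold phi. rewrite Cmod_div by trivial. apply Rle_div_r; lra.
Qed.

(* A bi-Lipschitz clock along a closed curve, differentiable off the zeros of
   the sine, turns the curve into an orbit. *)
Section Clock.

Variables (T : R -> R) (P : R) (tau : R -> R).
Hypothesis Tcont : forall x, continuous T x.
Hypothesis Tder : forall x, sin x <> 0 -> is_derive T x (tau x) /\ 2 / 3 <= tau x <= 2.

(** The gap between the speed bounds 2/3, 2 and the slopes 1/2, 3 makes both comparison functions
    strictly decreasing off the zeros of the sine. *)
Lemma clock_bounds x y : x < y -> (y - x) / 2 < T y - T x < 3 * (y - x).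
Proof.
intros Hxy. destruct (sin_zeros_finite x y) as [S HS].
assert (H1 : y * / 2 - T y < x * / 2 - T x).
{ apply (decreasing_derive_off_finite (fun z => z * / 2 - T z) (fun z => / 2 - tau z) S); trivial.
  - intros z _. apply continuous_Rminus; [|apply Tcont].
    apply (ex_derive_continuous (V := R_NormedModule)). auto_derive; trivial.
  - intros z Hz Hn. destruct (Tder z) as [K1 K2].
    { intros E. apply Hn, HS; [lra|trivial]. }
    split; [|lra]. evar_last.
    + apply (is_derive_minus (V := R_NormedModule)); [|exact K1]. auto_derive; trivial.
    + simpl. unfold minus, plus, opp; simpl. ring. }
assert (H2 : T y - y * 3 < T x - x * 3).
{ apply (decreasing_derive_off_finite (fun z => T z - z * 3) (fun z => tau z - 3) S); trivial.
  - intros z _. apply continuous_Rminus; [apply Tcont|].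
    apply (ex_derive_continuous (V := R_NormedModule)). auto_derive; trivial.
  - intros z Hz Hn. destruct (Tder z) as [K1 K2].
    { intros E. apply Hn, HS; [lra|trivial]. }
    split; [|lra]. evar_last.
    + apply (is_derive_minus (V := R_NormedModule)); [exact K1|]. auto_derive; trivial.
    + simpl. unfold minus, plus, opp; simpl. ring. }
lra.
Qed.

Lemma clock_onto t : exists x, T x = t.
Proof.
set (N := 2 * (Rabs (t - T 0)) + 1).
assert (HN := Rabs_pos (t - T 0)).
assert (H1 := clock_bounds 0 N ltac:(unfold N; lra)).
assert (H2 := clock_bounds (- N) 0 ltac:(unfold N; lra)).
assert (H3 := Rle_abs (t - T 0)). assert (H4 := Rle_abs (- (t - T 0))). rewrite Rabs_Ropp in H4.
destruct (IVT_cor (fun x => T x - t) (- N) N) as [x [_ Hx]].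
- intros x. apply continuity_pt_minus; [|apply continuity_pt_const; intros ? ?; reflexivity].
  apply continuity_pt_filterlim. apply Tcont.
- unfold N; lra.
- unfold N in *. nra.
- exists x. lra.
Qed.

Definition clock_inv (t : R) : R := epsilon (inhabits 0) (fun x => T x = t).

Lemma clock_inv_spec t : T (clock_inv t) = t.
Proof. apply (epsilon_spec (inhabits 0) (fun x => T x = t)). apply clock_onto. Qed.

Lemma clock_inj x y : T x = T y -> x = y.
Proof.
intros E. destruct (Rtotal_order x y) as [H|[H|H]]; trivial.
- assert (K := clock_bounds x y H). lra.
- assert (K := clock_bounds y x H). lra.
Qed.

Lemma clock_inv_lipschitz s t : Rabs (clock_inv s - clock_inv t) <= 2 * Rabs (s - t).
Proof.
assert (H : forall s t, clock_inv s < clock_inv t -> clock_inv t - clock_inv s <= 2 * (t - s)).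
{ intros s' t' H. assert (K := clock_bounds _ _ H). rewrite !clock_inv_spec in K. lra. }
destruct (Rtotal_order (clock_inv s) (clock_inv t)) as [K|[K|K]].
- specialize (H _ _ K). rewrite Rabs_left by lra. rewrite Rabs_left; lra.
- rewrite K, Rminus_diag, Rabs_R0. assert (H0 := Rabs_pos (s - t)). lra.
- specialize (H _ _ K). rewrite Rabs_right by lra. rewrite Rabs_right; lra.
Qed.

Lemma clock_inv_continuous t : continuous clock_inv t.
Proof. apply (lipschitz_continuous _ 2). apply clock_inv_lipschitz. Qed.

Lemma is_derive_clock_inv t : sin (clock_inv t) <> 0 -> is_derive clock_inv t (/ tau (clock_inv t)).
Proof.
intros Hs. destruct (Tder _ Hs) as [K1 K2].
apply is_derive_Reals. apply is_derive_Reals in K1.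
set (x := clock_inv t) in *. set (l := tau x) in *.
(* With [k] the increment of the inverse, the error is [(h/k - l) (k/h) / l] up to sign; the last
   two factors are at most 2 and 3/2, hence the division by 3. The radius is halved below because
   [|k| <= 2 |h|]. *)
intros e He. destruct (K1 (e / 3)) as [d Hd]; [lra|].
assert (Hdp := cond_pos d).
exists (mkposreal (d / 2) ltac:(lra)). simpl. intros h Hh0 Hh.
set (k := clock_inv (t + h) - x).
assert (Hk : Rabs k <= 2 * Rabs h).
{ unfold k, x. eapply Rle_trans; [apply clock_inv_lipschitz|]. replace (t + h - t) with h by ring. lra. }
assert (Ek : T (x + k) - T x = h).
{ unfold k. replace (x + (clock_inv (t + h) - x)) with (clock_inv (t + h)) by ring.
  unfold x. rewrite !clock_inv_spec. ring. }
assert (Hk0 : k <> 0). { intros E. rewrite E, Rplus_0_r in Ek. lra. }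
specialize (Hd k Hk0 ltac:(lra)). rewrite Ek in Hd.
replace (clock_inv (t + h) - clock_inv t) with k by reflexivity.
assert (E : k / h - / l = - ((h / k - l) * (k / h) / l)) by (field; repeat split; lra).
rewrite E, Rabs_Ropp. unfold Rdiv at 1. rewrite Rabs_mult, (Rabs_mult (h / k - l)).
assert (Hkh : Rabs (k / h) <= 2).
{ unfold Rdiv. rewrite Rabs_mult, Rabs_inv. assert (0 < Rabs h) by now apply Rabs_pos_lt.
  apply (Rmult_le_reg_r (Rabs h)); trivial. rewrite Rmult_assoc, Rinv_l; lra. }
assert (Hli : Rabs (/ l) <= 3 / 2).
{ rewrite Rabs_inv, Rabs_right by lra. apply (Rmult_le_reg_r l); [lra|]. rewrite Rinv_l; lra. }
assert (H0 := Rabs_pos (h / k - l)). assert (H0' := Rabs_pos (k / h)). assert (H0'' := Rabs_pos (/ l)).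
assert (Rabs (k / h) * Rabs (/ l) <= 3) by nra.
rewrite Rmult_assoc.
apply Rle_lt_trans with (Rabs (h / k - l) * 3).
- now apply Rmult_le_compat_l.
- unfold Rdiv in *. lra.
Qed.

Lemma clock_closed_orbit (Xp Xm : C -> C) (Z : R -> C) :
  0 < P -> (forall x, T (x + 2 * PI) = T x + P) ->
  (forall x, Z (x + 2 * PI) = Z x) ->
  (forall x, continuous_C Z x) ->
  (exists x, Z x <> Z 0) ->
  (forall x, 0 < sin x -> 0 < Im (Z x) /\ is_derive_C Z x (RtoC (- tau x) * Xp (Z x))%C) ->
  (forall x, sin x < 0 -> Im (Z x) < 0 /\ is_derive_C Z x (RtoC (- tau x) * Xm (Z x))%C) ->
  closed_orbit Xp Xm (fun z => exists x, z = Z x).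
Proof.
intros HP HTP HZ Hc Hne Hp Hm.
(* The orbit runs clockwise: time is [T 0 - T x], and the angle decreases with it. The hypotheses on
   [Z] carry [- tau] for this reason. *)
set (u := fun t => clock_inv (T 0 - t)).
assert (Hu0 : u 0 = 0). { apply clock_inj. unfold u. rewrite clock_inv_spec. ring. }
assert (Hu : forall x, u (T 0 - T x) = x).
{ intros x. apply clock_inj. unfold u. rewrite clock_inv_spec. ring. }
assert (Hud : forall t, sin (u t) <> 0 -> is_derive u t (- / tau (u t))).
{ intros t Ht. evar_last.
  - apply (is_derive_comp clock_inv (fun t => T 0 - t)).
    + apply is_derive_clock_inv. exact Ht.
    + apply (is_derive_minus (V := R_NormedModule)); [apply is_derive_const|apply is_derive_id].
  - unfold u, scal, minus, plus, opp, zero, one; simpl. unfold mult; simpl. ring. }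
assert (Huc : forall t, continuous u t).
{ intros t. apply (continuous_comp (fun t => T 0 - t) clock_inv); [|apply clock_inv_continuous].
  apply (ex_derive_continuous (V := R_NormedModule)). auto_derive; trivial. }
assert (Hder : forall t X, sin (u t) <> 0 -> is_derive_C Z (u t) (RtoC (- tau (u t)) * X)%C ->
   is_derive_C (fun t => Z (u t)) t X).
{ intros t X Hs HZd. destruct (Tder _ Hs) as [_ Ht].
  evar_last; [apply (is_derive_C_comp Z u t _ _ HZd (Hud t Hs))|].
  destruct X. apply C_eq; simpl; field; lra. }
exists (fun t => Z (u t)), P. repeat split.
- intros t. apply (continuous_comp u Z); [apply Huc|apply Hc].
- intros a b. destruct (sin_zeros_finite (u b) (u a)) as [S HS].
  exists (map (fun x => T 0 - T x) S). intros t Ht Hn.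
  assert (Hs : sin (u t) <> 0).
  { intros E. apply Hn. apply in_map_iff. exists (u t). split.
    - unfold u. rewrite clock_inv_spec. ring.
    - apply HS; trivial.
      assert (Hmono : forall p q, p <= q -> clock_inv p <= clock_inv q).
      { intros p q Hpq. apply Rnot_lt_le. intros K. assert (K' := clock_bounds _ _ K).
        rewrite !clock_inv_spec in K'. lra. }
      split; apply Hmono; lra. }
  destruct (Rtotal_order (sin (u t)) 0) as [K|[K|K]]; [|contradiction|].
  + destruct (Hm _ K) as [M1 M2]. exists (Xm (Z (u t))). split; [now apply Hder|].
    right; left; now split.
  + destruct (Hp _ K) as [M1 M2]. exists (Xp (Z (u t))). split; [now apply Hder|].
    left; now split.
- exact HP.
- intros t. replace (Z (u t)) with (Z (u (t + P) + 2 * PI)); [now rewrite HZ|]. f_equal.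
  apply clock_inj. rewrite HTP. unfold u. rewrite !clock_inv_spec. ring.
- destruct Hne as [x Hx]. exists (T 0 - T x). now rewrite Hu, Hu0.
- intros [x ->]. exists (T 0 - T x). now rewrite Hu.
- intros [t <-]. now exists (u t).
Qed.

End Clock.

(** * The closed orbit and its isolation *)

Section Core.

Variables (ra rb rc rd eps L : R) (Qp Qm Xp Xm : C -> C) (rhop rhom : R -> R).
Hypothesis Heps : 0 < eps.
Hypothesis Hra : 0 < ra.
Hypothesis Hac : ra < rc.
Hypothesis Hcd : rc <= rd.
Hypothesis Hdb : rd < rb.
Hypothesis Hrb : rb < 1.
Hypothesis HQp : forall w, ra <= Cmod w <= rb -> Cmod (Qp w) <= L.
Hypothesis HQm : forall w, ra <= Cmod w <= rb -> Cmod (Qm w) <= L.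
Hypothesis HL : eps * L <= ra / 2.
Hypothesis HXp : forall z, (1 - z)%C <> RtoC 0 -> ra <= Cmod (phi z) <= rb ->
  ((phi z + 1) * (phi z + 1) / 2 * Xp z)%C = (- rotation_field eps Qp (phi z))%C.
Hypothesis HXm : forall z, (1 - z)%C <> RtoC 0 -> ra <= Cmod (phi z) <= rb ->
  ((phi z + 1) * (phi z + 1) / 2 * Xm z)%C = Cconj (rotation_field eps Qm (Cconj (phi z))).
Hypothesis Hrp : forall x, continuous rhop x.
Hypothesis Hrm : forall x, continuous rhom x.
Hypothesis Hrp_range : forall x, rc <= rhop x <= rd.
Hypothesis Hrm_range : forall x, rc <= rhom x <= rd.
Hypothesis Hr0 : rhop 0 = rhom 0.
Hypothesis HrPI : rhop PI = rhom PI.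
Hypothesis Hrp_der : forall x, 0 < x < PI -> is_derive rhop x (eps * radial eps Qp (rhop x) x).
Hypothesis Hrm_der : forall x, 0 < x < PI -> is_derive rhom x (eps * radial eps Qm (rhom x) x).

(** The polar equation of the cycle in the plane of [phi z], as a function that is constant on rays.
    Writing it through [ang] rather than through a real angle makes it single-valued. *)
Definition rad (w : C) : R := if Rle_dec 0 (Im w) then rhop (ang w) else rhom (ang w).

Definition cycle_point (x : R) : C := phi_inv (RtoC (rad (cis x)) * cis x)%C.

Definition cycle (z : C) : Prop := exists x, z = cycle_point x.

Lemma rad_range w : rc <= rad w <= rd.
Proof. unfold rad. destruct (Rle_dec 0 (Im w)); trivial. Qed.

Lemma continuous_rad {U : UniformSpace} (F : U -> C) (t : U) :
  continuous_C F t -> F t <> RtoC 0 -> continuous (fun s => rad (F s)) t.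
Proof. intros HF H. now apply continuous_glue. Qed.

Lemma rad_scale r x : 0 < r -> rad (RtoC r * cis x)%C = rad (cis x).
Proof.
intros Hr. unfold rad. rewrite ang_scale by trivial. simpl.
destruct (Rle_dec 0 (r * sin x + 0 * cos x)), (Rle_dec 0 (sin x)); trivial; exfalso; nra.
Qed.

Definition cycle_w (x : R) : C := (RtoC (rad (cis x)) * cis x)%C.

Lemma Cmod_cycle_w x : Cmod (cycle_w x) = rad (cis x).
Proof. apply Cmod_polar. assert (H := rad_range (cis x)). lra. Qed.

Lemma cycle_w_plus_1 x : (cycle_w x + 1)%C <> RtoC 0.
Proof. apply plus_1_neq_0. rewrite Cmod_cycle_w. assert (H := rad_range (cis x)). lra. Qed.

Lemma phi_cycle_point x : phi (cycle_point x) = cycle_w x.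
Proof. apply phi_phi_inv. apply cycle_w_plus_1. Qed.

Lemma cycle_point_neq_1 x : (1 - cycle_point x)%C <> RtoC 0.
Proof. apply one_minus_phi_inv_neq_0. apply cycle_w_plus_1. Qed.

(** The image of the cycle meets each ray from 0 exactly once, so membership, inside and outside
    become comparisons of [Cmod (phi z)] with [rad (phi z)]. *)
Lemma cycle_iff z : (1 - z)%C <> RtoC 0 -> phi z <> RtoC 0 ->
  (cycle z <-> Cmod (phi z) = rad (phi z)).
Proof.
intros H1 H0. split.
- intros [x ->]. rewrite phi_cycle_point, Cmod_cycle_w. unfold cycle_w.
  rewrite rad_scale; trivial. assert (H := rad_range (cis x)). lra.
- intros E. destruct (polar_form _ H0) as [x Hx].
  assert (Hm : 0 < Cmod (phi z)) by now apply Cmod_gt_0.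
  exists x. unfold cycle_point.
  rewrite <- (rad_scale (Cmod (phi z)) x) by trivial.
  rewrite <- Hx, <- E, <- Hx. symmetry. now apply phi_inv_phi.
Qed.

Lemma cycle_facts z : cycle z ->
  (1 - z)%C <> RtoC 0 /\ rc <= Cmod (phi z) <= rd /\ Cmod (phi z) = rad (phi z).
Proof.
intros [x ->]. split; [apply cycle_point_neq_1|].
rewrite phi_cycle_point, Cmod_cycle_w. split; [apply rad_range|].
unfold cycle_w. rewrite rad_scale; trivial. assert (H := rad_range (cis x)). lra.
Qed.

Lemma continuous_cycle_w x : continuous_C cycle_w x.
Proof.
apply continuous_C_mult; [|apply continuous_cis].
apply continuous_C_components; split; simpl.
- apply continuous_rad; [apply continuous_cis|apply cis_neq_0].
- apply continuous_const.
Qed.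

Lemma continuous_cycle_point x : continuous_C cycle_point x.
Proof. apply (continuous_phi_inv cycle_w); [apply continuous_cycle_w|apply cycle_w_plus_1]. Qed.

Lemma not_cycle_right z : 0 <= Re z -> ~ cycle z.
Proof.
intros Hz Hc. destruct (cycle_facts _ Hc) as [F1 [F2 _]].
assert (K := Cmod_phi_right z F1 Hz). lra.
Qed.

Lemma cycle_not_surrounds_1 : ~ surrounds cycle (RtoC 1).
Proof.
intros [_ [B HB]].
(* The positive real ray from 1 to [2 + |B|]: it ends beyond the supposed bound and stays in the
   half-plane free of the cycle. *)
set (path := fun t : R => RtoC (1 + t * (Rabs B + 1))).
assert (HB0 := Rabs_pos B). assert (HB1 := Rle_abs B).
assert (K : Cmod (path 1) <= B).
{ apply HB.
  - intros t. apply continuous_C_components; split; simpl; [|apply continuous_const].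
    apply (ex_derive_continuous (V := R_NormedModule)). auto_derive; trivial.
  - unfold path. f_equal. ring.
  - intros t Ht. apply not_cycle_right. simpl. nra. }
unfold path in K. rewrite Cmod_R, Rabs_right in K; lra.
Qed.

Lemma cycle_surrounds_m1 : surrounds cycle (RtoC (-1)).
Proof.
assert (Ephi : phi (RtoC (-1)) = RtoC 0).
{ unfold phi. replace (1 + RtoC (-1))%C with (RtoC 0) by (apply C_eq; simpl; ring). unfold Cdiv. ring. }
split.
- intros Hc. destruct (cycle_facts _ Hc) as [_ [F _]]. rewrite Ephi, Cmod_0 in F. lra.
(* Inside the cycle [|w| <= rd], so [|phi_inv w| = |w - 1| / |w + 1| <= 2 / (1 - rd)]. *)
- exists (2 / (1 - rd)). intros path Hp Hp0 Hav.
  (* Inside and outside; the point 1, where [phi] has its pole, counts as outside. *)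
  set (A := fun t => (1 - path t)%C <> RtoC 0 /\ Cmod (phi (path t)) < rad (phi (path t))).
  set (B := fun t => (1 - path t)%C = RtoC 0 \/ rad (phi (path t)) < Cmod (phi (path t))).
  assert (Hone : forall t, (1 - path t)%C <> RtoC 0 -> locally t (fun s => (1 - path s)%C <> RtoC 0)).
  { intros t Ht. apply (filter_imp (fun s => 0 < Cmod (1 - path s)%C)); [intros s; apply Cmod_gt_0|].
    assert (Hc : continuous (fun s => Cmod (1 - path s)%C) t).
    { apply (continuous_comp (fun s => 1 - path s)%C Cmod); [|apply continuous_Cmod].
      apply continuous_C_minus; [apply continuous_C_const|apply Hp]. }
    apply (Hc (fun r => 0 < r)), (open_gt 0). now apply Cmod_gt_0. }
  assert (HcM : forall t, (1 - path t)%C <> RtoC 0 -> continuous (fun s => Cmod (phi (path s))) t).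
  { intros t Ht. apply (continuous_comp (fun s => phi (path s)) Cmod); [|apply continuous_Cmod].
    now apply continuous_phi. }
  assert (HcD : forall t, (1 - path t)%C <> RtoC 0 -> phi (path t) <> RtoC 0 ->
    continuous (fun s => Cmod (phi (path s)) - rad (phi (path s))) t).
  { intros t Ht H0. apply continuous_Rminus.
    - now apply HcM.
    - apply (continuous_rad (fun s => phi (path s))); trivial. now apply continuous_phi. }
  assert (HA1 : A 1).
  { apply (unit_interval_connected A B).
    - intros t Ht. unfold A, B. destruct (excluded_middle_informative ((1 - path t)%C = RtoC 0)) as [E|E]; [tauto|].
      destruct (Rtotal_order (Cmod (phi (path t))) (rad (phi (path t)))) as [K|[K|K]]; try tauto.
      exfalso. apply (Hav t Ht). apply cycle_iff; trivial.
      assert (F := rad_range (phi (path t))). apply Cmod_gt_0. lra.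
    - intros t [A1 A2] [B1|B1]; [contradiction|lra].
    - intros t _ [A1 A2]. apply filter_and; [now apply Hone|].
      (* At [w = 0] the function [rad] need not be continuous, and its lower bound [rc] is used
         instead. *)
      destruct (excluded_middle_informative (phi (path t) = RtoC 0)) as [E|E].
      + apply (filter_imp (fun s => Cmod (phi (path s)) < rc)).
        * intros s Hs. assert (F := rad_range (phi (path s))). lra.
        * apply (HcM t A1 (fun r => r < rc)), (open_lt rc). rewrite E, Cmod_0. lra.
      + apply (filter_imp (fun s => Cmod (phi (path s)) - rad (phi (path s)) < 0)); [intros; lra|].
        apply (HcD t A1 E (fun r => r < 0)), (open_lt 0). lra.
    - intros t _ HB. destruct (excluded_middle_informative ((1 - path t)%C = RtoC 0)) as [E|E].
      (* Near the pole the path is in the right half-plane, where [|phi| >= 1 > rd]. *)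
      + assert (Hre : 0 < Re (path t)).
        { assert (K := f_equal Re E). simpl in K. unfold Re. lra. }
        destruct (proj1 (continuous_C_components path t) (Hp t)) as [Hc _].
        apply (filter_imp (fun s => 0 < Re (path s))).
        * intros s Hs. unfold B. destruct (excluded_middle_informative ((1 - path s)%C = RtoC 0)) as [E'|E']; [tauto|].
          right. assert (F := rad_range (phi (path s))).
          assert (K := Cmod_phi_right (path s) E' ltac:(lra)). lra.
        * apply (Hc (fun r => 0 < r)), (open_gt 0 _ Hre).
      + destruct HB as [HB|HB]; [contradiction|].
        apply (filter_imp (fun s => 0 < Cmod (phi (path s)) - rad (phi (path s)))); [intros s Hs; right; lra|].
        apply (HcD t E) with (P := fun r => 0 < r); [|apply (open_gt 0); lra].
        assert (F := rad_range (phi (path t))). apply Cmod_gt_0. lra.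
    - unfold A. rewrite Hp0, Ephi, Cmod_0. split.
      + intros E. assert (K := f_equal Re E). simpl in K. lra.
      + assert (F := rad_range (RtoC 0)). lra. }
  destruct HA1 as [A1 A2]. set (w := phi (path 1)) in *.
  assert (F := rad_range w). rewrite <- (phi_inv_phi (path 1) A1). fold w. unfold phi_inv.
  assert (Hw1 : (w + 1)%C <> RtoC 0) by (apply plus_1_neq_0; lra).
  rewrite Cmod_div by trivial.
  assert (N1 : Cmod (w - 1)%C <= 2).
  { eapply Rle_trans; [apply Cmod_triangle|]. rewrite Cmod_opp, Cmod_1. lra. }
  assert (N2 : 1 - rd <= Cmod (w + 1)%C).
  { assert (K := Cmod_triangle (w + 1)%C (- w)%C). replace (w + 1 + - w)%C with (RtoC 1) in K by ring.
    rewrite Cmod_opp, Cmod_1 in K. lra. }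
  assert (N0 := Cmod_ge_0 (w - 1)%C).
  unfold Rdiv. apply Rmult_le_compat; trivial; [left; apply Rinv_0_lt_compat; lra|].
  apply Rinv_le_contravar; lra.
Qed.

Lemma is_derive_cycle_w_upper x : 0 < sin x ->
  is_derive_C cycle_w x
   (RtoC (angle_time eps Qp (rhop (ang (cis x))) (ang (cis x))) * rotation_field eps Qp (cycle_w x))%C.
Proof.
intros Hs. set (u := ang (cis x)).
assert (Hu := ang_cis_range x ltac:(lra)). fold u in Hu.
assert (E : cis u = cis x).
{ symmetry. rewrite (polar_upper (cis x) (cis_neq_0 x)) at 1 by (simpl; lra). rewrite Cmod_cis. fold u. ring. }
assert (Hloc : locally x (fun y => 0 < sin y)).
{ apply (continuous_sin x (fun r => 0 < r)). now apply (open_gt 0). }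
apply (is_derive_ext_loc (V := C_R_NormedModule) (fun y => (fun v => RtoC (rhop v) * cis v)%C (ang (cis y)))).
{ generalize Hloc. apply filter_imp. intros y Hy. unfold cycle_w, rad. simpl Im.
  destruct (Rle_dec 0 (sin y)); [|lra]. f_equal.
  rewrite (polar_upper (cis y) (cis_neq_0 y)) at 2 by (simpl; lra). rewrite Cmod_cis. ring. }
assert (Ew : cycle_w x = (RtoC (rhop u) * cis u)%C).
{ rewrite E. unfold cycle_w, rad. simpl Im. destruct (Rle_dec 0 (sin x)); [reflexivity|lra]. }
rewrite Ew.
assert (D1 := is_derive_polar_arc eps ra rb L Qp Heps Hra HQp HL rhop u (Hrp_der u Hu)
   ltac:(generalize (Hrp_range u); lra)).
assert (D2 := is_derive_fold x ltac:(lra)). rewrite sign_eq_1 in D2 by trivial.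
evar_last; [exact (is_derive_C_comp (fun v => RtoC (rhop v) * cis v)%C (fun y => ang (cis y)) x _ _ D1 D2)|].
ring.
Qed.

(** The lower arc is the conjugate of an arc of [Qm], and the folded angle decreases while [x]
    increases: hence both the conjugation and the minus sign. *)
Lemma is_derive_cycle_w_lower x : sin x < 0 ->
  is_derive_C cycle_w x
   (RtoC (angle_time eps Qm (rhom (ang (cis x))) (ang (cis x)))
     * - Cconj (rotation_field eps Qm (Cconj (cycle_w x))))%C.
Proof.
intros Hs. set (u := ang (cis x)).
assert (Hu := ang_cis_range x ltac:(lra)). fold u in Hu.
assert (E : cis u = Cconj (cis x)).
{ symmetry. rewrite (polar_lower (cis x) (cis_neq_0 x)) at 1 by (simpl; lra). rewrite Cmod_cis. fold u.
  rewrite Cmult_1_l, Cconj_cis, Ropp_involutive. reflexivity. }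
assert (Hloc : locally x (fun y => sin y < 0)).
{ apply (continuous_sin x (fun r => r < 0)). now apply (open_lt 0). }
apply (is_derive_ext_loc (V := C_R_NormedModule) (fun y => (fun v => Cconj (RtoC (rhom v) * cis v)) (ang (cis y)))).
{ generalize Hloc. apply filter_imp. intros y Hy. unfold cycle_w, rad. simpl Im.
  destruct (Rle_dec 0 (sin y)); [lra|]. rewrite Cmult_conj, Cconj_cis. f_equal.
  - apply C_eq; simpl; ring.
  - rewrite (polar_lower (cis y) (cis_neq_0 y)) at 2 by (simpl; lra). rewrite Cmod_cis. ring. }
assert (Ew : Cconj (cycle_w x) = (RtoC (rhom u) * cis u)%C).
{ rewrite E. unfold cycle_w, rad. simpl Im. destruct (Rle_dec 0 (sin x)); [lra|].
  rewrite Cmult_conj. fold u. f_equal. apply C_eq; simpl; ring. }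
rewrite Ew.
assert (D1 := is_derive_polar_arc eps ra rb L Qm Heps Hra HQm HL rhom u (Hrm_der u Hu)
   ltac:(generalize (Hrm_range u); lra)).
apply is_derive_C_conj in D1.
assert (D2 := is_derive_fold x ltac:(lra)). rewrite sign_eq_m1 in D2 by trivial.
evar_last; [exact (is_derive_C_comp (fun v => Cconj (RtoC (rhom v) * cis v)) (fun y => ang (cis y)) x _ _ D1 D2)|].
rewrite Cmult_conj. apply C_eq; simpl; ring.
Qed.

Hypothesis Htp : forall x, continuous (fun x => angle_time eps Qp (rhop x) x) x.
Hypothesis Htm : forall x, continuous (fun x => angle_time eps Qm (rhom x) x) x.

Let taup x := angle_time eps Qp (rhop x) x.
Let taum x := angle_time eps Qm (rhom x) x.
Let fold x := ang (cis x).

(* The derivative of [fold] is 1 above and -1 below the real axis, so that the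
   derivative of [cycle_clock] is [taup] above and [taum] below. *)
Definition cycle_clock (x : R) : R :=
  RInt (fun y => (taup (fold y) + taum (fold y)) / 2) 0 x
  + RInt (fun v => (taup v - taum v) / 2) 0 (fold x).

Definition cycle_speed (x : R) : R := if Rle_dec 0 (sin x) then taup (fold x) else taum (fold x).

Lemma fold_continuous x : continuous fold x.
Proof. apply continuous_ang; [apply continuous_cis|apply cis_neq_0]. Qed.

Lemma clock_even_continuous x : continuous (fun y => (taup (fold y) + taum (fold y)) / 2) x.
Proof.
apply continuous_Rmult; [|apply continuous_const].
apply continuous_Rplus.
- apply (continuous_comp fold taup); [apply fold_continuous|apply Htp].
- apply (continuous_comp fold taum); [apply fold_continuous|apply Htm].
Qed.

Lemma clock_odd_continuous x : continuous (fun v => (taup v - taum v) / 2) x.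
Proof.
apply continuous_Rmult; [|apply continuous_const].
apply continuous_Rminus; [apply Htp|apply Htm].
Qed.

Lemma cycle_clock_continuous x : continuous cycle_clock x.
Proof.
apply continuous_Rplus.
- apply continuous_RInt_cont. apply clock_even_continuous.
- apply (continuous_comp fold (fun y => RInt (fun v => (taup v - taum v) / 2) 0 y)); [apply fold_continuous|].
  apply continuous_RInt_cont. apply clock_odd_continuous.
Qed.

Lemma is_derive_cycle_clock x : sin x <> 0 ->
  is_derive cycle_clock x (cycle_speed x) /\ 2 / 3 <= cycle_speed x <= 2.
Proof.
intros Hs. split.
- evar_last.
  + apply (is_derive_plus (V := R_NormedModule)
     (fun x => RInt (fun y => (taup (fold y) + taum (fold y)) / 2) 0 x)
     (fun x => RInt (fun v => (taup v - taum v) / 2) 0 (fold x))).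
    * apply is_derive_RInt_cont. apply clock_even_continuous.
    * apply (is_derive_comp (fun y => RInt (fun v => (taup v - taum v) / 2) 0 y) fold).
      -- apply is_derive_RInt_cont. apply clock_odd_continuous.
      -- apply is_derive_fold. exact Hs.
  + unfold plus, scal; simpl. unfold mult; simpl. unfold cycle_speed.
    destruct (Rle_dec 0 (sin x)).
    * rewrite sign_eq_1 by lra. field.
    * rewrite sign_eq_m1 by lra. field.
- unfold cycle_speed. destruct (Rle_dec 0 (sin x)).
  + apply (angle_time_bound eps ra rb L Qp Heps Hra HQp HL). generalize (Hrp_range (fold x)); lra.
  + apply (angle_time_bound eps ra rb L Qm Heps Hra HQm HL). generalize (Hrm_range (fold x)); lra.
Qed.

(** The first integrand is periodic, so its integral over a period does not depend on the starting
    point; the second term is a function of the periodic [fold x]. *)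
Lemma cycle_clock_period x : cycle_clock (x + 2 * PI) = cycle_clock x + (cycle_clock (2 * PI) - cycle_clock 0).
Proof.
assert (Hf : forall y, fold (y + 2 * PI) = fold y). { intros y. unfold fold. now rewrite cis_period. }
set (e := fun y => (taup (fold y) + taum (fold y)) / 2).
set (J := (fun y => RInt e 0 y) : R -> R).
assert (HJ : J (x + 2 * PI) - J x = J (0 + 2 * PI) - J 0).
{ assert (Hd : forall y, is_derive (fun y => J (y + 2 * PI) - J y) y 0).
  { intros y. evar_last.
    - apply (is_derive_minus (V := R_NormedModule)).
      + apply (is_derive_comp J (fun y => y + 2 * PI)).
        * apply (is_derive_RInt_cont e). apply clock_even_continuous.
        * auto_derive; trivial.
      + apply (is_derive_RInt_cont e). apply clock_even_continuous.
    - unfold scal, minus, plus, opp; simpl. unfold mult; simpl. unfold e. rewrite Hf. ring. }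
  destruct (Req_dec 0 x) as [<-|Hx]; [reflexivity|].
  destruct (MVT_gen (fun y => J (y + 2 * PI) - J y) 0 x (fun _ => 0)) as [y [_ Hy]].
  - intros; apply Hd.
  - intros y _. apply continuity_pt_filterlim.
    apply (ex_derive_continuous (V := R_NormedModule) (fun y => J (y + 2 * PI) - J y) y). now exists 0.
  - lra. }
assert (Hf0 := Hf 0). rewrite Rplus_0_l in Hf0, HJ.
unfold cycle_clock. rewrite Hf, Hf0. fold e. fold (J x) (J (x + 2 * PI)) (J (2 * PI)) (J 0).
lra.
Qed.

Lemma cycle_closed_orbit : closed_orbit Xp Xm cycle.
Proof.
assert (HP := PI_RGT_0).
apply (clock_closed_orbit cycle_clock (cycle_clock (2 * PI) - cycle_clock 0) cycle_speed
  cycle_clock_continuous is_derive_cycle_clock).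
- assert (K := clock_bounds cycle_clock cycle_speed cycle_clock_continuous is_derive_cycle_clock 0 (2 * PI) ltac:(lra)). lra.
- apply cycle_clock_period.
- intros x. unfold cycle_point. now rewrite cis_period.
- apply continuous_cycle_point.
- exists PI. intros E. assert (E' : phi (cycle_point PI) = phi (cycle_point 0)) by now rewrite E.
  rewrite !phi_cycle_point in E'. unfold cycle_w in E'.
  assert (K := f_equal Re E'). simpl in K. rewrite cos_PI, cos_0, sin_0, sin_PI in K.
  assert (K1 := rad_range (cis PI)). assert (K2 := rad_range (cis 0)). lra.
- intros x Hs. assert (Hr := rad_range (cis x)). assert (H1 := cycle_point_neq_1 x). split.
  + apply Im_phi_pos; trivial. rewrite phi_cycle_point. simpl. nra.
  + evar_last; [apply (is_derive_phi_inv cycle_w x _ (is_derive_cycle_w_upper x Hs) (cycle_w_plus_1 x))|].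
    assert (HX := HXp (cycle_point x) H1). rewrite phi_cycle_point, Cmod_cycle_w in HX.
    specialize (HX ltac:(lra)).
    unfold cycle_speed. destruct (Rle_dec 0 (sin x)); [|lra]. fold (fold x). fold (taup (fold x)).
    replace (rotation_field eps Qp (cycle_w x)) with (- - rotation_field eps Qp (cycle_w x))%C by ring.
    rewrite <- HX. rewrite RtoC_opp. field. apply cycle_w_plus_1.
- intros x Hs. assert (Hr := rad_range (cis x)). assert (H1 := cycle_point_neq_1 x). split.
  + apply Im_phi_neg; trivial. rewrite phi_cycle_point. simpl. nra.
  + evar_last; [apply (is_derive_phi_inv cycle_w x _ (is_derive_cycle_w_lower x Hs) (cycle_w_plus_1 x))|].
    assert (HX := HXm (cycle_point x) H1). rewrite phi_cycle_point, Cmod_cycle_w in HX.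
    specialize (HX ltac:(lra)).
    unfold cycle_speed. destruct (Rle_dec 0 (sin x)); [lra|]. fold (fold x). fold (taum (fold x)).
    rewrite <- HX. rewrite RtoC_opp. field. apply cycle_w_plus_1.
Qed.

(** * The Lyapunov function of the cycle *)

Variables (c kappa : R) (ap am : R -> R).
Hypothesis Hkappa : kappa < Rabs c.
Hypothesis Hap : forall x, continuous ap x.
Hypothesis Ham : forall x, continuous am x.
Hypothesis Hbalance : RInt ap 0 PI - c * PI = RInt am 0 PI + c * PI.
Hypothesis Hlin_p : forall r r' x, ra <= r <= rb -> ra <= r' <= rb ->
  Rabs (radial eps Qp r x - radial eps Qp r' x - ap x * (r - r')) <= kappa * Rabs (r - r').
Hypothesis Hlin_m : forall r r' x, ra <= r <= rb -> ra <= r' <= rb ->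
  Rabs (radial eps Qm r x - radial eps Qm r' x - am x * (r - r')) <= kappa * Rabs (r - r').

(** In true time the folded angle decreases on the upper half and increases on the lower one; the
    opposite signs of [c] compensate, so that [c * lyap] decreases on both. The two weights vanish
    at 0, and [Hbalance] is their equality at PI, which makes the glued weight continuous. *)
Let Ap x := RInt ap 0 x - c * x.
Let Am x := RInt am 0 x + c * x.

Definition weight (w : C) : R := if Rle_dec 0 (Im w) then Ap (ang w) else Am (ang w).

Definition lyap (w : C) : R := ((Cmod w - rad w) * exp (- eps * weight w)) ^ 2.

Lemma is_derive_Ap x : is_derive Ap x (ap x - c).
Proof.
evar_last.
- apply (is_derive_minus (V := R_NormedModule) (fun x => RInt ap 0 x)).
  + now apply is_derive_RInt_cont.
  + apply (is_derive_scal (fun x => x) x c 1). exact (is_derive_id (K := R_AbsRing) x).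
- unfold minus, plus, opp; simpl. ring.
Qed.

Lemma is_derive_Am x : is_derive Am x (am x - - c).
Proof.
evar_last.
- apply (is_derive_plus (V := R_NormedModule) (fun x => RInt am 0 x)).
  + now apply is_derive_RInt_cont.
  + apply (is_derive_scal (fun x => x) x c 1). exact (is_derive_id (K := R_AbsRing) x).
- unfold plus; simpl. ring.
Qed.

Lemma continuous_lyap {U : UniformSpace} (F : U -> C) (t : U) :
  continuous_C F t -> F t <> RtoC 0 -> continuous (fun s => lyap (F s)) t.
Proof.
intros HF H.
assert (K : continuous (fun s => (Cmod (F s) - rad (F s)) * exp (- eps * weight (F s))) t).
{ apply continuous_Rmult.
  - apply continuous_Rminus.
    + apply (continuous_comp F Cmod); [trivial|apply continuous_Cmod].
    + now apply continuous_rad.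
  - apply (continuous_comp (fun s => - eps * weight (F s)) exp).
    + apply continuous_Rmult; [apply continuous_const|].
      apply continuous_glue; trivial.
      * unfold Ap, Am. rewrite !RInt_point. ring.
      * intros x. apply (ex_derive_continuous (V := R_NormedModule)). eexists; apply is_derive_Ap.
      * intros x. apply (ex_derive_continuous (V := R_NormedModule)). eexists; apply is_derive_Am.
    + apply continuous_exp. }
unfold lyap. simpl.
apply continuous_Rmult; [exact K|].
apply continuous_Rmult; [exact K|]. apply continuous_const.
Qed.

Lemma lyap_neq_0 w : lyap w <> 0 <-> Cmod w - rad w <> 0.
Proof.
unfold lyap. assert (H := exp_pos (- eps * weight w)). split; intros K E.
- apply K. rewrite E. ring.
- apply K. assert (E' : (Cmod w - rad w) * exp (- eps * weight w) = 0) by nra.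
  apply Rmult_integral in E'. destruct E'; [trivial|lra].
Qed.

Lemma lyap_upper (W : R -> C) (t : R) :
  is_derive_C W t (- rotation_field eps Qp (W t))%C -> 0 < Im (W t) ->
  ra <= Cmod (W t) <= rb -> lyap (W t) <> 0 ->
  exists l, is_derive (fun s => lyap (W s)) t l /\ c * l < 0.
Proof.
intros HW HI Hr Hn.
assert (Hc := is_derive_C_continuous _ _ _ HW).
apply continuous_C_components in Hc. destruct Hc as [_ Hc].
replace (- rotation_field eps Qp (W t))%C with (RtoC (-1) * rotation_field eps Qp (W t))%C in HW
  by (apply C_eq; simpl; ring).
apply lyap_neq_0 in Hn. unfold rad in Hn. destruct (Rle_dec 0 (Im (W t))); [|lra].
destruct (lyapunov_curve eps ra rb L Qp rhop ap Ap c kappa (-1) W t) as [l [Hl Hl']]; trivial.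
- intros x. assert (K := Hrp_range x). lra.
- apply is_derive_Ap.
- lra.
- exists l. split; [|lra].
  revert Hl. apply is_derive_ext_loc. apply (filter_imp (fun s => 0 < Im (W s))).
  + intros s Hs. unfold lyap, rad, weight. destruct (Rle_dec 0 (Im (W s))); [reflexivity|lra].
  + apply (Hc (fun r => 0 < r)), (open_gt 0 _ HI).
Qed.

Lemma lyap_lower (W : R -> C) (t : R) :
  is_derive_C W t (Cconj (rotation_field eps Qm (Cconj (W t))))%C -> Im (W t) < 0 ->
  ra <= Cmod (W t) <= rb -> lyap (W t) <> 0 ->
  exists l, is_derive (fun s => lyap (W s)) t l /\ c * l < 0.
Proof.
intros HW HI Hr Hn.
assert (Hc := is_derive_C_continuous _ _ _ HW).
apply continuous_C_components in Hc. destruct Hc as [_ Hc].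
apply is_derive_C_conj in HW.
replace (Cconj (Cconj (rotation_field eps Qm (Cconj (W t))))) with (RtoC 1 * rotation_field eps Qm (Cconj (W t)))%C in HW
  by (apply C_eq; simpl; ring).
apply lyap_neq_0 in Hn. unfold rad in Hn. destruct (Rle_dec 0 (Im (W t))); [lra|].
destruct (lyapunov_curve eps ra rb L Qm rhom am Am (- c) kappa 1 (fun s => Cconj (W s)) t) as [l [Hl Hl']]; trivial.
- intros x. assert (K := Hrm_range x). lra.
- apply is_derive_Am.
- now rewrite Rabs_Ropp.
- simpl. unfold Im in HI. lra.
- now rewrite Cmod_conj.
- now rewrite ang_conj, Cmod_conj.
- exists l. split; [|lra].
  revert Hl. apply is_derive_ext_loc. apply (filter_imp (fun s => Im (W s) < 0)).
  + intros s Hs. rewrite ang_conj, Cmod_conj. unfold lyap, rad, weight. destruct (Rle_dec 0 (Im (W s))); [lra|reflexivity].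
  + apply (Hc (fun r => r < 0)), (open_lt 0 _ HI).
Qed.

Lemma upper_clockwise w : w <> RtoC 0 -> ra <= Cmod w <= rb ->
  Im (- rotation_field eps Qp w * Cconj w)%C < 0.
Proof.
intros H0 Hr. destruct (polar_form w H0) as [x Ex].
destruct (rotation_field_conj eps Qp (Cmod w) x ltac:(lra)) as [_ K]. rewrite <- Ex in K.
assert (Hs := angle_speed_pos eps ra rb L Qp Heps Hra HQp HL (Cmod w) x Hr).
replace (- rotation_field eps Qp w * Cconj w)%C with (- (rotation_field eps Qp w * Cconj w))%C by ring.
change (Im (- (rotation_field eps Qp w * Cconj w))) with (- Im (rotation_field eps Qp w * Cconj w)).
rewrite K. nra.
Qed.

Lemma lower_clockwise w : w <> RtoC 0 -> ra <= Cmod w <= rb ->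
  Im (Cconj (rotation_field eps Qm (Cconj w)) * Cconj w)%C < 0.
Proof.
intros H0 Hr. destruct (polar_form (Cconj w) (Cconj_neq_0 _ H0)) as [x Ex].
rewrite <- Cmod_conj in Hr.
destruct (rotation_field_conj eps Qm (Cmod (Cconj w)) x ltac:(lra)) as [_ K]. rewrite <- Ex in K.
assert (Hs := angle_speed_pos eps ra rb L Qm Heps Hra HQm HL (Cmod (Cconj w)) x Hr).
rewrite <- Cmult_conj.
replace (rotation_field eps Qm (Cconj w) * w)%C with (rotation_field eps Qm (Cconj w) * Cconj (Cconj w))%C
  by (f_equal; apply C_eq; simpl; unfold Re, Im; ring).
match goal with |- Im (Cconj ?u) < 0 => change (- Im u < 0) end.
rewrite K. nra.
Qed.

(** Clockwise rotation is the negativity of a real-linear function of the velocity, so it passes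
    from the one-sided fields to every convex combination, sliding velocities included. *)
Lemma filippov_clockwise z v : (1 - z)%C <> RtoC 0 -> ra <= Cmod (phi z) <= rb ->
  filippov Xp Xm z v ->
  Im ((phi z + 1) * (phi z + 1) / 2 * v * Cconj (phi z))%C < 0.
Proof.
intros H1 Hr Hv.
assert (H0 : phi z <> RtoC 0) by (apply Cmod_gt_0; lra).
assert (Up := upper_clockwise _ H0 Hr). assert (Lo := lower_clockwise _ H0 Hr).
rewrite <- HXp in Up by trivial. rewrite <- HXm in Lo by trivial.
destruct Hv as [[_ ->]|[[_ ->]|[_ [lam [Hl ->]]]]]; trivial.
set (k := ((phi z + 1) * (phi z + 1) / 2)%C) in *.
replace (k * (RtoC lam * Xp z + RtoC (1 - lam) * Xm z) * Cconj (phi z))%C with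
  (RtoC lam * (k * Xp z * Cconj (phi z)) + RtoC (1 - lam) * (k * Xm z * Cconj (phi z)))%C by ring.
set (u1 := (k * Xp z * Cconj (phi z))%C) in *. set (u2 := (k * Xm z * Cconj (phi z))%C) in *.
destruct u1 as [a1 b1], u2 as [a2 b2]. simpl in *. nra.
Qed.

(** * Periodic Filippov orbits in the annulus *)

Section Orbit.

Variables (g : R -> C) (T : R).
Hypothesis Hg : filippov_solution Xp Xm g.
Hypothesis HT : 0 < T.
Hypothesis HgT : forall t, g (t + T) = g t.
Hypothesis Hg1 : forall t, (1 - g t)%C <> RtoC 0.
Hypothesis Hgr : forall t, ra <= Cmod (phi (g t)) <= rb.

Let W t := phi (g t).

Lemma orbit_continuous t : continuous_C W t.
Proof. apply continuous_phi; [apply Hg|apply Hg1]. Qed.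

Lemma orbit_neq_0 t : W t <> RtoC 0.
Proof. apply Cmod_gt_0. assert (H := Hgr t). unfold W. lra. Qed.

(** At a real point clockwise rotation reads [Im v' * Re (W t) < 0], so the axis is crossed with
    nonzero vertical speed and no sliding arc exists in the annulus. *)
Lemma orbit_leaves_line t v : is_derive_C g t v -> filippov Xp Xm (g t) v ->
  exists eta, 0 < eta /\ ((forall t', t < t' < t + eta -> 0 < Im (W t')) \/
    (forall t', t < t' < t + eta -> Im (W t') < 0)).
Proof.
intros Hd Hv.
assert (Hc := orbit_continuous t). apply continuous_C_components in Hc. destruct Hc as [_ Hc].
assert (Hcl := filippov_clockwise _ _ (Hg1 t) (Hgr t) Hv).
assert (HW := is_derive_phi g t v Hd (Hg1 t)). fold W in HW. fold (W t) in *.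
set (v' := ((W t + 1) * (W t + 1) / 2 * v)%C) in *.
apply is_derive_C_components in HW. destruct HW as [_ HW].
destruct (Rtotal_order (Im (W t)) 0) as [H|[H|H]].
- destruct (Hc (fun r => r < 0) (open_lt 0 _ H)) as [d Hd'].
  exists d; split; [apply cond_pos|]. right. intros t' Ht'. apply Hd'.
  change (Rabs (t' - t) < d). rewrite Rabs_right; lra.
- assert (E : Im (v' * Cconj (W t))%C = Im v' * Re (W t)).
  { transitivity (Im v' * Re (W t) - Re v' * Im (W t)); [simpl; unfold Re, Im; ring|]. rewrite H. ring. }
  rewrite E in Hcl.
  destruct (Rtotal_order (Im v') 0) as [K|[K|K]].
  + destruct (derive_neg_right _ _ _ HW K) as [eta [He He']].
    exists eta; split; trivial. right. intros t' Ht'. specialize (He' t' Ht'). change (Im (W t') < Im (W t)) in He'. lra.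
  + rewrite K in Hcl. lra.
  + destruct (derive_neg_right (fun s => - Im (W s)) t (- Im v')) as [eta [He He']].
    * apply (is_derive_opp (V := R_NormedModule) _ _ _ HW).
    * lra.
    * exists eta; split; trivial. left. intros t' Ht'. specialize (He' t' Ht'). change (- Im (W t') < - Im (W t)) in He'. lra.
- destruct (Hc (fun r => 0 < r) (open_gt 0 _ H)) as [d Hd'].
  exists d; split; [apply cond_pos|]. left. intros t' Ht'. apply Hd'.
  change (Rabs (t' - t) < d). rewrite Rabs_right; lra.
Qed.

Lemma orbit_lyap_continuous t : continuous (fun s => c * lyap (W s)) t.
Proof.
apply continuous_Rmult; [apply continuous_const|].
apply continuous_lyap; [apply orbit_continuous|apply orbit_neq_0].
Qed.

Lemma orbit_lyap_derive t : lyap (W t) <> 0 -> Im (W t) <> 0 ->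
  (exists v, is_derive_C g t v /\ filippov Xp Xm (g t) v) ->
  is_derive (fun s => c * lyap (W s)) t (Derive (fun s => c * lyap (W s)) t) /\
  Derive (fun s => c * lyap (W s)) t < 0.
Proof.
intros Hn Hi [v [Hd Hv]].
assert (HW := is_derive_phi g t v Hd (Hg1 t)).
assert (H : exists l, is_derive (fun s => lyap (W s)) t l /\ c * l < 0).
{ destruct Hv as [[K ->]|[[K ->]|[K _]]].
  - rewrite HXp in HW by (apply Hg1 || apply Hgr). apply lyap_upper; trivial; [|apply Hgr].
    now apply Im_phi_pos.
  - rewrite HXm in HW by (apply Hg1 || apply Hgr). apply lyap_lower; trivial; [|apply Hgr].
    now apply Im_phi_neg.
  - exfalso. assert (E := Im_phi (g t) (Hg1 t)). rewrite K in E.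
    assert (0 < Cmod (1 - g t)%C ^ 2) by (apply pow_lt, Cmod_gt_0, Hg1). unfold W in Hi. nra. }
destruct H as [l [Hl Hl']].
assert (D : is_derive (fun s => c * lyap (W s)) t (c * l)) by now apply is_derive_scal.
assert (ED : Derive (fun s => c * lyap (W s)) t = c * l) by exact (is_derive_unique _ _ _ D).
rewrite ED. now split.
Qed.

(** [lyap] may have corners on the real axis, so no derivative is taken there. Just after each
    non-exceptional time the orbit is off the axis and free of switching, and the decrease on that
    interval extends to its left end by continuity. *)
Lemma orbit_lyap_monotone p q : p < q -> (forall t, p <= t <= q -> lyap (W t) <> 0) ->
  c * lyap (W q) < c * lyap (W p).
Proof.
intros Hpq Hn. destruct Hg as [_ Hg']. destruct (Hg' p q) as [S HS].
apply (decreasing_off_finite (fun t => c * lyap (W t)) S p q Hpq).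
- intros t _. apply orbit_lyap_continuous.
- intros t Ht HtS. destruct (HS t ltac:(lra) HtS) as [v [Hd Hv]].
  destruct (orbit_leaves_line t v Hd Hv) as [eta [He He']].
  destruct (right_gap S t) as [c0 [Hc0 Hc0']].
  set (e := Rmin (Rmin eta (c0 - t)) (q - t)).
  assert (e <= Rmin eta (c0 - t)) by apply Rmin_l. assert (e <= q - t) by apply Rmin_r.
  assert (Rmin eta (c0 - t) <= eta) by apply Rmin_l. assert (Rmin eta (c0 - t) <= c0 - t) by apply Rmin_r.
  exists e. split; [repeat apply Rmin_glb_lt; lra|]. intros t' Ht'.
  apply (decreasing_derive_off_finite (fun t => c * lyap (W t)) (Derive (fun s => c * lyap (W s))) nil t t'); [lra| |].
  + intros s _. apply orbit_lyap_continuous.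
  + intros s Hs _. apply orbit_lyap_derive.
    * apply Hn. lra.
    * destruct He' as [He'|He']; specialize (He' s ltac:(lra)); lra.
    * apply HS; [lra|]. apply Hc0'. lra.
Qed.

(* A periodic orbit attains the maximum of [lyap], against strict monotonicity. *)
Lemma orbit_lyap_zero t0 : lyap (W t0) = 0.
Proof.
destruct (Req_dec (lyap (W t0)) 0) as [|Hn]; trivial. exfalso.
assert (Hpos : forall w, 0 <= lyap w). { intros w. unfold lyap. apply pow2_ge_0. }
assert (Hcont : forall t, continuous (fun s => lyap (W s)) t).
{ intros t. apply continuous_lyap; [apply orbit_continuous|apply orbit_neq_0]. }
destruct (continuity_ab_maj (fun s => lyap (W s)) t0 (t0 + T)) as [M [HM1 HM2]]; [lra| |].
{ intros t _. apply continuity_pt_filterlim, Hcont. }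
assert (Hper : forall t, W (t + T) = W t) by (intros t; unfold W; now rewrite HgT).
(* Three periods are covered, so that a neighbourhood of the maximum point is included even if it is
   an endpoint. *)
assert (Hmax : forall t, t0 - T <= t <= t0 + 2 * T -> lyap (W t) <= lyap (W M)).
{ intros t Ht. destruct (Rlt_dec t t0).
  - rewrite <- Hper. apply HM1. lra.
  - destruct (Rle_dec t (t0 + T)); [apply HM1; lra|].
    replace t with ((t - T) + T) by ring. rewrite Hper. apply HM1. lra. }
assert (HMp : 0 < lyap (W M)).
{ assert (K := HM1 t0 ltac:(lra)). assert (K' := Hpos (W t0)). lra. }
destruct (proj1 (continuous_R_iff _ _) (Hcont M) (lyap (W M)) HMp) as [d [Hd Hd']].
set (e := Rmin (d / 2) (T / 2)).
assert (e <= d / 2) by apply Rmin_l. assert (e <= T / 2) by apply Rmin_r.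
assert (He : 0 < e) by (apply Rmin_glb_lt; lra).
assert (Hnz : forall t, M - e <= t <= M + e -> lyap (W t) <> 0).
{ intros t Ht. specialize (Hd' t). assert (Rabs (t - M) < d) by (apply Rabs_def1; lra).
  specialize (Hd' H1). apply Rabs_def2 in Hd'. lra. }
(* For [c < 0] the function grows just after its maximum, for [c > 0] it was larger just before. The
   case [c = 0] would give [kappa < 0], against the linearisation bound. *)
destruct (Rtotal_order c 0) as [Hc|[Hc|Hc]].
- assert (K := orbit_lyap_monotone M (M + e) ltac:(lra) ltac:(intros; apply Hnz; lra)).
  assert (K' := Hmax (M + e) ltac:(lra)). nra.
- rewrite Hc, Rabs_R0 in Hkappa.
  assert (K := Hlin_p rb ra 0 ltac:(lra) ltac:(lra)).
  assert (K' := Rabs_pos (radial eps Qp rb 0 - radial eps Qp ra 0 - ap 0 * (rb - ra))).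
  rewrite (Rabs_right (rb - ra)) in K by lra. nra.
- assert (K := orbit_lyap_monotone (M - e) M ltac:(lra) ltac:(intros; apply Hnz; lra)).
  assert (K' := Hmax (M - e) ltac:(lra)). nra.
Qed.

Lemma orbit_in_cycle t : cycle (g t).
Proof.
apply cycle_iff; [apply Hg1|apply orbit_neq_0|].
assert (H := orbit_lyap_zero t). unfold W in H.
destruct (Req_dec (Cmod (phi (g t)) - rad (phi (g t))) 0) as [|K]; [lra|].
apply lyap_neq_0 in K. contradiction.
Qed.

(* If the orbit missed the point at angle [x0], its argument on the plane slit
   there would be strictly decreasing and periodic. *)
Lemma cycle_in_orbit z : cycle z -> exists t, g t = z.
Proof.
intros [x0 ->]. apply NNPP. intros Hno.
(* Rotated so that the missed direction [cis x0] falls on the slit, the negative real axis. *)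
set (y := fun t => (- W t * cis (- x0))%C).
assert (Hslit : forall t, Im (y t) <> 0 \/ 0 < Re (y t)).
{ intros t. apply NNPP. intros K. apply not_or_and in K. destruct K as [K1 K2]. apply NNPP in K1.
  apply Hno. exists t. set (r := - Re (y t)).
  assert (Ey : (W t * cis (- x0))%C = RtoC r).
  { unfold r. transitivity (- y t)%C; [unfold y; ring|].
    apply C_eq; [reflexivity|]. change (- Im (y t) = 0). rewrite K1. ring. }
  assert (EW : W t = (RtoC r * cis x0)%C).
  { rewrite <- Ey, <- Cmult_assoc, (Cmult_comm (cis (- x0))), cis_mul_neg. ring. }
  assert (Hr0' : 0 < r).
  { destruct (Req_dec r 0) as [E|E]; [|unfold r in *; lra].
    exfalso. apply (orbit_neq_0 t). rewrite EW, E. ring. }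
  destruct (cycle_facts _ (orbit_in_cycle t)) as [F1 [_ F3]]. fold (W t) in F3.
  rewrite EW, rad_scale, Cmod_polar in F3 by lra.
  unfold cycle_point. rewrite <- F3, <- EW. symmetry. now apply phi_inv_phi. }
destruct Hg as [_ Hg']. destruct (Hg' 0 T) as [S HS].
set (h := fun t => slit_arg (Re (y t)) (Im (y t))).
assert (Hyc : forall t, continuous_C y t).
{ intros t. apply continuous_C_mult; [|apply continuous_const].
  apply (continuous_opp (V := C_R_NormedModule) W). apply orbit_continuous. }
assert (Hh : h T < h 0).
{ apply (decreasing_derive_off_finite h (Derive h) S); [lra| |].
  - intros t _. destruct (proj1 (continuous_C_components y t) (Hyc t)) as [Y1 Y2].
    now apply continuous_slit_arg.
  - intros t Ht HtS. destruct (HS t ltac:(lra) HtS) as [v [Hd Hv]].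
    assert (Hcl := filippov_clockwise _ _ (Hg1 t) (Hgr t) Hv).
    assert (HW := is_derive_phi g t v Hd (Hg1 t)). fold W in HW. fold (W t) in *.
    set (v' := ((W t + 1) * (W t + 1) / 2 * v)%C) in *.
    assert (Hy : is_derive_C y t (- v' * cis (- x0))%C).
    { evar_last; [apply (is_derive_C_mult (fun s => - W s)%C (fun _ => cis (- x0)) t (- v')%C (RtoC 0))|].
      - exact (is_derive_opp (V := C_R_NormedModule) _ _ _ HW).
      - apply is_derive_C_const.
      - simpl. ring. }
    apply is_derive_C_components in Hy. destruct Hy as [Y1 Y2].
    assert (D := is_derive_slit_arg _ _ _ _ _ Y1 Y2 (Hslit t)).
    change (is_derive h t ((Re (y t) * Im (- v' * cis (- x0))%C - Im (y t) * Re (- v' * cis (- x0))%C) / (Re (y t) ^ 2 + Im (y t) ^ 2))) in D.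
    assert (ED := is_derive_unique _ _ _ D).
    change (is_derive h t (Derive h t) /\ Derive h t < 0). rewrite ED. split; [exact D|]. clear ED D.
    rewrite <- Cmod2_alt.
    assert (Em : Cmod (y t) = Cmod (W t)).
    { unfold y. rewrite Cmod_mult, Cmod_opp, Cmod_cis. ring. }
    rewrite Em.
    (* The area form of position and velocity, which the rotation leaves unchanged. *)
    replace (Re (y t) * Im (- v' * cis (- x0))%C - Im (y t) * Re (- v' * cis (- x0))%C)
      with (Im (v' * Cconj (W t))%C).
    + assert (0 < Cmod (W t)) by apply Cmod_gt_0, orbit_neq_0.
      assert (0 < / Cmod (W t) ^ 2) by (apply Rinv_0_lt_compat, pow_lt; trivial).
      unfold Rdiv. nra.
    + unfold y. destruct v' as [p q], (W t) as [u w]. simpl. rewrite cos_neg, sin_neg.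
      assert (K := sin2_cos2 x0). unfold Rsqr in K.
      transitivity ((p * - w + q * u) * (sin x0 * sin x0 + cos x0 * cos x0)); [rewrite K; ring|ring]. }
assert (E : h T = h 0). { unfold h, y, W. now rewrite <- (Rplus_0_l T), HgT. }
lra.
Qed.

End Orbit.

Lemma cycle_limit_cycle : limit_cycle Xp Xm cycle.
Proof.
split; [apply cycle_closed_orbit|].
(* On the cycle [|1 - w0| >= 1], hence [|1 - z| >= 1/2] within distance 1/2, and [|phi z - phi w0| =
   2 |z - w0| / (|1 - z| |1 - w0|) <= 4 |z - w0|]. A quarter of each gap then keeps the orbit in the
   annulus. *)
set (delta := Rmin (/ 2) (Rmin ((rc - ra) / 4) ((rb - rd) / 4))).
assert (D1 : delta <= / 2) by apply Rmin_l.
assert (D2 : delta <= Rmin ((rc - ra) / 4) ((rb - rd) / 4)) by apply Rmin_r.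
assert (D3 : Rmin ((rc - ra) / 4) ((rb - rd) / 4) <= (rc - ra) / 4) by apply Rmin_l.
assert (D4 : Rmin ((rc - ra) / 4) ((rb - rd) / 4) <= (rb - rd) / 4) by apply Rmin_r.
assert (D0 : 0 < delta) by (repeat apply Rmin_glb_lt; lra).
exists delta. split; [exact D0|].
intros K' [g [T [Hg [HT [HgT [_ HK']]]]]] Hnear.
assert (Hann : forall z, K' z -> (1 - z)%C <> RtoC 0 /\ ra <= Cmod (phi z) <= rb).
{ intros z Hz. destruct (Hnear z Hz) as [w0 [Hw0 Hd]].
  destruct (cycle_facts _ Hw0) as [F1 [F2 _]].
  assert (M1 : 1 <= Cmod (1 - w0)%C).
  { assert (Hre : Re w0 < 0).
    { apply Rnot_le_lt. intros K. assert (K1 := Cmod_phi_right w0 F1 K). lra. }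
    assert (K1 := re_le_Cmod (1 - w0)%C). assert (K2 := Rle_abs (Re (1 - w0)%C)).
    change (Re (1 - w0)%C) with (1 - Re w0) in K1, K2. lra. }
  assert (M2 : / 2 <= Cmod (1 - z)%C).
  { assert (K := Cmod_triangle (1 - z)%C (z - w0)%C).
    replace (1 - z + (z - w0))%C with (1 - w0)%C in K by ring. lra. }
  assert (N : (1 - z)%C <> RtoC 0) by (apply Cmod_gt_0; lra).
  split; trivial.
  assert (E : (phi z - phi w0)%C = (2 * (z - w0) / ((1 - z) * (1 - w0)))%C).
  { unfold phi. field. split; trivial. }
  assert (Hle : Cmod (phi z - phi w0)%C <= 4 * Cmod (z - w0)%C).
  { rewrite E, Cmod_div by (apply Cmult_neq_0; trivial).
    rewrite !Cmod_mult, Cmod_R, Rabs_right by lra.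
    assert (Hz0 := Cmod_ge_0 (z - w0)%C).
    assert (Hpr : / 2 <= Cmod (1 - z)%C * Cmod (1 - w0)%C) by nra.
    apply Rle_div_l; [lra|]. nra. }
  assert (T1 := Cmod_triangle (phi z - phi w0)%C (phi w0)).
  replace (phi z - phi w0 + phi w0)%C with (phi z) in T1 by ring.
  assert (T2 := Cmod_triangle (- (phi z - phi w0))%C (phi z)). rewrite Cmod_opp in T2.
  replace (- (phi z - phi w0) + phi z)%C with (phi w0) in T2 by ring.
  lra. }
assert (Hg1 : forall t, (1 - g t)%C <> RtoC 0).
{ intros t. apply Hann, HK'. now exists t. }
assert (Hgr : forall t, ra <= Cmod (phi (g t)) <= rb).
{ intros t. apply Hann, HK'. now exists t. }
intros z. split.
- intros Hz. apply HK'. now apply (cycle_in_orbit g T).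
- intros Hz. apply HK' in Hz. destruct Hz as [t <-]. now apply (orbit_in_cycle g T).
Qed.

Lemma cycle_well_placed :
  limit_cycle Xp Xm cycle /\ surrounds cycle (RtoC (-1)) /\ ~ surrounds cycle (RtoC 1) /\
  (exists z, cycle z) /\ forall z, cycle z -> rc <= Cmod (phi z) <= rd.
Proof.
split; [exact cycle_limit_cycle|]. split; [exact cycle_surrounds_m1|].
split; [exact cycle_not_surrounds_1|]. split; [exists (cycle_point 0); now exists 0|].
intros z Hz. now apply cycle_facts.
Qed.

End Core.

(** * Taylor estimates *)

Definition annulus (r0 r1 : R) (w : C) : Prop := r0 <= Cmod w <= r1.

(** A two-point form of differentiability. The annulus is not convex, so Lipschitz bounds for [p]
    and [p'] are drawn from this inequality rather than from the mean value theorem; it is also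
    stable under the algebra that builds the perturbation. *)
Definition taylor1 (S : C -> Prop) (L : R) (p p' : C -> C) : Prop :=
  forall w w0, S w -> S w0 ->
    Cmod (p w) <= L /\ Cmod (p' w) <= L /\
    Cmod (p w - p w0 - p' w0 * (w - w0))%C <= L * Cmod (w - w0)%C ^ 2.

Definition tame (S : C -> Prop) (p : C -> C) : Prop :=
  exists (p' : C -> C) (L : R), 0 <= L /\ taylor1 S L p p'.

Section Tame.

Variable S : C -> Prop.
Hypothesis HS : forall w, S w -> Cmod w <= 1.

Lemma taylor1_diameter w w0 : S w -> S w0 -> Cmod (w - w0)%C <= 2.
Proof.
intros H H0. eapply Rle_trans; [apply Cmod_triangle|]. rewrite Cmod_opp.
specialize (HS w H) as K. specialize (HS w0 H0) as K0. lra.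
Qed.

Lemma taylor1_weaken L L' p p' : L <= L' -> taylor1 S L p p' -> taylor1 S L' p p'.
Proof.
intros HL H w w0 Hw Hw0. destruct (H w w0 Hw Hw0) as [H1 [H2 H3]].
assert (0 <= Cmod (w - w0)%C ^ 2) by apply pow2_ge_0.
repeat split; try lra. eapply Rle_trans; [exact H3|]. nra.
Qed.

Lemma taylor1_lipschitz L p p' w w0 : 0 <= L -> taylor1 S L p p' -> S w -> S w0 ->
  Cmod (p w - p w0)%C <= 3 * L * Cmod (w - w0)%C.
Proof.
intros HL H Hw Hw0. destruct (H w w0 Hw Hw0) as [_ [_ H3]]. destruct (H w0 w Hw0 Hw) as [_ [H2 _]].
assert (Hd := taylor1_diameter w w0 Hw Hw0). assert (H0 := Cmod_ge_0 (w - w0)%C).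
replace (p w - p w0)%C with ((p w - p w0 - p' w0 * (w - w0)) + p' w0 * (w - w0))%C by ring.
eapply Rle_trans; [apply Cmod_triangle|]. rewrite Cmod_mult.
assert (Cmod (p' w0) * Cmod (w - w0)%C <= L * Cmod (w - w0)%C) by (apply Rmult_le_compat_r; lra).
assert (L * Cmod (w - w0)%C ^ 2 <= L * (2 * Cmod (w - w0)%C)) by (apply Rmult_le_compat_l; nra).
lra.
Qed.

(** Adding the Taylor estimates at [w0] and at [w] cancels the values of [p] and leaves
    [(p' w - p' w0) * (w - w0)]. *)
Lemma taylor1_derivative_lipschitz L p p' w w0 : 0 <= L -> taylor1 S L p p' -> S w -> S w0 ->
  Cmod (p' w - p' w0)%C <= 2 * L * Cmod (w - w0)%C.
Proof.
intros HL H Hw Hw0.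
destruct (H w w0 Hw Hw0) as [_ [_ H1]]. destruct (H w0 w Hw0 Hw) as [_ [_ H2]].
assert (H0 := Cmod_ge_0 (w - w0)%C).
replace (w0 - w)%C with (- (w - w0))%C in H2 by ring. rewrite Cmod_opp in H2.
destruct (Req_dec (Cmod (w - w0)%C) 0) as [E|E].
- apply Cmod_eq_0 in E. assert (E' : w = w0) by (replace w with (w - w0 + w0)%C by ring; rewrite E; ring).
  rewrite E'. replace (p' w0 - p' w0)%C with (RtoC 0) by ring. rewrite Cmod_0.
  replace (w0 - w0)%C with (RtoC 0) by ring. rewrite Cmod_0. lra.
- assert (K : Cmod ((p' w - p' w0) * (w - w0))%C <= 2 * L * Cmod (w - w0)%C ^ 2).
  { replace ((p' w - p' w0) * (w - w0))%C with
      ((p w - p w0 - p' w0 * (w - w0)) + (p w0 - p w - p' w * (- (w - w0))))%C by ring.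
    eapply Rle_trans; [apply Cmod_triangle|]. lra. }
  rewrite Cmod_mult in K. apply (Rmult_le_reg_r (Cmod (w - w0)%C)); [lra|]. simpl in K. lra.
Qed.

Lemma tame_const k : tame S (fun _ => k).
Proof.
exists (fun _ => RtoC 0), (Cmod k). split; [apply Cmod_ge_0|]. intros w w0 _ _.
assert (H := Cmod_ge_0 k). assert (0 <= Cmod (w - w0)%C ^ 2) by apply pow2_ge_0.
rewrite Cmod_0. replace (k - k - 0 * (w - w0))%C with (RtoC 0) by ring. rewrite Cmod_0.
repeat split; try lra. nra.
Qed.

Lemma tame_id : tame S (fun w => w).
Proof.
exists (fun _ => RtoC 1), 1. split; [lra|]. intros w w0 Hw _.
assert (0 <= Cmod (w - w0)%C ^ 2) by apply pow2_ge_0.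
replace (w - w0 - 1 * (w - w0))%C with (RtoC 0) by ring. rewrite Cmod_0, Cmod_1.
repeat split; try lra. now apply HS.
Qed.

Lemma tame_plus p q : tame S p -> tame S q -> tame S (fun w => p w + q w)%C.
Proof.
intros [p' [Lp [HLp Hp]]] [q' [Lq [HLq Hq]]].
exists (fun w => p' w + q' w)%C, (Lp + Lq). split; [lra|]. intros w w0 Hw Hw0.
destruct (Hp w w0 Hw Hw0) as [P1 [P2 P3]]. destruct (Hq w w0 Hw Hw0) as [Q1 [Q2 Q3]].
repeat split.
- eapply Rle_trans; [apply Cmod_triangle|]. lra.
- eapply Rle_trans; [apply Cmod_triangle|]. lra.
- replace (p w + q w - (p w0 + q w0) - (p' w0 + q' w0) * (w - w0))%C with
   ((p w - p w0 - p' w0 * (w - w0)) + (q w - q w0 - q' w0 * (w - w0)))%C by ring.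
  eapply Rle_trans; [apply Cmod_triangle|]. lra.
Qed.

Lemma tame_mult p q : tame S p -> tame S q -> tame S (fun w => p w * q w)%C.
Proof.
intros [p' [Lp [HLp Hp]]] [q' [Lq [HLq Hq]]].
(* The remainder splits into three products, bounded by 1, 1 and 3 times [Lp * Lq]; the 3 is the
   Lipschitz factor of [p]. *)
exists (fun w => p' w * q w + p w * q' w)%C, (5 * (Lp * Lq)).
assert (H0 : 0 <= Lp * Lq) by nra.
split; [lra|]. intros w w0 Hw Hw0.
destruct (Hp w w0 Hw Hw0) as [P1 [P2 P3]]. destruct (Hq w w0 Hw Hw0) as [Q1 [Q2 Q3]].
destruct (Hp w0 w Hw0 Hw) as [P4 [P5 _]]. destruct (Hq w0 w Hw0 Hw) as [Q4 [Q5 _]].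
assert (Hpl := taylor1_lipschitz Lp p p' w w0 HLp Hp Hw Hw0).
assert (B : forall a b A B', Cmod a <= A -> Cmod b <= B' -> Cmod (a * b)%C <= A * B').
{ intros a b A B' Ha Hb. rewrite Cmod_mult. apply Rmult_le_compat; trivial; apply Cmod_ge_0. }
repeat split.
- specialize (B _ _ _ _ P1 Q1). lra.
- eapply Rle_trans; [apply Cmod_triangle|].
  assert (B1 := B _ _ _ _ P2 Q1). assert (B2 := B _ _ _ _ P1 Q2). lra.
- set (h := (w - w0)%C) in *.
  replace (p w * q w - p w0 * q w0 - (p' w0 * q w0 + p w0 * q' w0) * h)%C with
    (p w * (q w - q w0 - q' w0 * h) + (q w0 * (p w - p w0 - p' w0 * h) + (p w - p w0) * (q' w0 * h)))%C by ring.
  assert (Hh := Cmod_ge_0 h).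
  assert (B1 := B _ _ _ _ P1 Q3). assert (B2 := B _ _ _ _ Q4 P3).
  assert (B3 : Cmod (q' w0 * h)%C <= Lq * Cmod h) by (apply B; [trivial|lra]).
  assert (B4 := B _ _ _ _ Hpl B3).
  eapply Rle_trans; [apply Cmod_triangle|].
  assert (T := Cmod_triangle (q w0 * (p w - p w0 - p' w0 * h))%C ((p w - p w0) * (q' w0 * h))%C).
  replace (5 * (Lp * Lq) * Cmod h ^ 2) with (Lp * (Lq * Cmod h ^ 2) + (Lq * (Lp * Cmod h ^ 2) + 3 * Lp * Cmod h * (Lq * Cmod h))) by ring.
  lra.
Qed.

Lemma tame_opp p : tame S p -> tame S (fun w => - p w)%C.
Proof.
intros Hp. destruct (tame_mult (fun _ => RtoC (-1)) p (tame_const _) Hp) as [p' [L [HL H]]].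
exists p', L. split; [trivial|]. intros w w0 Hw Hw0. specialize (H w w0 Hw Hw0). cbv beta in H.
replace (RtoC (-1) * p w)%C with (- p w)%C in H by (apply C_eq; simpl; unfold Re, Im; ring).
replace (RtoC (-1) * p w0)%C with (- p w0)%C in H by (apply C_eq; simpl; unfold Re, Im; ring).
exact H.
Qed.

Lemma tame_inv_plus_1 m : 0 < m -> (forall w, S w -> m <= Cmod (w + 1)%C) ->
  tame S (fun w => / (w + 1))%C.
Proof.
intros Hm H. exists (fun w => - / ((w + 1) * (w + 1)))%C, (/ m + / (m * m) + / (m * m * m)).
assert (K1 : 0 < / m) by now apply Rinv_0_lt_compat.
assert (K2 : 0 < / (m * m)) by (apply Rinv_0_lt_compat; nra).
assert (K3 : 0 < / (m * m * m)) by (apply Rinv_0_lt_compat; repeat apply Rmult_lt_0_compat; lra).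
split; [lra|]. intros w w0 Hw Hw0.
assert (Hw' := H w Hw). assert (Hw0' := H w0 Hw0).
assert (N : (w + 1)%C <> RtoC 0) by (apply Cmod_gt_0; lra).
assert (N0 : (w0 + 1)%C <> RtoC 0) by (apply Cmod_gt_0; lra).
repeat split.
- rewrite Cmod_inv by trivial. assert (/ Cmod (w + 1)%C <= / m) by (apply Rinv_le_contravar; lra). lra.
- rewrite Cmod_opp, Cmod_inv, Cmod_mult by now apply Cmult_neq_0.
  assert (/ (Cmod (w + 1)%C * Cmod (w + 1)%C) <= / (m * m)) by (apply Rinv_le_contravar; nra). lra.
- replace (/ (w + 1) - / (w0 + 1) - - / ((w0 + 1) * (w0 + 1)) * (w - w0))%C with
    ((w - w0) * (w - w0) * / ((w + 1) * ((w0 + 1) * (w0 + 1))))%C by (field; split; trivial).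
  rewrite Cmod_mult, Cmod_inv by (repeat apply Cmult_neq_0; trivial). rewrite !Cmod_mult.
  assert (/ (Cmod (w + 1)%C * (Cmod (w0 + 1)%C * Cmod (w0 + 1)%C)) <= / (m * m * m)).
  { apply Rinv_le_contravar; [repeat apply Rmult_lt_0_compat; lra|].
    rewrite Rmult_assoc. apply Rmult_le_compat; nra. }
  assert (Hd0 := Cmod_ge_0 (w - w0)%C). rewrite Rmult_comm.
  replace (Cmod (w - w0)%C ^ 2) with (Cmod (w - w0)%C * Cmod (w - w0)%C) by ring.
  apply Rmult_le_compat_r; nra.
Qed.

Lemma tame_conj p : (forall w, S w -> S (Cconj w)) -> tame S p -> tame S (fun w => Cconj (p (Cconj w))).
Proof.
intros Hc [p' [L [HL H]]]. exists (fun w => Cconj (p' (Cconj w))), L. split; [trivial|].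
intros w w0 Hw Hw0. destruct (H _ _ (Hc w Hw) (Hc w0 Hw0)) as [H1 [H2 H3]].
rewrite !Cmod_conj. repeat split; trivial.
rewrite <- Cmod_conj, <- (Cmod_conj (w - w0)%C).
eapply Rle_trans; [|eapply Rle_trans; [exact H3|]]; right.
- f_equal. apply C_eq; simpl; unfold Re, Im; ring.
- f_equal. f_equal. f_equal. apply C_eq; simpl; unfold Re, Im; ring.
Qed.

Lemma tame_pow p n : tame S p -> tame S (fun w => p w ^ n)%C.
Proof.
intros Hp. induction n as [|n IH].
- exact (tame_const (RtoC 1)).
- apply (tame_mult p (fun w => p w ^ n)%C); trivial.
Qed.

Lemma tame_Rpoly m a p : tame S p -> tame S (fun w => Rpoly m a (p w)).
Proof.
intros Hp. induction m as [|m IH].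
- assert (K : tame S (fun w => Cconj (a 0%nat) * p w ^ 0)%C) by (apply tame_mult; [apply tame_const|now apply tame_pow]).
  destruct K as [p' [L [HL H]]]. exists p', L. split; [trivial|].
  intros w w0 Hw Hw0. unfold Rpoly. rewrite !sum_O. now apply H.
- assert (K : tame S (fun w => Rpoly m a (p w) + Cconj (a (Datatypes.S m)) * p w ^ Datatypes.S m)%C).
  { apply tame_plus; [exact IH|]. apply tame_mult; [apply tame_const|now apply tame_pow]. }
  destruct K as [p' [L [HL H]]]. exists p', L. split; [trivial|].
  intros w w0 Hw Hw0. unfold Rpoly in *. rewrite !sum_Sn. now apply H.
Qed.

End Tame.

(* The perturbation [R_m] in the coordinate [w = phi z]. *)
Definition Ppert (m : nat) (a : nat -> C) (w : C) : C :=
  ((w + 1) * (w + 1) / 2 * Rpoly m a (phi_inv w))%C.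

Lemma tame_Ppert m a r0 r1 : r1 < 1 -> tame (annulus r0 r1) (Ppert m a).
Proof.
intros Hr1.
assert (HS : forall w, annulus r0 r1 w -> Cmod w <= 1) by (intros w Hw; unfold annulus in Hw; lra).
assert (Hw1 : tame (annulus r0 r1) (fun w => w + 1)%C).
{ apply tame_plus; trivial; [now apply tame_id|now apply tame_const]. }
unfold Ppert, Cdiv. apply tame_mult; trivial.
- apply tame_mult; trivial; [now apply tame_mult|now apply tame_const].
- apply tame_Rpoly; trivial. unfold phi_inv, Cdiv. apply tame_mult; trivial.
  + apply tame_plus; trivial; [now apply tame_id|now apply tame_const].
  + apply (tame_inv_plus_1 _ (1 - r1)); [lra|]. intros w Hw. unfold annulus in Hw.
    assert (K := Cmod_triangle (w + 1)%C (- w)%C). replace (w + 1 + - w)%C with (RtoC 1) in K by ring.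
    rewrite Cmod_opp, Cmod_1 in K. lra.
Qed.

Lemma continuous_C_lipschitz (S : C -> Prop) (p : C -> C) (K : R) (F : R -> C) (t : R) :
  (forall w w0, S w -> S w0 -> Cmod (p w - p w0)%C <= K * Cmod (w - w0)%C) ->
  (forall s, S (F s)) -> continuous_C F t ->
  continuous_C (fun s => p (F s)) t.
Proof.
intros HK HS HF.
assert (Hd : forall e, 0 < e -> locally t (fun s => Cmod (p (F s) - p (F t))%C < e)).
{ intros e He.
  assert (Hc : continuous (fun s => Cmod (F s - F t)%C) t).
  { apply (continuous_comp (fun s => F s - F t)%C Cmod); [|apply continuous_Cmod].
    apply continuous_C_minus; [trivial|apply continuous_C_const]. }
  assert (HK1 : 0 < Rabs K + 1) by (generalize (Rabs_pos K); lra).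
  apply (filter_imp (fun s => Cmod (F s - F t)%C < e / (Rabs K + 1))).
  - intros s Hs. eapply Rle_lt_trans; [apply HK; apply HS|].
    assert (H0 := Cmod_ge_0 (F s - F t)%C). assert (HKa := Rle_abs K).
    assert (Cmod (F s - F t)%C * (Rabs K + 1) < e).
    { apply (Rmult_lt_compat_r (Rabs K + 1)) in Hs; [|lra]. unfold Rdiv in Hs.
      rewrite Rmult_assoc, Rinv_l in Hs by lra. lra. }
    nra.
  - apply (Hc (fun r => r < e / (Rabs K + 1))), open_lt.
    replace (F t - F t)%C with (RtoC 0) by ring. rewrite Cmod_0. now apply Rdiv_lt_0_compat. }
apply continuous_C_components; split; apply filterlim_locally; intros e.
- generalize (Hd e (cond_pos e)). apply filter_imp. intros s Hs.
  change (Rabs (Re (p (F s)) - Re (p (F t))) < e). eapply Rle_lt_trans; [|exact Hs].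
  eapply Rle_trans; [|apply re_le_Cmod]. right. f_equal.
- generalize (Hd e (cond_pos e)). apply filter_imp. intros s Hs.
  change (Rabs (Im (p (F s)) - Im (p (F t))) < e). eapply Rle_lt_trans; [|exact Hs].
  eapply Rle_trans; [|apply Rmax_Cmod]. eapply Rle_trans; [|apply Rmax_r]. right. f_equal.
Qed.

Lemma Im_le_Cmod (u : C) : Rabs (Im u) <= Cmod u.
Proof. eapply Rle_trans; [|apply Rmax_Cmod]. apply Rmax_r. Qed.

(** * Estimates for the radial equation, uniform in [eps] *)

Section HalfEstimates.

Variables (r0 r1 L : R) (Q Q' : C -> C).
Hypothesis Hr0 : 0 < r0.
Hypothesis Hr1 : r1 < 1.
Hypothesis HL0 : 0 <= L.
Hypothesis HQ : taylor1 (annulus r0 r1) L Q Q'.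

Lemma annulus_unit : forall w, annulus r0 r1 w -> Cmod w <= 1.
Proof. intros w Hw. unfold annulus in Hw. lra. Qed.

Lemma annulus_polar r x : r0 <= r <= r1 -> annulus r0 r1 (RtoC r * cis x)%C.
Proof. intros Hr. unfold annulus. rewrite Cmod_polar; lra. Qed.

Lemma polar_diff r s x : (RtoC r * cis x - RtoC s * cis x)%C = (RtoC (r - s) * cis x)%C.
Proof. rewrite RtoC_minus. ring. Qed.

Lemma Cmod_polar_diff r s x : Cmod (RtoC r * cis x - RtoC s * cis x)%C = Rabs (r - s).
Proof. rewrite polar_diff, Cmod_mult, Cmod_cis, Cmod_R. ring. Qed.

Lemma polar_part_taylor r s x : r0 <= r <= r1 -> r0 <= s <= r1 ->
  Cmod (polar_part Q r x - polar_part Q s x - RtoC (r - s) * Q' (RtoC s * cis x))%C <= L * (r - s) ^ 2.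
Proof.
intros Hr Hs.
destruct (HQ _ _ (annulus_polar r x Hr) (annulus_polar s x Hs)) as [_ [_ H]].
rewrite Cmod_polar_diff, pow2_abs in H.
eapply Rle_trans; [|exact H]. right.
rewrite polar_diff. unfold polar_part.
transitivity (Cmod ((Q (RtoC r * cis x) - Q (RtoC s * cis x) - Q' (RtoC s * cis x) * (RtoC (r - s) * cis x)) * cis (- x))%C).
- f_equal. transitivity ((Q (RtoC r * cis x) * cis (- x) - Q (RtoC s * cis x) * cis (- x)
    - RtoC (r - s) * Q' (RtoC s * cis x) * (cis x * cis (- x))))%C; [rewrite cis_mul_neg; ring|ring].
- rewrite Cmod_mult, Cmod_cis. ring.
Qed.

Lemma polar_part_lipschitz r s x : r0 <= r <= r1 -> r0 <= s <= r1 ->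
  Cmod (polar_part Q r x - polar_part Q s x)%C <= 3 * L * Rabs (r - s).
Proof.
intros Hr Hs. unfold polar_part.
replace (Q (RtoC r * cis x) * cis (- x) - Q (RtoC s * cis x) * cis (- x))%C
  with ((Q (RtoC r * cis x) - Q (RtoC s * cis x)) * cis (- x))%C by ring.
rewrite Cmod_mult, Cmod_cis, Rmult_1_r, <- (Cmod_polar_diff r s x).
apply (taylor1_lipschitz _ annulus_unit L Q Q'); trivial; now apply annulus_polar.
Qed.

Lemma polar_part_le r x : r0 <= r <= r1 -> Cmod (polar_part Q r x) <= L.
Proof.
intros Hr. unfold polar_part. rewrite Cmod_mult, Cmod_cis, Rmult_1_r.
now destruct (HQ _ _ (annulus_polar r x Hr) (annulus_polar r x Hr)) as [H _].
Qed.

Lemma continuous_polar (y : R -> R) x : continuous y x ->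
  continuous_C (fun x => RtoC (y x) * cis x)%C x.
Proof.
intros Hy. apply continuous_C_mult; [|apply continuous_cis].
apply continuous_C_components; split; simpl; [exact Hy|apply continuous_const].
Qed.

Lemma continuous_polar_part (y : R -> R) x : (forall x, r0 <= y x <= r1) -> continuous y x ->
  continuous_C (fun x => polar_part Q (y x) x) x.
Proof.
intros Hr Hy. unfold polar_part. apply continuous_C_mult.
- apply (continuous_C_lipschitz (annulus r0 r1) Q (3 * L)).
  + intros w w0 Hw Hw0. now apply (taylor1_lipschitz _ annulus_unit L Q Q').
  + intros s. now apply annulus_polar.
  + now apply continuous_polar.
- apply (continuous_comp (fun x => - x) cis); [|apply continuous_cis].
  apply (continuous_opp (V := R_NormedModule)), continuous_id.
Qed.

(** The radial derivative of [Re (polar_part Q s x)]: the factor [cis x] of the chain rule cancels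
    [cis (- x)]. *)
Definition slope (s x : R) : R := Re (Q' (RtoC s * cis x)%C).

Lemma continuous_slope s x : r0 <= s <= r1 -> continuous (slope s) x.
Proof.
intros Hs.
refine (proj1 (proj1 (continuous_C_components (fun x => Q' (RtoC s * cis x)%C) x) _)).
apply (continuous_C_lipschitz (annulus r0 r1) Q' (2 * L)).
- intros w w0 Hw Hw0. now apply (taylor1_derivative_lipschitz (annulus r0 r1) L Q Q').
- intros t. now apply annulus_polar.
- apply (continuous_polar (fun _ => s)). apply continuous_const.
Qed.

Lemma slope_lipschitz r s x : r0 <= r <= r1 -> r0 <= s <= r1 ->
  Rabs (slope r x - slope s x) <= 2 * L * Rabs (r - s).
Proof.
intros Hr Hs. rewrite <- (Cmod_polar_diff r s x).
eapply Rle_trans; [|apply (taylor1_derivative_lipschitz (annulus r0 r1) L Q Q' _ _ HL0 HQ); now apply annulus_polar].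
eapply Rle_trans; [|apply re_le_Cmod]. right. f_equal.
Qed.

Lemma slope_bound s x : r0 <= s <= r1 -> Rabs (slope s x) <= L.
Proof.
intros Hs. eapply Rle_trans; [apply re_le_Cmod|].
now destruct (HQ _ _ (annulus_polar s x Hs) (annulus_polar s x Hs)) as [_ [H _]].
Qed.

Lemma re_polar_part_taylor r s x : r0 <= r <= r1 -> r0 <= s <= r1 ->
  Rabs (Re (polar_part Q r x) - Re (polar_part Q s x) - slope s x * (r - s)) <= L * (r - s) ^ 2.
Proof.
intros Hr Hs. eapply Rle_trans; [|now apply (polar_part_taylor r s x)].
eapply Rle_trans; [|apply re_le_Cmod]. right. f_equal. unfold slope. simpl. unfold Re, Im. ring.
Qed.

Section Radial.

Variable eps : R.
Hypothesis Heps : 0 < eps.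
Hypothesis HeL : eps * L <= r0 / 2.

Let e r x := Re (polar_part Q r x) * Im (polar_part Q r x) / (r + eps * Im (polar_part Q r x)).

Lemma eps_im_bound r x : r0 <= r <= r1 -> r0 / 2 <= r + eps * Im (polar_part Q r x).
Proof.
intros Hr. assert (H := polar_part_le r x Hr). assert (H' := Im_le_Cmod (polar_part Q r x)).
assert (H'' := Rle_abs (- Im (polar_part Q r x))). rewrite Rabs_Ropp in H''. nra.
Qed.

(** [r u / (r + eps v) = u - eps u v / (r + eps v)]: the term to be averaged is isolated and the
    rest carries a factor [eps]. *)
Lemma radial_split r x : r0 <= r <= r1 -> radial eps Q r x = Re (polar_part Q r x) - eps * e r x.
Proof.
intros Hr. assert (H := eps_im_bound r x Hr). unfold radial, e. field. lra.
Qed.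

Lemma radial_excess_bound r x : r0 <= r <= r1 -> Rabs (e r x) <= 2 * L ^ 2 / r0.
Proof.
intros Hr. assert (H := eps_im_bound r x Hr). unfold e, Rdiv.
assert (H0 := polar_part_le r x Hr).
assert (H1 := re_le_Cmod (polar_part Q r x)). assert (H2 := Im_le_Cmod (polar_part Q r x)).
rewrite !Rabs_mult, Rabs_inv, (Rabs_right (r + _)) by lra.
replace (2 * L ^ 2 * / r0) with (L * L * / (r0 / 2)) by (field; lra).
apply Rmult_le_compat.
- apply Rmult_le_pos; apply Rabs_pos.
- left; apply Rinv_0_lt_compat; lra.
- apply Rmult_le_compat; try apply Rabs_pos; lra.
- apply Rinv_le_contravar; lra.
Qed.

(** The first term comes from varying the numerator, [6 L^2] times [2 / r0]; the second from varying
    the denominator, [L^2] times [5/2] times [(2 / r0)^2]. *)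
Definition excess_lip : R := 12 * L ^ 2 / r0 + 10 * L ^ 2 / r0 ^ 2.

Lemma radial_excess_lipschitz r s x : r0 <= r <= r1 -> r0 <= s <= r1 ->
  Rabs (e r x - e s x) <= excess_lip * Rabs (r - s).
Proof.
intros Hr Hs. assert (Dr := eps_im_bound r x Hr). assert (Ds := eps_im_bound s x Hs).
assert (Hl := polar_part_lipschitz r s x Hr Hs).
assert (Br := polar_part_le r x Hr). assert (Bs := polar_part_le s x Hs).
unfold e. set (p := polar_part Q r x) in *. set (q := polar_part Q s x) in *.
assert (Hu : Rabs (Re p - Re q) <= 3 * L * Rabs (r - s)).
{ eapply Rle_trans; [|exact Hl]. eapply Rle_trans; [|apply re_le_Cmod]. right. f_equal. }
assert (Hv : Rabs (Im p - Im q) <= 3 * L * Rabs (r - s)).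
{ eapply Rle_trans; [|exact Hl]. eapply Rle_trans; [|apply Im_le_Cmod]. right. f_equal. }
assert (Bu := Rle_trans _ _ _ (re_le_Cmod p) Br). assert (Bv := Rle_trans _ _ _ (Im_le_Cmod p) Br).
assert (Bu' := Rle_trans _ _ _ (re_le_Cmod q) Bs). assert (Bv' := Rle_trans _ _ _ (Im_le_Cmod q) Bs).
set (u := Re p) in *. set (v := Im p) in *. set (u' := Re q) in *. set (v' := Im q) in *.
set (d := r + eps * v) in *. set (d' := s + eps * v') in *. set (D := Rabs (r - s)) in *.
assert (HD : 0 <= D) by apply Rabs_pos.
(* The 5/2 is 1 for the radius plus 3/2 for its correction, as [3 eps L <= 3 r0 / 2 <= 3/2]. *)
assert (Hd : Rabs (d' - d) <= 5 / 2 * D).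
{ replace (d' - d) with (- (r - s) + - (eps * (v - v'))) by (unfold d, d'; ring).
  eapply Rle_trans; [apply Rabs_triang|]. rewrite !Rabs_Ropp. fold D.
  rewrite Rabs_mult, (Rabs_right eps) by lra.
  assert (eps * Rabs (v - v') <= eps * (3 * L * D)) by (apply Rmult_le_compat_l; lra).
  assert (eps * L * D <= r0 / 2 * D) by (apply Rmult_le_compat_r; lra).
  assert (r0 / 2 * D <= / 2 * D) by (apply Rmult_le_compat_r; lra). lra. }
replace (u * v / d - u' * v' / d') with
  ((u * (v - v') + (u - u') * v') * / d + u' * v' * ((d' - d) * (/ d * / d'))) by (field; lra).
assert (I1 : Rabs (/ d) <= 2 / r0).
{ rewrite Rabs_inv, Rabs_right by lra. replace (2 / r0) with (/ (r0 / 2)) by (field; lra). apply Rinv_le_contravar; lra. }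
assert (I2 : Rabs (/ d') <= 2 / r0).
{ rewrite Rabs_inv, Rabs_right by lra. replace (2 / r0) with (/ (r0 / 2)) by (field; lra). apply Rinv_le_contravar; lra. }
assert (B : forall a b A B', Rabs a <= A -> Rabs b <= B' -> Rabs (a * b) <= A * B').
{ intros a b A B' Ha Hb. rewrite Rabs_mult. apply Rmult_le_compat; trivial; apply Rabs_pos. }
assert (T1 : Rabs (u * (v - v') + (u - u') * v') <= L * (3 * L * D) + 3 * L * D * L).
{ eapply Rle_trans; [apply Rabs_triang|]. apply Rplus_le_compat; apply B; trivial. }
eapply Rle_trans; [apply Rabs_triang|].
apply Rle_trans with ((L * (3 * L * D) + 3 * L * D * L) * (2 / r0) + L * L * (5 / 2 * D * (2 / r0 * (2 / r0)))).
- apply Rplus_le_compat; repeat apply B; trivial.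
- unfold excess_lip. right. field. lra.
Qed.

(** The slope is frozen at [rs], so that the linear coefficient depends on the angle only. With
    [|r - s| <= 2 eta] the Taylor remainder costs [2 L eta] and the freezing another [2 L eta]. *)
Lemma radial_linear eta rs r s x : r0 <= rs - eta -> rs + eta <= r1 ->
  rs - eta <= r <= rs + eta -> rs - eta <= s <= rs + eta ->
  Rabs (radial eps Q r x - radial eps Q s x - slope rs x * (r - s))
   <= (4 * L * eta + eps * excess_lip) * Rabs (r - s).
Proof.
intros H1 H2 Hr Hs.
rewrite !radial_split by lra.
assert (T := re_polar_part_taylor r s x ltac:(lra) ltac:(lra)).
assert (E := radial_excess_lipschitz r s x ltac:(lra) ltac:(lra)).
assert (S := slope_lipschitz s rs x ltac:(lra) ltac:(lra)).
set (D := Rabs (r - s)) in *. assert (HD : 0 <= D) by apply Rabs_pos.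
assert (HD2 : D <= 2 * eta) by (unfold D; apply Rabs_le; lra).
assert (Hse : Rabs (s - rs) <= eta) by (apply Rabs_le; lra).
replace (Re (polar_part Q r x) - eps * e r x - (Re (polar_part Q s x) - eps * e s x) - slope rs x * (r - s)) with
  ((Re (polar_part Q r x) - Re (polar_part Q s x) - slope s x * (r - s)) + ((slope s x - slope rs x) * (r - s) + - (eps * (e r x - e s x)))) by ring.
eapply Rle_trans; [apply Rabs_triang|].
assert (T2 := Rabs_triang ((slope s x - slope rs x) * (r - s)) (- (eps * (e r x - e s x)))).
rewrite Rabs_Ropp, !Rabs_mult, (Rabs_right eps) in T2 by lra. fold D in T2.
assert (K1 : (r - s) ^ 2 = D * D). { unfold D. rewrite <- Rabs_mult, Rabs_right; [ring|apply Rle_ge, Rle_0_sqr]. }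
rewrite K1 in T.
assert (K2 : L * (D * D) <= L * (2 * eta * D)) by (apply Rmult_le_compat_l; nra).
assert (K3 : Rabs (slope s x - slope rs x) * D <= 2 * L * eta * D).
{ apply Rmult_le_compat_r; trivial. eapply Rle_trans; [exact S|]. apply Rmult_le_compat_l; lra. }
assert (K4 : eps * Rabs (e r x - e s x) <= eps * (excess_lip * D)) by (apply Rmult_le_compat_l; lra).
lra.
Qed.

Lemma radial_bound r x : r0 <= r <= r1 -> Rabs (radial eps Q r x) <= 2 * L.
Proof.
intros Hr. rewrite radial_split by trivial.
assert (H := radial_excess_bound r x Hr).
assert (H1 := Rle_trans _ _ _ (re_le_Cmod _) (polar_part_le r x Hr)).
assert (T := Rabs_triang (Re (polar_part Q r x)) (- (eps * e r x))).
rewrite Rabs_Ropp, Rabs_mult, (Rabs_right eps) in T by lra.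
assert (eps * Rabs (e r x) <= L).
{ apply Rle_trans with (eps * (2 * L ^ 2 / r0)); [apply Rmult_le_compat_l; lra|].
  replace (eps * (2 * L ^ 2 / r0)) with (eps * L * (2 * L / r0)) by (field; lra).
  apply Rle_trans with (r0 / 2 * (2 * L / r0)); [|right; field; lra].
  apply Rmult_le_compat_r; trivial. apply Rmult_le_pos; [lra|]. left; now apply Rinv_0_lt_compat. }
unfold Rminus. lra.
Qed.

Lemma radial_approx r x : r0 <= r <= r1 -> Rabs (radial eps Q r x - Re (polar_part Q r x)) <= eps * (2 * L ^ 2 / r0).
Proof.
intros Hr. rewrite radial_split by trivial.
replace (Re (polar_part Q r x) - eps * e r x - Re (polar_part Q r x)) with (- (eps * e r x)) by ring.
rewrite Rabs_Ropp, Rabs_mult, (Rabs_right eps) by lra.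
apply Rmult_le_compat_l; [lra|]. now apply radial_excess_bound.
Qed.

Lemma continuous_angle_speed (y : R -> R) x : (forall x, r0 <= y x <= r1) -> continuous y x ->
  continuous (fun x => / (y x + eps * Im (polar_part Q (y x) x))) x.
Proof.
intros Hr Hy. apply (continuous_Rinv_comp' (fun x => y x + eps * Im (polar_part Q (y x) x))).
- apply continuous_Rplus; trivial.
  apply continuous_Rmult; [apply continuous_const|].
  now apply (proj1 (continuous_C_components _ x) (continuous_polar_part y x Hr Hy)).
- assert (H := eps_im_bound (y x) x (Hr x)). lra.
Qed.

Lemma continuous_angle_time (y : R -> R) x : (forall x, r0 <= y x <= r1) -> continuous y x ->
  continuous (fun x => angle_time eps Q (y x) x) x.
Proof.
intros Hr Hy. apply continuous_Rmult; trivial. now apply continuous_angle_speed.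
Qed.

Lemma continuous_radial (y : R -> R) x : (forall x, r0 <= y x <= r1) -> continuous y x ->
  continuous (fun x => radial eps Q (y x) x) x.
Proof.
intros Hr Hy. apply continuous_Rmult.
- apply continuous_Rmult; trivial.
  now apply (proj1 (continuous_C_components _ x) (continuous_polar_part y x Hr Hy)).
- now apply continuous_angle_speed.
Qed.

End Radial.

Definition half_average (r : R) : R := RInt (fun x => Re (polar_part Q r x)) 0 PI.

Lemma continuous_re_polar_part r x : r0 <= r <= r1 -> continuous (fun x => Re (polar_part Q r x)) x.
Proof.
intros Hr. apply (proj1 (continuous_C_components _ x) (continuous_polar_part (fun _ => r) x (fun _ => Hr) (continuous_const _ _))).
Qed.

(** Integrating the pointwise Taylor bound replaces differentiation under the integral sign. *)
Lemma half_average_taylor r s : r0 <= r <= r1 -> r0 <= s <= r1 ->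
  Rabs (half_average r - half_average s - RInt (slope s) 0 PI * (r - s)) <= PI * (L * (r - s) ^ 2).
Proof.
intros Hr Hs. unfold half_average. assert (HP := PI_RGT_0).
assert (C1 := fun x => continuous_re_polar_part r x Hr).
assert (C2 := fun x => continuous_re_polar_part s x Hs).
assert (C3 := fun x => continuous_slope s x Hs).
assert (C4 : forall x, continuous (fun x => Re (polar_part Q s x) + (r - s) * slope s x) x).
{ intros x. apply continuous_Rplus; [apply C2|].
  apply continuous_Rmult; [apply continuous_const|apply C3]. }
assert (E : RInt (fun x => Re (polar_part Q s x)) 0 PI + RInt (slope s) 0 PI * (r - s) =
  RInt (fun x => Re (polar_part Q s x) + (r - s) * slope s x) 0 PI).
{ symmetry. apply is_RInt_unique.
  evar_last.
  - apply (is_RInt_plus (V := R_NormedModule)).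
    + apply (RInt_correct (V := R_CompleteNormedModule)), ex_RInt_cont, C2.
    + apply (is_RInt_scal (V := R_NormedModule)). apply (RInt_correct (V := R_CompleteNormedModule)), ex_RInt_cont, C3.
  - unfold plus, scal; simpl; unfold mult; simpl. ring. }
replace (RInt (fun x => Re (polar_part Q r x)) 0 PI - RInt (fun x => Re (polar_part Q s x)) 0 PI - RInt (slope s) 0 PI * (r - s))
  with (RInt (fun x => Re (polar_part Q r x)) 0 PI - RInt (fun x => Re (polar_part Q s x) + (r - s) * slope s x) 0 PI)
  by (rewrite <- E; ring).
apply RInt_close; trivial; [lra|].
intros x _.
replace (Re (polar_part Q r x) - (Re (polar_part Q s x) + (r - s) * slope s x)) with
  (Re (polar_part Q r x) - Re (polar_part Q s x) - slope s x * (r - s)) by ring.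
now apply re_polar_part_taylor.
Qed.

End HalfEstimates.

(** * The averaged functions as polar integrals *)

Lemma C_derive_phi (z : C) : (1 - z)%C <> RtoC 0 -> C_derive phi z = (2 / ((1 - z) * (1 - z)))%C.
Proof.
intros Hz. destruct z as [x0 y0].
set (F := fun x : R => (2 / ((1 - (x, y0)) * (1 - (x0, y0))))%C).
assert (Hline : continuous_C (fun x : R => (1 - (x, y0))%C) x0).
{ apply continuous_C_minus; [apply continuous_C_const|].
  apply continuous_C_components; split; simpl; [apply continuous_id|apply continuous_const]. }
assert (HF : continuous_C F x0).
{ unfold F, Cdiv. apply continuous_C_mult; [apply continuous_C_const|].
  apply (continuous_C_inv (fun x : R => ((1 - (x, y0)) * (1 - (x0, y0)))%C)).
  - apply continuous_C_mult; [exact Hline|apply continuous_C_const].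
  - now apply Cmult_neq_0. }
assert (Hloc : Rbar_locally' x0 (fun x => F x = ((phi (x, y0) - phi (x0, y0)) / ((x, y0) - (x0, y0)))%C)).
{ assert (Hn : locally x0 (fun x => (1 - (x, y0))%C <> RtoC 0)).
  { apply (filter_imp (fun x => 0 < Cmod (1 - (x, y0))%C)); [intros x; apply Cmod_gt_0|].
    assert (Hc : continuous (fun x => Cmod (1 - (x, y0))%C) x0).
    { apply (continuous_comp (fun x => 1 - (x, y0))%C Cmod); [exact Hline|apply continuous_Cmod]. }
    apply (Hc (fun r => 0 < r)), (open_gt 0). now apply Cmod_gt_0. }
  destruct Hn as [d Hd]. exists d. intros x Hx Hne. specialize (Hd x Hx).
  assert (Hxz : ((x, y0) - (x0, y0))%C <> RtoC 0).
  { intros E. assert (K := f_equal Re E). simpl in K. apply Hne. lra. }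
  unfold F, phi. field. repeat split; trivial. }
apply continuous_C_components in HF. destruct HF as [H1 H2].
set (q := fun x : R => ((phi (x, y0) - phi (x0, y0)) / ((x, y0) - (x0, y0)))%C) in *.
assert (L1 : is_lim (fun x => Re (q x)) x0 (Re (F x0))).
{ apply (is_lim_ext_loc (fun x => Re (F x))).
  - generalize Hloc. apply filter_imp. intros x Hx. now rewrite Hx.
  - apply (is_lim_continuity (fun x => Re (F x))). now apply continuity_pt_filterlim. }
assert (L2 : is_lim (fun x => Im (q x)) x0 (Im (F x0))).
{ apply (is_lim_ext_loc (fun x => Im (F x))).
  - generalize Hloc. apply filter_imp. intros x Hx. now rewrite Hx.
  - apply (is_lim_continuity (fun x => Im (F x))). now apply continuity_pt_filterlim. }
(* [C_derive] unfolds to the limits of the two components of the difference quotient along the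
   horizontal line through [z]. *)
change ((real (Lim (fun x => Re (q x)) x0), real (Lim (fun x => Im (q x)) x0)) = F x0).
rewrite (is_lim_unique _ _ _ L1), (is_lim_unique _ _ _ L2). now destruct (F x0).
Qed.

Lemma C_derive_phi_Rpoly m a (w : C) : Cmod w < 1 ->
  (C_derive phi (phi_inv w) * Rpoly m a (phi_inv w))%C = Ppert m a w.
Proof.
intros Hw. assert (H1 := plus_1_neq_0 w Hw).
rewrite C_derive_phi by now apply one_minus_phi_inv_neq_0.
rewrite one_minus_phi_inv by trivial. unfold Ppert. field. exact H1.
Qed.

Definition upper_pert (m : nat) (a : nat -> C) (w : C) : C := (- Ppert m a w)%C.
Definition lower_pert (m : nat) (a : nat -> C) (w : C) : C := Cconj (Ppert m a (Cconj w)).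

Lemma tame_upper m a r0 r1 : r1 < 1 -> tame (annulus r0 r1) (upper_pert m a).
Proof.
intros H. unfold upper_pert. apply tame_opp; [|now apply tame_Ppert].
intros w Hw. unfold annulus in Hw. lra.
Qed.

Lemma tame_lower m a r0 r1 : r1 < 1 -> tame (annulus r0 r1) (lower_pert m a).
Proof.
intros H. unfold lower_pert. apply (tame_conj _ (Ppert m a)); [|now apply tame_Ppert].
intros w Hw. unfold annulus in *. now rewrite Cmod_conj.
Qed.

Lemma M1_half_integrand m a r x : 0 < r < 1 ->
  let z := phi_inv (RtoC r * cis x)%C in
  (Cconj (C_derive phi z * Rpoly m a z) * (Ci * cis x))%C =
  (Ci * Cconj (Ppert m a (RtoC r * cis x) * cis (- x)))%C.
Proof.
intros Hr z. unfold z. rewrite C_derive_phi_Rpoly by (rewrite Cmod_polar; lra).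
rewrite Cmult_conj, Cconj_cis, Ropp_involutive. ring.
Qed.

Lemma continuous_Ppert_polar m a r x : 0 < r < 1 ->
  continuous_C (fun x => (Ppert m a (RtoC r * cis x) * cis (- x))%C) x.
Proof.
intros Hr. destruct (tame_Ppert m a r r ltac:(lra)) as [Q' [L [HL H]]].
apply (continuous_polar_part r r L (Ppert m a) Q' ltac:(lra) ltac:(lra) HL H (fun _ => r)); [intros; lra|apply continuous_const].
Qed.

(** [Im (Ci * Cconj u) = Re u], and conjugation turns [cis x] into [cis (- x)]: the averaged
    integrand is the radial component of the transported perturbation. *)
Lemma M1_half_RInt m a alpha r : 0 < r < 1 ->
  M1_half m a alpha r = - RInt (fun x => Re (Ppert m a (RtoC r * cis x) * cis (- x))%C) 0 alpha.
Proof.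
intros Hr. unfold M1_half. f_equal.
set (f := fun x => (Ppert m a (RtoC r * cis x) * cis (- x))%C).
assert (Hc := fun x => proj1 (continuous_C_components f x) (continuous_Ppert_polar m a r x Hr)).
assert (H : is_RInt (V := C_R_NormedModule) (fun x : R => (Ci * Cconj (f x))%C) 0 alpha
   (RInt (fun x => Im (f x)) 0 alpha, RInt (fun x => Re (f x)) 0 alpha)).
{ apply (is_RInt_fct_extend_pair (U := R_NormedModule) (V := R_NormedModule)).
  - apply (is_RInt_ext (fun x => Im (f x))); [intros; simpl; unfold Re, Im; ring|].
    apply (RInt_correct (V := R_CompleteNormedModule)), ex_RInt_cont. intros x; apply (Hc x).
  - apply (is_RInt_ext (fun x => Re (f x))); [intros; simpl; unfold Re, Im; ring|].
    apply (RInt_correct (V := R_CompleteNormedModule)), ex_RInt_cont. intros x; apply (Hc x). }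
rewrite (is_RInt_unique (V := C_R_CompleteNormedModule) _ _ _ (RInt (fun x => Im (f x)) 0 alpha, RInt (fun x => Re (f x)) 0 alpha)); [reflexivity|].
apply (is_RInt_ext (V := C_R_NormedModule) (fun x : R => (Ci * Cconj (f x))%C)); [|exact H].
intros x _. symmetry. now apply M1_half_integrand.
Qed.

Lemma M1_half_upper m a r : 0 < r < 1 -> M1_half m a PI r = half_average (upper_pert m a) r.
Proof.
intros Hr. rewrite M1_half_RInt by trivial. unfold half_average.
rewrite <- (RInt_opp (V := R_CompleteNormedModule)).
- apply (RInt_ext (V := R_CompleteNormedModule)). intros x _. unfold polar_part, upper_pert, opp. simpl. unfold Re, Im. ring.
- apply ex_RInt_cont. intros x. apply (proj1 (continuous_C_components _ x) (continuous_Ppert_polar m a r x Hr)).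
Qed.

(** The substitution x -> -x moves the integral to [0, PI], where the conjugated perturbation takes
    over; its sign cancels the outer one. *)
Lemma M1_half_lower m a r : 0 < r < 1 -> M1_half m a (- PI) r = half_average (lower_pert m a) r.
Proof.
intros Hr. rewrite M1_half_RInt by trivial. unfold half_average.
set (f := fun x => Re (Ppert m a (RtoC r * cis x) * cis (- x))%C).
assert (Hf : forall x, continuous f x).
{ intros x. apply (proj1 (continuous_C_components _ x) (continuous_Ppert_polar m a r x Hr)). }
assert (H : is_RInt (fun y : R => opp (f (- y))) 0 PI (RInt f 0 (- PI))).
{ apply (is_RInt_comp_opp (V := R_NormedModule)). rewrite Ropp_0.
  apply (RInt_correct (V := R_CompleteNormedModule)). now apply ex_RInt_cont. }
apply (is_RInt_opp (V := R_NormedModule)) in H.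
symmetry. apply is_RInt_unique.
apply (is_RInt_ext (fun y => opp (opp (f (- y))))); [|exact H].
intros x _. rewrite opp_opp. unfold f, polar_part, lower_pert.
rewrite Cmult_conj, Cconj_cis, Ropp_involutive.
replace (Cconj (RtoC r)) with (RtoC r) by (apply C_eq; simpl; ring).
rewrite <- (Cconj_cis x). destruct (Ppert m a (RtoC r * cis (- x))%C) as [u v]. simpl. ring.
Qed.

Lemma M1_average m ap am r : 0 < r < 1 ->
  M1 m ap am r = half_average (upper_pert m ap) r - half_average (lower_pert m am) r.
Proof. intros Hr. unfold M1. now rewrite M1_half_upper, M1_half_lower. Qed.

Lemma vfield_phi m eps a (z : C) : (1 - z)%C <> RtoC 0 ->
  ((phi z + 1) * (phi z + 1) / 2 * vfield m eps a z)%C = (- (Ci * phi z) + RtoC eps * Ppert m a (phi z))%C.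
Proof.
intros H. unfold Ppert. rewrite phi_inv_phi by trivial. unfold vfield.
set (R0 := Rpoly m a z).
assert (E : ((phi z + 1) * (phi z + 1) / 2 * (Ci / 2 * (z ^ 2 - 1)))%C = (- (Ci * phi z))%C).
{ unfold phi. simpl. field. exact H. }
rewrite <- E. field.
Qed.

Lemma vfield_upper m eps a z : (1 - z)%C <> RtoC 0 ->
  ((phi z + 1) * (phi z + 1) / 2 * vfield m eps a z)%C = (- rotation_field eps (upper_pert m a) (phi z))%C.
Proof. intros H. rewrite vfield_phi by trivial. unfold rotation_field, upper_pert. ring. Qed.

Lemma vfield_lower m eps a z : (1 - z)%C <> RtoC 0 ->
  ((phi z + 1) * (phi z + 1) / 2 * vfield m eps a z)%C =
  Cconj (rotation_field eps (lower_pert m a) (Cconj (phi z))).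
Proof.
intros H. rewrite vfield_phi by trivial. unfold rotation_field, lower_pert.
replace (Cconj (Cconj (phi z))) with (phi z) by (apply C_eq; simpl; unfold Re, Im; ring).
destruct (Ppert m a (phi z)) as [u v]. destruct (phi z) as [x y]. apply C_eq; simpl; ring.
Qed.

(** * The averaging theorem *)

Section HalfFlow.

Variables (r0 r1 L : R) (Q Q' : C -> C).
Hypothesis Hr0 : 0 < r0.
Hypothesis Hr1 : r1 < 1.
Hypothesis HL0 : 0 <= L.
Hypothesis HQ : taylor1 (annulus r0 r1) L Q Q'.
Variables (rs eta A eps : R).
Hypothesis Heta : 0 < eta.
Hypothesis Hlo : r0 <= rs - eta.
Hypothesis Hhi : rs + eta <= r1.
Hypothesis HA : 4 * L * eta <= A / 4.
Hypothesis Heps : 0 < eps.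
Hypothesis HeL : eps * L <= r0 / 2.
Hypothesis Hex : eps * excess_lip r0 L <= A / 4.
Hypothesis Hpic : PI * (eps * (L + A)) <= / 2.
Hypothesis Hdisp : PI * (eps * (2 * L)) <= eta / 4.

(** Outside the band of half-width [eta] around [rs] the field is continued constantly in the
    radius, which gives the global hypotheses of Picard. A solution starting within [eta / 2] of
    [rs] moves by at most [eta / 4] and never feels the clamp. *)
Definition clamped_radial (r x : R) : R := eps * radial eps Q (clamp (rs - eta) (rs + eta) r) x.

Definition half_flow (xi x : R) : R := picard clamped_radial PI xi x.

Lemma A_nonneg : 0 <= A.
Proof. assert (0 <= L * eta) by nra. lra. Qed.

Lemma clamp_annulus r : r0 <= clamp (rs - eta) (rs + eta) r <= r1.
Proof. assert (H := clamp_range (rs - eta) (rs + eta) r ltac:(lra)). lra. Qed.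

Lemma radial_lipschitz r s x : rs - eta <= r <= rs + eta -> rs - eta <= s <= rs + eta ->
  Rabs (radial eps Q r x - radial eps Q s x) <= (L + A) * Rabs (r - s).
Proof.
intros Hr Hs.
assert (K := radial_linear r0 r1 L Q Q' Hr0 Hr1 HL0 HQ eps Heps HeL eta rs r s x Hlo Hhi Hr Hs).
assert (S := slope_bound r0 r1 L Q Q' Hr0 HQ rs x ltac:(lra)).
assert (HD := Rabs_pos (r - s)).
replace (radial eps Q r x - radial eps Q s x) with
  ((radial eps Q r x - radial eps Q s x - slope Q' rs x * (r - s)) + slope Q' rs x * (r - s)) by ring.
eapply Rle_trans; [apply Rabs_triang|]. rewrite (Rabs_mult (slope Q' rs x)).
assert (HA0 := A_nonneg).
assert (Rabs (slope Q' rs x) * Rabs (r - s) <= L * Rabs (r - s)) by now apply Rmult_le_compat_r.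
assert ((4 * L * eta + eps * excess_lip r0 L) * Rabs (r - s) <= A * Rabs (r - s)) by (apply Rmult_le_compat_r; lra).
lra.
Qed.

Lemma clamped_radial_lipschitz r s x :
  Rabs (clamped_radial r x - clamped_radial s x) <= eps * (L + A) * Rabs (r - s).
Proof.
unfold clamped_radial. rewrite <- Rmult_minus_distr_l, Rabs_mult, (Rabs_right eps), Rmult_assoc by lra.
apply Rmult_le_compat_l; [lra|].
eapply Rle_trans; [apply radial_lipschitz; apply clamp_range; lra|].
assert (HA0 := A_nonneg). apply Rmult_le_compat_l; [lra|apply clamp_lipschitz].
Qed.

Lemma clamped_radial_bound r x : Rabs (clamped_radial r x) <= eps * (2 * L).
Proof.
unfold clamped_radial. rewrite Rabs_mult, (Rabs_right eps) by lra.
apply Rmult_le_compat_l; [lra|].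
apply (radial_bound r0 r1 L Q Q' Hr0 HL0 HQ eps Heps HeL). apply clamp_annulus.
Qed.

Lemma clamped_radial_continuous (y : R -> R) : (forall x, continuous y x) ->
  forall x, continuous (fun x => clamped_radial (y x) x) x.
Proof.
intros Hy x. apply continuous_Rmult; [apply continuous_const|].
apply (continuous_radial r0 r1 L Q Q' Hr0 Hr1 HL0 HQ eps Heps HeL (fun x => clamp (rs - eta) (rs + eta) (y x))).
- intros; apply clamp_annulus.
- apply (continuous_comp y); [apply Hy|]. apply (lipschitz_continuous _ 1).
  intros. rewrite Rmult_1_l. apply clamp_lipschitz.
Qed.

Lemma half_flow_continuous xi x : continuous (half_flow xi) x.
Proof.
apply (picard_continuous clamped_radial (eps * (L + A)) (eps * (2 * L)) PI PI_RGT_0 Hpic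
  clamped_radial_lipschitz clamped_radial_bound clamped_radial_continuous).
Qed.

Lemma half_flow_range xi x : Rabs (half_flow xi x - xi) <= PI * (eps * (2 * L)).
Proof.
apply (picard_range clamped_radial (eps * (L + A)) (eps * (2 * L)) PI PI_RGT_0 Hpic
  clamped_radial_lipschitz clamped_radial_bound clamped_radial_continuous).
Qed.

Lemma half_flow_equation xi x : half_flow xi x =
  xi + RInt (fun t => clamped_radial (half_flow xi t) t) 0 (clamp 0 PI x).
Proof.
apply (picard_equation clamped_radial (eps * (L + A)) (eps * (2 * L)) PI PI_RGT_0 Hpic
  clamped_radial_lipschitz clamped_radial_bound clamped_radial_continuous).
Qed.

Lemma half_flow_0 xi : half_flow xi 0 = xi.
Proof.
rewrite half_flow_equation, clamp_id by (assert (H := PI_RGT_0); lra).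
rewrite RInt_point. unfold zero; simpl. ring.
Qed.

Lemma half_flow_lipschitz xi xi' x : Rabs (half_flow xi x - half_flow xi' x) <= 2 * Rabs (xi - xi').
Proof.
apply (picard_lipschitz_initial clamped_radial (eps * (L + A)) (eps * (2 * L)) PI PI_RGT_0 Hpic
  clamped_radial_lipschitz clamped_radial_bound clamped_radial_continuous).
Qed.

Section Initial.

Variable xi : R.
Hypothesis Hxi : rs - eta / 2 <= xi <= rs + eta / 2.

Lemma half_flow_annulus x : rs - 3 / 4 * eta <= half_flow xi x <= rs + 3 / 4 * eta.
Proof. assert (H := half_flow_range xi x). apply Rabs_le_between in H. lra. Qed.

Lemma is_derive_half_flow x : 0 < x < PI ->
  is_derive (half_flow xi) x (eps * radial eps Q (half_flow xi x) x).
Proof.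
intros Hx. evar_last.
- apply (is_derive_picard clamped_radial (eps * (L + A)) (eps * (2 * L)) PI PI_RGT_0 Hpic
    clamped_radial_lipschitz clamped_radial_bound clamped_radial_continuous xi x Hx).
- unfold clamped_radial at 1. fold (half_flow xi x). rewrite clamp_id; [reflexivity|].
  assert (H := half_flow_annulus x). lra.
Qed.

(** Two errors of order [eps] enter the integrand, from freezing the radius at [xi] and from
    replacing [radial] by its leading term; the outer factor [eps] makes the total second order. *)
Lemma half_flow_averaging :
  Rabs (half_flow xi PI - xi - eps * half_average Q xi)
    <= PI * (eps * (eps * ((L + A) * (PI * (2 * L)) + 2 * L ^ 2 / r0))).
Proof.
assert (HP := PI_RGT_0).
assert (Hc : forall x, continuous (fun x => Re (polar_part Q xi x)) x).
{ intros x. apply (continuous_re_polar_part r0 r1 L Q Q' Hr0 Hr1 HL0 HQ). lra. }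
assert (E : eps * half_average Q xi = RInt (fun x => eps * Re (polar_part Q xi x)) 0 PI).
{ symmetry. apply (RInt_scal (V := R_CompleteNormedModule)). now apply ex_RInt_cont. }
rewrite half_flow_equation, clamp_id, E by lra.
assert (E' : forall a b c : R, a + b - a - c = b - c) by (intros; ring). rewrite E'. clear E'.
apply RInt_close; [|  |lra|].
- apply clamped_radial_continuous. apply half_flow_continuous.
- intros x. apply continuous_Rmult; [apply continuous_const|apply Hc].
- intros x _. unfold clamped_radial. assert (Ha := half_flow_annulus x).
  rewrite clamp_id by lra.
  rewrite <- Rmult_minus_distr_l, Rabs_mult, (Rabs_right eps) by lra.
  apply Rmult_le_compat_l; [lra|].
  assert (K1 := radial_lipschitz (half_flow xi x) xi x ltac:(lra) ltac:(lra)).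
  assert (K2 := radial_approx r0 r1 L Q Q' Hr0 HQ eps Heps HeL xi x ltac:(lra)).
  assert (K3 := half_flow_range xi x). assert (HA0 := A_nonneg).
  replace (radial eps Q (half_flow xi x) x - Re (polar_part Q xi x)) with
   ((radial eps Q (half_flow xi x) x - radial eps Q xi x) + (radial eps Q xi x - Re (polar_part Q xi x))) by ring.
  eapply Rle_trans; [apply Rabs_triang|].
  assert ((L + A) * Rabs (half_flow xi x - xi) <= (L + A) * (PI * (eps * (2 * L)))) by (apply Rmult_le_compat_l; lra).
  lra.
Qed.

End Initial.

Lemma half_flow_spec : exists rho : R -> R -> R,
  (forall w, rs - eta <= Cmod w <= rs + eta -> Cmod (Q w) <= L) /\
  (forall x, continuous (slope Q' rs) x) /\
  (forall r s x, rs - eta <= r <= rs + eta -> rs - eta <= s <= rs + eta ->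
    Rabs (radial eps Q r x - radial eps Q s x - slope Q' rs x * (r - s)) <= A / 2 * Rabs (r - s)) /\
  (forall xi, rho xi 0 = xi) /\
  (forall xi x, continuous (rho xi) x) /\
  (forall xi xi' x, Rabs (rho xi x - rho xi' x) <= 2 * Rabs (xi - xi')) /\
  forall xi, rs - eta / 2 <= xi <= rs + eta / 2 ->
    (forall x, rs - 3 / 4 * eta <= rho xi x <= rs + 3 / 4 * eta) /\
    (forall x, 0 < x < PI -> is_derive (rho xi) x (eps * radial eps Q (rho xi x) x)) /\
    (forall x, continuous (fun x => angle_time eps Q (rho xi x) x) x) /\
    Rabs (rho xi PI - xi - eps * half_average Q xi)
      <= PI * (eps * (eps * ((L + A) * (PI * (2 * L)) + 2 * L ^ 2 / r0))).
Proof.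
exists half_flow. repeat apply conj.
- intros w Hw. apply (HQ w w); unfold annulus; lra.
- intros x. apply (continuous_slope r0 r1 L Q Q'); trivial; lra.
- intros r s x Hr Hs. eapply Rle_trans.
  + apply (radial_linear r0 r1 L Q Q' Hr0 Hr1 HL0 HQ eps Heps HeL eta rs r s x Hlo Hhi Hr Hs).
  + apply Rmult_le_compat_r; [apply Rabs_pos|lra].
- exact half_flow_0.
- exact half_flow_continuous.
- exact half_flow_lipschitz.
- intros xi Hxi. repeat apply conj.
  + now apply half_flow_annulus.
  + now apply is_derive_half_flow.
  + intros x. apply (continuous_angle_time r0 r1 L Q Q' Hr0 Hr1 HL0 HQ eps Heps HeL (half_flow xi)).
    * intros y. assert (K := half_flow_annulus xi Hxi y). lra.
    * apply half_flow_continuous.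
  + now apply half_flow_averaging.
Qed.

End HalfFlow.

Lemma is_derive_quadratic (f : R -> R) (x l K delta : R) : 0 < delta -> 0 <= K ->
  (forall y, Rabs (y - x) < delta -> Rabs (f y - f x - l * (y - x)) <= K * (y - x) ^ 2) ->
  is_derive f x l.
Proof.
intros Hd HK H. apply is_derive_Reals. intros e He.
assert (Hp : 0 < Rmin delta (e / (K + 1))) by (apply Rmin_glb_lt; [lra|apply Rdiv_lt_0_compat; lra]).
exists (mkposreal _ Hp). simpl. intros h Hh0 Hh.
assert (H1 := Rlt_le_trans _ _ _ Hh (Rmin_l _ _)). assert (H2 := Rlt_le_trans _ _ _ Hh (Rmin_r _ _)).
specialize (H (x + h)). replace (x + h - x) with h in H by ring. specialize (H H1).
assert (Hah : 0 < Rabs h) by now apply Rabs_pos_lt.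
replace ((f (x + h) - f x) / h - l) with ((f (x + h) - f x - l * h) * / h) by (field; trivial).
rewrite Rabs_mult, Rabs_inv. apply (Rmult_lt_reg_r (Rabs h)); trivial.
rewrite Rmult_assoc, Rinv_l, Rmult_1_r by lra.
assert (H3 : Rabs h * (K + 1) < e).
{ apply (Rmult_lt_compat_r (K + 1)) in H2; [|lra]. unfold Rdiv in H2. rewrite Rmult_assoc, Rinv_l in H2 by lra. lra. }
assert (E : h ^ 2 = Rabs h * Rabs h) by (rewrite <- Rabs_mult, Rabs_right; [ring|apply Rle_ge, Rle_0_sqr]).
rewrite E in H. nra.
Qed.

Lemma small_eps (l : list (R * R)) : (forall p, In p l -> 0 < snd p) ->
  exists e0, 0 < e0 /\ forall e, 0 < e <= e0 -> forall p, In p l -> e * fst p < snd p.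
Proof.
induction l as [|[X Y] l IH]; intros H.
- exists 1. split; [lra|]. simpl; tauto.
- destruct IH as [e1 [He1 H1]]. { intros p Hp. apply H. now right. }
  assert (HY : 0 < Y) by (apply (H (X, Y)); now left). assert (HX := Rabs_pos X). assert (HX' := Rle_abs X).
  exists (Rmin e1 (Y / (Rabs X + 1))). split; [apply Rmin_glb_lt; trivial; apply Rdiv_lt_0_compat; lra|].
  intros e [He He'] p [<-|Hp].
  + assert (K := Rle_trans _ _ _ He' (Rmin_r _ _)). apply Rle_div_r in K; [simpl; nra|lra].
  + apply H1; trivial. assert (K := Rle_trans _ _ _ He' (Rmin_l _ _)). lra.
Qed.

(** The last two clauses tell apart the cycles born from different zeros. *)
Definition well_placed (Xp Xm : C -> C) (rs eta : R) (K : C -> Prop) : Prop :=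
  limit_cycle Xp Xm K /\ surrounds K (RtoC (-1)) /\ ~ surrounds K (RtoC 1) /\
  (exists z, K z) /\ forall z, K z -> Rabs (Cmod (phi z) - rs) < eta.

Lemma simple_zero_cycle m ap am rs eta0 :
  0 < rs < 1 -> simple_zero (M1 m ap am) rs -> 0 < eta0 ->
  exists eps0, 0 < eps0 /\ forall eps, 0 < eps < eps0 ->
    exists K, well_placed (vfield m eps ap) (vfield m eps am) rs eta0 K.
Proof.
intros Hrs [Hz [d [Hd Hd0]]] Heta0. assert (HP := PI_RGT_0).
set (r0 := rs / 2). set (r1 := (1 + rs) / 2).
assert (Hr0 : 0 < r0) by (unfold r0; lra). assert (Hr1 : r1 < 1) by (unfold r1; lra).
destruct (tame_upper m ap r0 r1 Hr1) as [Qp' [Lp [HLp HQp0]]].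
destruct (tame_lower m am r0 r1 Hr1) as [Qm' [Lm [HLm HQm0]]].
set (L := Lp + Lm + 1). assert (HL1 : 1 <= L) by (unfold L; lra). assert (HL : 0 <= L) by lra.
assert (HQp : taylor1 (annulus r0 r1) L (upper_pert m ap) Qp') by (apply (taylor1_weaken _ Lp); [unfold L; lra|trivial]).
assert (HQm : taylor1 (annulus r0 r1) L (lower_pert m am) Qm') by (apply (taylor1_weaken _ Lm); [unfold L; lra|trivial]).
clear HQp0 HQm0.
set (Qp := upper_pert m ap) in *. set (Qm := lower_pert m am) in *.
set (sp := RInt (slope Qp' rs) 0 PI). set (sm := RInt (slope Qm' rs) 0 PI).
assert (HM : forall r, r0 <= r <= r1 -> Rabs (M1 m ap am r - (sp - sm) * (r - rs)) <= 2 * PI * L * (r - rs) ^ 2).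
{ intros r Hr. rewrite M1_average by (unfold r0, r1 in *; lra). fold Qp Qm.
  assert (Hz' : half_average Qp rs - half_average Qm rs = 0) by (rewrite <- Hz; symmetry; apply M1_average; lra).
  assert (K1 := half_average_taylor r0 r1 L Qp Qp' Hr0 Hr1 HL HQp r rs Hr ltac:(unfold r0, r1; lra)).
  assert (K2 := half_average_taylor r0 r1 L Qm Qm' Hr0 Hr1 HL HQm r rs Hr ltac:(unfold r0, r1; lra)).
  fold sp in K1. fold sm in K2.
  set (a := half_average Qp r - half_average Qp rs - sp * (r - rs)) in *.
  set (b := half_average Qm r - half_average Qm rs - sm * (r - rs)) in *.
  replace (half_average Qp r - half_average Qm r - (sp - sm) * (r - rs)) with (a + - b) by (unfold a, b; lra).
  eapply Rle_trans; [apply Rabs_triang|]. rewrite Rabs_Ropp. lra. }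
assert (Ed : d = sp - sm).
{ assert (K : is_derive (M1 m ap am) rs (sp - sm)).
  { apply (is_derive_quadratic _ _ _ (2 * PI * L) (Rmin (rs / 2) ((1 - rs) / 2))).
    - apply Rmin_glb_lt; lra.
    - apply Rmult_le_pos; lra.
    - intros r Hr. rewrite Hz, Rminus_0_r. apply HM.
      assert (T1 := Rlt_le_trans _ _ _ Hr (Rmin_l _ _)). assert (T2 := Rlt_le_trans _ _ _ Hr (Rmin_r _ _)).
      apply Rabs_def2 in T1. apply Rabs_def2 in T2. unfold r0, r1. lra. }
  rewrite <- (is_derive_unique _ _ _ Hd). now apply is_derive_unique. }
rewrite <- Ed in HM.
(* The value forced by the matching of the weights at PI: with [sp - sm = d], the balance condition
   is [2 PI c = d]. *)
set (c := d / (2 * PI)). set (A := Rabs c).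
assert (Ec : 2 * PI * c = d) by (unfold c; field; lra).
assert (Hc0 : c <> 0) by (intros E; rewrite E in Ec; lra).
assert (HA0 : 0 < A) by now apply Rabs_pos_lt.
assert (EA : Rabs d = 2 * PI * A) by (rewrite <- Ec, Rabs_mult, (Rabs_right (2 * PI)) by lra; reflexivity).
(* In order: closeness to the zero, room on both sides inside the annulus, and [4 L eta < A / 4],
   half of the error [kappa = A / 2] allowed against [|c| = A]. *)
destruct (small_eps ((1, eta0) :: (1, rs / 4) :: (1, (1 - rs) / 4) :: (16 * L, A) :: nil)) as [eta [Heta He]].
{ intros p [<-|[<-|[<-|[<-|[]]]]]; simpl; lra. }
assert (E1 := He eta ltac:(lra) (1, eta0) ltac:(simpl; tauto)).
assert (E2 := He eta ltac:(lra) (1, rs / 4) ltac:(simpl; tauto)).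
assert (E3 := He eta ltac:(lra) (1, (1 - rs) / 4) ltac:(simpl; tauto)).
assert (E5 := He eta ltac:(lra) (16 * L, A) ltac:(simpl; tauto)).
simpl in E1, E2, E3, E5. clear He.
assert (Hlo : r0 <= rs - eta) by (unfold r0; lra).
assert (Hhi : rs + eta <= r1) by (unfold r1; lra).
assert (HA : 4 * L * eta <= A / 4) by lra.
set (E := (L + A) * (PI * (2 * L)) + 2 * L ^ 2 / r0).
assert (HdA : 0 < Rabs d) by now apply Rabs_pos_lt.
(* In order: positive angular speed, the other half of [kappa], contraction of the Picard operator,
   small displacement, and an averaging error below half of the main term [|d| eta / 2]. *)
destruct (small_eps ((L, r0 / 2) :: (excess_lip r0 L, A / 4) :: (PI * (L + A), / 2) ::
  (PI * (2 * L), eta / 4) :: (2 * (PI * E), Rabs d * (eta / 4)) :: nil)) as [eps0 [He0 He]].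
{ intros p [<-|[<-|[<-|[<-|[<-|[]]]]]]; simpl; try lra. apply Rmult_lt_0_compat; lra. }
exists eps0. split; [exact He0|]. intros eps [Heps Heps'].
assert (HeL := He eps ltac:(lra) (L, r0 / 2) ltac:(simpl; tauto)).
assert (Hex := He eps ltac:(lra) (excess_lip r0 L, A / 4) ltac:(simpl; tauto)).
assert (Hpic := He eps ltac:(lra) (PI * (L + A), / 2) ltac:(simpl; tauto)).
assert (Hdisp := He eps ltac:(lra) (PI * (2 * L), eta / 4) ltac:(simpl; tauto)).
assert (He5' := He eps ltac:(lra) (2 * (PI * E), Rabs d * (eta / 4)) ltac:(simpl; tauto)).
cbv [fst snd] in HeL, Hex, Hpic, Hdisp, He5'. clear He Heps'.
destruct (half_flow_spec r0 r1 L Qp Qp' Hr0 Hr1 HL HQp rs eta A eps Heta Hlo Hhi HA Heps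
  ltac:(lra) ltac:(lra) ltac:(lra) ltac:(lra))
  as [fp [Bp [Sp [Lp' [Jp [Cp [Op Fp]]]]]]].
destruct (half_flow_spec r0 r1 L Qm Qm' Hr0 Hr1 HL HQm rs eta A eps Heta Hlo Hhi HA Heps
  ltac:(lra) ltac:(lra) ltac:(lra) ltac:(lra))
  as [fm [Bm [Sm [Lm' [Jm [Cm [Om Fm]]]]]]].
set (D := fun xi => fp xi PI - fm xi PI).
assert (HD : forall xi, rs - eta / 2 <= xi <= rs + eta / 2 ->
  Rabs (D xi - eps * M1 m ap am xi) <= eps * (eps * (2 * (PI * E)))).
{ intros xi Hxi. rewrite M1_average by lra. fold Qp Qm.
  destruct (Fp xi Hxi) as [_ [_ [_ K1]]]. destruct (Fm xi Hxi) as [_ [_ [_ K2]]]. fold E in K1, K2.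
  set (a := fp xi PI - xi - eps * half_average Qp xi) in *.
  set (b := fm xi PI - xi - eps * half_average Qm xi) in *.
  replace (D xi - eps * (half_average Qp xi - half_average Qm xi)) with (a + - b) by (unfold a, b, D; ring).
  eapply Rle_trans; [apply Rabs_triang|]. rewrite Rabs_Ropp. lra. }
(* At distance [eta / 2], after division by [eps], the linear term [d h] exceeds the Taylor
   remainder of M1 and the averaging error together, as each is at most [|d| eta / 4] and the latter
   is strictly less. So [D] changes sign between the two ends. *)
assert (Hsign : forall h, Rabs h = eta / 2 -> 0 < D (rs + h) * (d * h)).
{ intros h Hh.
  assert (Hhb : - (eta / 2) <= h <= eta / 2) by (apply Rabs_le_between; lra).
  assert (K1 := HD (rs + h) ltac:(lra)).
  assert (K2 := HM (rs + h) ltac:(lra)). replace (rs + h - rs) with h in K2 by ring.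
  assert (Eh : h ^ 2 = eta / 2 * (eta / 2)).
  { rewrite <- Hh, <- Rabs_mult, Rabs_right; [ring|apply Rle_ge, Rle_0_sqr]. }
  rewrite Eh in K2.
  assert (K3 : Rabs (D (rs + h) - eps * (d * h)) < eps * (Rabs d * (eta / 2))).
  { replace (D (rs + h) - eps * (d * h)) with ((D (rs + h) - eps * M1 m ap am (rs + h)) + eps * (M1 m ap am (rs + h) - d * h)) by ring.
    eapply Rle_lt_trans; [apply Rabs_triang|]. rewrite (Rabs_mult eps), (Rabs_right eps) by lra.
    assert (K4 : 2 * PI * L * (eta / 2 * (eta / 2)) <= Rabs d * (eta / 4)).
    { rewrite EA. replace (2 * PI * L * (eta / 2 * (eta / 2))) with (2 * PI * (eta / 4) * (L * eta)) by field.
      replace (2 * PI * A * (eta / 4)) with (2 * PI * (eta / 4) * A) by ring.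
      apply Rmult_le_compat_l; [|lra]. apply Rmult_le_pos; lra. }
    assert (eps * Rabs (M1 m ap am (rs + h) - d * h) <= eps * (Rabs d * (eta / 4))) by (apply Rmult_le_compat_l; lra).
    assert (eps * (eps * (2 * (PI * E))) < eps * (Rabs d * (eta / 4))) by (apply Rmult_lt_compat_l; lra).
    lra. }
  rewrite <- Hh, <- Rabs_mult in K3.
  assert (Hdh : d * h <> 0).
  { apply Rmult_integral_contrapositive. split; trivial. intros E0. rewrite E0, Rabs_R0 in Hh. lra. }
  apply Rabs_def2 in K3. destruct (Rtotal_order (d * h) 0) as [K|[K|K]]; [|contradiction|].
  - rewrite Rabs_left in K3 by trivial. nra.
  - rewrite Rabs_right in K3 by lra. nra. }
assert (HDc : forall xi, continuous D xi).
{ intros xi. apply (lipschitz_continuous _ 4). intros x y.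
  assert (K1 := Op x y PI). assert (K2 := Om x y PI).
  unfold D. replace (fp x PI - fm x PI - (fp y PI - fm y PI)) with ((fp x PI - fp y PI) + - (fm x PI - fm y PI)) by ring.
  eapply Rle_trans; [apply Rabs_triang|]. rewrite Rabs_Ropp. lra. }
destruct (IVT_cor D (rs - eta / 2) (rs + eta / 2)) as [xi [Hxi HDxi]].
{ intros x. apply continuity_pt_filterlim, HDc. }
{ lra. }
{ assert (K1 := Hsign (eta / 2) ltac:(rewrite Rabs_right; lra)).
  assert (K2 := Hsign (- (eta / 2)) ltac:(rewrite Rabs_left; lra)).
  replace (rs + - (eta / 2)) with (rs - eta / 2) in K2 by ring.
  assert (Hd2 : 0 < d * d) by nra.
  apply Rnot_lt_le. intros K.
  assert (K3 : 0 < (D (rs + eta / 2) * (d * (eta / 2))) * (D (rs - eta / 2) * (d * - (eta / 2)))) by now apply Rmult_lt_0_compat.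
  replace ((D (rs + eta / 2) * (d * (eta / 2))) * (D (rs - eta / 2) * (d * - (eta / 2)))) with
    (- ((D (rs - eta / 2) * D (rs + eta / 2)) * ((d * d) * (eta / 2 * (eta / 2))))) in K3 by ring.
  assert (0 < (D (rs - eta / 2) * D (rs + eta / 2)) * ((d * d) * (eta / 2 * (eta / 2)))).
  { apply Rmult_lt_0_compat; trivial. apply Rmult_lt_0_compat; trivial. nra. }
  lra. }
destruct (Fp xi Hxi) as [Rp [Dp [Tp _]]]. destruct (Fm xi Hxi) as [Rm [Dm [Tm _]]].
exists (cycle (fp xi) (fm xi)).
destruct (cycle_well_placed (rs - eta) (rs + eta) (rs - 3 / 4 * eta) (rs + 3 / 4 * eta) eps L Qp Qm
   (vfield m eps ap) (vfield m eps am) (fp xi) (fm xi)) with (c := c) (kappa := A / 2)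
   (ap := slope Qp' rs) (am := slope Qm' rs) as [W1 [W2 [W3 [W4 W5]]]]; trivial; try lra.
- intros z Hz1 _. now apply vfield_upper.
- intros z Hz1 _. now apply vfield_lower.
- now rewrite Jp, Jm.
- unfold D in HDxi. lra.
- fold A. lra.
- fold sp sm. lra.
- split; [trivial|split; [trivial|split; [trivial|split; [trivial|]]]].
  intros z Hz1. specialize (W5 z Hz1). apply Rabs_def1; lra.
Qed.

(** * Nests of limit cycles *)

Lemma list_separation (s : list R) :
  exists eta, 0 < eta /\ forall r r', In r s -> In r' s -> r <> r' -> 2 * eta <= Rabs (r - r').
Proof.
assert (H1 : forall (a : R) (s : list R), exists eta, 0 < eta /\ forall r, In r s -> r <> a -> 2 * eta <= Rabs (r - a)).
{ intros a s'. induction s' as [|b s' [eta [He H]]].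
  - exists 1. split; [lra|]. simpl; tauto.
  - destruct (Req_dec b a) as [E|E].
    + exists eta. split; trivial. intros r [<-|Hr] Hn; [contradiction|now apply H].
    + assert (Hb : 0 < Rabs (b - a)) by (apply Rabs_pos_lt; lra).
      exists (Rmin eta (Rabs (b - a) / 2)). split; [apply Rmin_glb_lt; lra|].
      assert (M1' := Rmin_l eta (Rabs (b - a) / 2)). assert (M2' := Rmin_r eta (Rabs (b - a) / 2)).
      intros r [<-|Hr] Hn; [lra|]. specialize (H r Hr Hn). lra. }
induction s as [|a s [eta [He H]]].
- exists 1. split; [lra|]. simpl; tauto.
- destruct (H1 a s) as [e' [He' H']].
  exists (Rmin eta e'). split; [now apply Rmin_glb_lt|].
  assert (K1 := Rmin_l eta e'). assert (K2 := Rmin_r eta e').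
  intros r r' [<-|Hr] [<-|Hr'] Hn.
  + contradiction.
  + rewrite Rabs_minus_sym. specialize (H' r' Hr' ltac:(auto)). lra.
  + specialize (H' r Hr Hn). lra.
  + specialize (H r r' Hr Hr' Hn). lra.
Qed.

Lemma uniform_eps (s : list R) (P : R -> R -> Prop) :
  (forall r, In r s -> exists e0, 0 < e0 /\ forall e, 0 < e < e0 -> P r e) ->
  exists e0, 0 < e0 /\ forall e, 0 < e < e0 -> forall r, In r s -> P r e.
Proof.
induction s as [|a s IH]; intros H.
- exists 1. split; [lra|]. simpl; tauto.
- destruct (H a) as [e1 [He1 H1]]; [now left|].
  destruct IH as [e2 [He2 H2]]. { intros r Hr. apply H. now right. }
  exists (Rmin e1 e2). split; [now apply Rmin_glb_lt|].
  assert (K1 := Rmin_l e1 e2). assert (K2 := Rmin_r e1 e2).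
  intros e He r [<-|Hr]; [apply H1; lra|apply H2; trivial; lra].
Qed.

Lemma nest_of_simple_zeros m ap am n : has_simple_zeros (M1 m ap am) n ->
  exists eps0, 0 < eps0 /\ forall eps, 0 < eps < eps0 ->
    has_nest (vfield m eps ap) (vfield m eps am) (RtoC (-1)) (RtoC 1) n.
Proof.
intros [s [Hnd [Hlen Hs]]].
destruct (list_separation s) as [eta [Heta Hsep]].
destruct (uniform_eps s (fun r eps => exists K, well_placed (vfield m eps ap) (vfield m eps am) r eta K)) as [eps0 [He0 H]].
{ intros r Hr. apply Hs in Hr. destruct Hr as [Hr1 Hr2]. now apply simple_zero_cycle. }
exists eps0. split; trivial. intros eps Heps. specialize (H eps Heps).
set (K := fun k => epsilon (inhabits (fun _ : C => False))
  (fun K => well_placed (vfield m eps ap) (vfield m eps am) (nth k s 0) eta K)).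
assert (HK : forall k, (k < n)%nat -> well_placed (vfield m eps ap) (vfield m eps am) (nth k s 0) eta (K k)).
{ intros k Hk. unfold K. apply epsilon_spec. apply H. apply nth_In. lia. }
exists K. split.
- intros k Hk. destruct (HK k Hk) as [K1 [K2 [K3 _]]]. auto.
- intros k l Hk Hl Hne Hsame.
  destruct (HK k Hk) as [_ [_ [_ [[z Hz] Hk']]]]. destruct (HK l Hl) as [_ [_ [_ [_ Hl']]]].
  assert (Hr : nth k s 0 <> nth l s 0).
  { intros E. apply Hne. apply (NoDup_nth s 0); trivial; lia. }
  (* A common point of the two cycles would have a radius within [eta] of two zeros that are at
     least [2 eta] apart. *)
  specialize (Hsep _ _ (nth_In s 0 (eq_ind_r (fun q => (k < q)%nat) Hk Hlen)) (nth_In s 0 (eq_ind_r (fun q => (l < q)%nat) Hl Hlen)) Hr).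
  specialize (Hk' z Hz). apply Hsame in Hz. specialize (Hl' z Hz).
  replace (nth k s 0 - nth l s 0) with ((Cmod (phi z) - nth l s 0) + - (Cmod (phi z) - nth k s 0)) in Hsep by ring.
  assert (T := Rabs_triang (Cmod (phi z) - nth l s 0) (- (Cmod (phi z) - nth k s 0))).
  rewrite Rabs_Ropp in T. lra.
Qed.

(* [z -> -z] followed by time reversal exchanges the two half-planes and the
   two centers. *)
Section Reflection.

Variables (Xp Xm Yp Ym : C -> C).
Hypothesis HYp : forall z, Yp z = Xm (- z)%C.
Hypothesis HYm : forall z, Ym z = Xp (- z)%C.

Lemma filippov_reflect z v : filippov Yp Ym z v -> filippov Xp Xm (- z)%C v.
Proof.
unfold filippov. rewrite HYp, HYm.
change (Im (- z)%C) with (- Im z).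
intros [[H ->]|[[H ->]|[H [lam [Hl ->]]]]].
- right; left. split; [lra|reflexivity].
- left. split; [lra|reflexivity].
- right; right. split; [lra|]. exists (1 - lam). split; [lra|].
  replace (1 - (1 - lam)) with lam by ring. ring.
Qed.

(** The signs from the reflection and from the time reversal cancel: the velocity is unchanged and
    only the half-planes are exchanged. *)
Lemma closed_orbit_reflect K : closed_orbit Yp Ym K -> closed_orbit Xp Xm (fun z => K (- z)%C).
Proof.
intros [g [T [[Hc Hd] [HT [Hper [[t0 Ht0] HK]]]]]].
exists (fun t : R => (- g (- t)%R)%C), T.
assert (Hinv : forall z : C, (- - z)%C = z) by (intros; ring).
split; [split|split; [exact HT|split; [|split]]].
- intros t. apply (continuous_opp (V := C_R_NormedModule) (fun t => g (- t))).
  apply (continuous_comp (fun t => - t) g); [|apply Hc].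
  apply (continuous_opp (V := R_NormedModule)), continuous_id.
- intros a b. destruct (Hd (- b) (- a)) as [s Hs].
  exists (map Ropp s). intros t Ht Hn.
  destruct (Hs (- t)) as [v [Hv1 Hv2]]; [lra| |].
  { intros Hin. apply Hn. apply in_map_iff. exists (- t). split; [ring|trivial]. }
  exists v. split; [|now apply filippov_reflect].
  assert (Do : is_derive (fun t : R => - t) t (- 1)).
  { apply (is_derive_opp (V := R_NormedModule) (fun t => t)). exact (is_derive_id (K := R_AbsRing) t). }
  evar_last.
  + apply (is_derive_opp (V := C_R_NormedModule)), (is_derive_C_comp g (fun t => - t) t _ _ Hv1 Do).
  + apply C_eq; unfold opp; simpl; unfold opp, Re, Im; simpl; ring.
- intros t. f_equal. replace (- t) with (- (t + T) + T) by ring. now rewrite Hper.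
- exists (- t0). rewrite Ropp_involutive, Ropp_0. intros E. apply Ht0.
  rewrite <- (Hinv (g t0)), E. apply Hinv.
- intros z. split.
  + intros Hz. apply HK in Hz. destruct Hz as [t Ht]. exists (- t).
    rewrite Ropp_involutive, Ht. apply Hinv.
  + intros [t <-]. apply HK. exists (- t). now rewrite Hinv.
Qed.

End Reflection.

Section ReflectNest.

Variables (Xp Xm Yp Ym : C -> C).
Hypothesis HYp : forall z, Yp z = Xm (- z)%C.
Hypothesis HYm : forall z, Ym z = Xp (- z)%C.

Lemma Copp_involutive (z : C) : (- - z)%C = z.
Proof. ring. Qed.

(** Reflection is an isometric involution, so a nearby competitor is reflected back and met by the
    isolation of [K]. *)
Lemma limit_cycle_reflect K : limit_cycle Yp Ym K -> limit_cycle Xp Xm (fun z => K (- z)%C).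
Proof.
intros [H1 [delta [Hd H2]]]. split; [now apply (closed_orbit_reflect Xp Xm Yp Ym)|].
exists delta. split; [trivial|]. intros K' HK' Hnear.
assert (Hs : same_set K (fun z => K' (- z)%C)).
{ apply H2.
  - apply (closed_orbit_reflect Yp Ym Xp Xm); trivial; intros z; rewrite ?HYp, ?HYm, Copp_involutive; reflexivity.
  - intros z Hz. destruct (Hnear _ Hz) as [w [Hw1 Hw2]]. exists (- w)%C. split; trivial.
    rewrite <- Cmod_opp. replace (- (z - - w))%C with (- z - w)%C by ring. trivial. }
intros z. rewrite (Hs (- z)%C), Copp_involutive. tauto.
Qed.

Lemma surrounds_reflect K p : surrounds K p -> surrounds (fun z => K (- z)%C) (- p)%C.
Proof.
intros [H1 [B H2]]. split; [now rewrite Copp_involutive|].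
exists B. intros path Hc H0 Hav. rewrite <- Cmod_opp. apply (H2 (fun t => - path t)%C).
- intros t. apply (continuous_opp (V := C_R_NormedModule)), Hc.
- now rewrite H0, Copp_involutive.
- exact Hav.
Qed.

Lemma surrounds_ext K K' p : (forall z, K z <-> K' z) -> surrounds K p -> surrounds K' p.
Proof.
intros E [H1 [B H2]]. split; [now rewrite <- E|].
exists B. intros path Hc H0 Hav. apply H2; trivial. intros t Ht. rewrite E. now apply Hav.
Qed.

Lemma has_nest_reflect p q n : has_nest Yp Ym p q n -> has_nest Xp Xm (- p)%C (- q)%C n.
Proof.
intros [K [H1 H2]]. exists (fun k z => K k (- z)%C). split.
- intros k Hk. destruct (H1 k Hk) as [L1 [L2 L3]]. split; [|split].
  + now apply limit_cycle_reflect.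
  + now apply surrounds_reflect.
  + intros Hs. apply L3. apply surrounds_reflect in Hs. rewrite Copp_involutive in Hs.
    revert Hs. apply surrounds_ext. intros z. rewrite Copp_involutive. tauto.
- intros k l Hk Hl Hne Hs. apply (H2 k l Hk Hl Hne). intros z.
  specialize (Hs (- z)%C). cbv beta in Hs. now rewrite Copp_involutive in Hs.
Qed.

End ReflectNest.

Lemma Rpoly_reflect m a z : Rpoly m (fun l => (RtoC (-1) ^ l * a l)%C) z = Rpoly m a (- z)%C.
Proof.
unfold Rpoly. apply (sum_n_ext (G := C_AbelianMonoid)). intros l.
change (Cconj (RtoC (-1) ^ l * a l) * z ^ l = Cconj (a l) * (- z) ^ l)%C.
rewrite Cmult_conj. transitivity (Cconj (a l) * (Cconj (RtoC (-1) ^ l) * z ^ l))%C; [ring|]. f_equal.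
replace (Cconj (RtoC (-1) ^ l)) with (RtoC (-1) ^ l)%C.
- rewrite <- Cpow_mult_l. f_equal. apply C_eq; simpl; ring.
- induction l as [|l IH]; [apply C_eq; simpl; ring|].
  simpl. rewrite Cmult_conj, <- IH. f_equal. apply C_eq; simpl; ring.
Qed.

Lemma vfield_reflect m eps a z : vfield m eps (fun l => (RtoC (-1) ^ l * a l)%C) z = vfield m eps a (- z)%C.
Proof. unfold vfield. rewrite Rpoly_reflect. simpl. ring. Qed.

Lemma averaged_limit_cycles m ap am i j : averaged_configuration m ap am i j ->
  has_limit_cycles m ap am i j.
Proof.
intros [Hi Hj].
destruct (nest_of_simple_zeros m ap am i Hi) as [e1 [He1 H1]].
destruct (nest_of_simple_zeros _ _ _ j Hj) as [e2 [He2 H2]].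
exists (Rmin e1 e2). split; [now apply Rmin_glb_lt|].
assert (K1 := Rmin_l e1 e2). assert (K2 := Rmin_r e1 e2).
intros eps Heps. split; [apply H1; lra|].
specialize (H2 eps ltac:(lra)).
apply (has_nest_reflect (vfield m eps ap) (vfield m eps am)) in H2; try (intros z; apply vfield_reflect).
replace (- RtoC (-1))%C with (RtoC 1) in H2 by (apply C_eq; simpl; ring).
replace (- RtoC 1)%C with (RtoC (-1)) in H2 by (apply C_eq; simpl; ring).
exact H2.
Qed.

(** * Closed form of the averaged functions *)

Lemma Cconj_pow (z : C) n : (Cconj (z ^ n) = Cconj z ^ n)%C.
Proof.
induction n as [|n IH]; [apply C_eq; simpl; ring|]. simpl. now rewrite Cmult_conj, IH.
Qed.

Lemma Cconj_plus (z w : C) : Cconj (z + w)%C = (Cconj z + Cconj w)%C.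
Proof. apply C_eq; simpl; ring. Qed.

Lemma Cconj_involutive (z : C) : Cconj (Cconj z) = z.
Proof. apply C_eq; simpl; unfold Re, Im; ring. Qed.

Lemma Rpoly_conj m a z : Cconj (Rpoly m a z) = Rpoly m (fun l => Cconj (a l)) (Cconj z).
Proof.
unfold Rpoly. induction m as [|m IH].
- rewrite !sum_O. change (Cconj (Cconj (a 0%nat) * 1) = Cconj (Cconj (a 0%nat)) * 1)%C.
  apply C_eq; simpl; ring.
- rewrite !sum_Sn. change (@plus C_AbelianMonoid) with Cplus.
  rewrite Cconj_plus, Cmult_conj, Cconj_pow, IH. reflexivity.
Qed.

Lemma Rpoly_plus m a b z : (Rpoly m a z + Rpoly m b z)%C = Rpoly m (fun l => (a l + b l)%C) z.
Proof.
unfold Rpoly. induction m as [|m IH].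
- rewrite !sum_O, Cconj_plus. ring.
- rewrite !sum_Sn. change (@plus C_AbelianMonoid) with Cplus. rewrite <- IH, Cconj_plus. ring.
Qed.

Lemma Cconj_inv (z : C) : Cconj (/ z)%C = (/ Cconj z)%C.
Proof.
unfold Cinv. simpl. replace (- snd z * (- snd z * 1)) with (snd z * (snd z * 1)) by ring.
apply C_eq; simpl; unfold Rdiv; ring.
Qed.

Lemma Ppert_conj m a w : Cconj (Ppert m a (Cconj w)) = Ppert m (fun l => Cconj (a l)) w.
Proof.
assert (E1 : Cconj (RtoC 1) = RtoC 1) by (apply C_eq; simpl; ring).
assert (E2 : Cconj (RtoC 2) = RtoC 2) by (apply C_eq; simpl; ring).
assert (Ep : Cconj (phi_inv (Cconj w)) = phi_inv w).
{ unfold phi_inv, Cdiv, Cminus. rewrite Cmult_conj, Cconj_inv, !Cconj_plus, Cconj_involutive, E1.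
  f_equal. f_equal. apply C_eq; simpl; ring. }
unfold Ppert, Cdiv. rewrite !Cmult_conj, Rpoly_conj, Ep, Cconj_inv, E2, Cconj_plus, Cconj_involutive, E1.
reflexivity.
Qed.

(** Conjugation moves the lower half to the same angular range, so M1 sees the two polynomials only
    through [ap l + Cconj (am l)]. The remaining freedom allows nonzero leading coefficients even
    when this combination has lower degree. *)
Lemma M1_RInt m ap am r : 0 < r < 1 -> M1 m ap am r =
  - RInt (fun x => Re (Ppert m (fun l => (ap l + Cconj (am l))%C) (RtoC r * cis x) * cis (- x))%C) 0 PI.
Proof.
intros Hr. rewrite M1_average by trivial. unfold half_average.
assert (Hc : forall a x, continuous (fun x => Re (Ppert m a (RtoC r * cis x) * cis (- x))%C) x).
{ intros a x. apply (proj1 (continuous_C_components _ x) (continuous_Ppert_polar m a r x Hr)). }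
set (f := fun x => Re (Ppert m ap (RtoC r * cis x) * cis (- x))%C).
set (g := fun x => Re (Ppert m (fun l => Cconj (am l)) (RtoC r * cis x) * cis (- x))%C).
assert (Ef : RInt (fun x => Re (polar_part (upper_pert m ap) r x)) 0 PI = - RInt f 0 PI).
{ apply is_RInt_unique. apply (is_RInt_ext (fun x => opp (f x))).
  - intros x _. unfold f, polar_part, upper_pert, opp. simpl. unfold Re, Im. ring.
  - apply (is_RInt_opp (V := R_NormedModule)), (RInt_correct (V := R_CompleteNormedModule)), ex_RInt_cont, Hc. }
assert (Eg : RInt (fun x => Re (polar_part (lower_pert m am) r x)) 0 PI = RInt g 0 PI).
{ apply (RInt_ext (V := R_CompleteNormedModule)). intros x _. unfold g, polar_part, lower_pert. now rewrite Ppert_conj. }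
rewrite Ef, Eg.
assert (E : RInt (fun x => Re (Ppert m (fun l => (ap l + Cconj (am l))%C) (RtoC r * cis x) * cis (- x))%C) 0 PI
  = RInt f 0 PI + RInt g 0 PI).
{ rewrite <- (RInt_plus (V := R_CompleteNormedModule) f g) by (apply ex_RInt_cont, Hc).
  apply (RInt_ext (V := R_CompleteNormedModule)). intros x _. unfold f, g, Ppert.
  rewrite <- Rpoly_plus. unfold plus; simpl. unfold Re, Im. ring. }
rewrite E. ring.
Qed.

(* [r] times the general combination of [1/r], [1], [r], [ln ((1-r)/(1+r))]. *)
Definition shape (k0 k1 k2 k3 r : R) : R :=
  k0 + k1 * r + k2 * r ^ 2 + k3 * (r * ln ((1 - r) / (1 + r))).

(** The factor [(w + 1)^2] clears the denominator [w + 1] of [phi_inv] from all powers up to the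
    second; the cube keeps a simple pole at [w = -1], whose contribution is the logarithm. *)
Lemma cubic_integral (x0 y0 y1 y3 r : R) (F : C -> C) : 0 < r < 1 ->
  (forall w, Cmod w < 1 -> F w =
    ((w + 1) * (w + 1) / 2 * ((x0, y0) + (0, y1) * phi_inv w + (0, y3) * phi_inv w ^ 3))%C) ->
  - RInt (fun x => Re (F (RtoC r * cis x) * cis (- x))%C) 0 PI =
  shape (y1 + y3 - y0) (- PI * x0) (y0 + y1 + y3) (4 * y3) r.
Proof.
intros Hr HF. assert (HP := PI_RGT_0).
(* [D x = |w + 1|^2] on the circle of radius [r]. *)
set (D := fun x => 1 + 2 * r * cos x + r ^ 2).
assert (HD : forall x, 0 < D x).
{ intros x. unfold D. assert (K := COS_bound x). nra. }
set (p := y0 / 2 - y1 / 2 + 7 / 2 * y3 - r ^ 2 * (y0 / 2 + y1 / 2 + y3 / 2)).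
set (J := fun x => x0 / 2 * (1 + r ^ 2) * cos x + r * x0 + p * sin x + 4 * y3 * (- sin x + r ^ 2 * sin x / D x)).
set (A := fun x => x0 / 2 * (1 + r ^ 2) * sin x + r * x0 * x - p * cos x + 4 * y3 * (cos x - r / 2 * ln (D x))).
assert (HJ : forall x, Re (F (RtoC r * cis x) * cis (- x))%C = J x).
{ intros x. rewrite HF by (rewrite Cmod_polar; lra).
  set (w := (RtoC r * cis x)%C).
  assert (Hw : (w + 1)%C <> RtoC 0) by (apply plus_1_neq_0; unfold w; rewrite Cmod_polar; lra).
  (* Polynomial division: [(w - 1)^3 / (w + 1) = w^2 - 4 w + 7 - 8 / (w + 1)]. *)
  replace ((w + 1) * (w + 1) / 2 * ((x0, y0) + (0, y1) * phi_inv w + (0, y3) * phi_inv w ^ 3))%C with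
    ((x0, y0) * ((w + 1) * (w + 1) / 2) + (0, y1) * ((w * w - 1) / 2) +
      (0, y3) * ((w * w - 4 * w + 7) / 2 - 4 * / (w + 1)))%C by (unfold phi_inv; simpl; field; exact Hw).
  assert (Ei : (/ (w + 1))%C = ((1 + r * cos x) / D x, - (r * sin x) / D x)).
  { unfold w. assert (K := sin2_cos2 x). unfold Rsqr in K.
    assert (ED : (r * cos x + 1) ^ 2 + (r * sin x) ^ 2 = D x).
    { unfold D. transitivity (1 + 2 * r * cos x + r ^ 2 * (sin x * sin x + cos x * cos x)); [ring|rewrite K; ring]. }
    unfold Cinv. simpl fst. simpl snd.
    replace (r * cos x - 0 * sin x + 1) with (r * cos x + 1) by ring.
    replace (r * sin x + 0 * cos x + 0) with (r * sin x) by ring.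
    rewrite ED. f_equal; f_equal; ring. }
  rewrite Ei. unfold w, J, p.
  assert (K := sin2_cos2 x). unfold Rsqr in K.
  assert (Dx := HD x). simpl. rewrite cos_neg, sin_neg.
  set (s := sin x) in *. set (c := cos x) in *.
  assert (ED : D x = 1 + 2 * r * c + r ^ 2) by reflexivity.
  set (d := D x) in *. set (i := / d).
  unfold Rdiv. fold i.
  assert (Hi : i * (1 + 2 * r * c + r ^ 2) = 1) by (unfold i; rewrite <- ED; apply Rinv_l; lra).
  assert (Hs2 : s * s = 1 - c * c) by lra.
  apply Rminus_diag_uniq.
  transitivity ((s * s + c * c - 1) * (r * x0 + r ^ 2 * (x0 / 2 * c - (y0 + y1 + y3) / 2 * s))
    + 4 * y3 * s * (1 - i * (1 + 2 * r * c + r ^ 2))).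
  - unfold Re, Im; simpl. field.
  - rewrite K, Hi. ring. }
assert (HA : forall x, is_derive A x (J x)).
{ intros x. assert (Dx := HD x). unfold A, J. evar_last.
  - unfold D in *. auto_derive; [exact Dx|reflexivity].
  - unfold D. field. unfold D in Dx. lra. }
assert (HJc : forall x, continuous J x).
{ intros x. apply (ex_derive_continuous (V := R_NormedModule)). assert (Dx := HD x).
  unfold J, D in *. auto_derive. lra. }
assert (E : RInt (fun x => Re (F (RtoC r * cis x) * cis (- x))%C) 0 PI = A PI - A 0).
{ apply is_RInt_unique. apply (is_RInt_ext J); [intros x _; symmetry; apply HJ|].
  apply (is_RInt_derive (V := R_CompleteNormedModule) A J); intros; auto. }
rewrite E. unfold A, p, D, shape. rewrite sin_0, sin_PI, cos_0, cos_PI.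
replace (1 + 2 * r * -1 + r ^ 2) with ((1 - r) ^ 2) by ring.
replace (1 + 2 * r * 1 + r ^ 2) with ((1 + r) ^ 2) by ring.
rewrite ln_div by lra.
replace (ln ((1 - r) ^ 2)) with (2 * ln (1 - r)) by (simpl; rewrite Rmult_1_r, ln_mult by lra; ring).
replace (ln ((1 + r) ^ 2)) with (2 * ln (1 + r)) by (simpl; rewrite Rmult_1_r, ln_mult by lra; ring).
field.
Qed.

(** * Counting zeros *)

(* Chosen so that [Cconj (coef_upper l) + coef_lower l], the only combination that
   enters [M1], is [- k1 / PI + i (k2 - k0) / 2], [i ((k2 + k0) / 2 - k3 / 4)], [0],
   [i k3 / 4] for [l = 0, 1, 2, 3], with nonzero leading coefficients. *)
Definition coef_upper (k0 k1 k2 k3 : R) (l : nat) : C :=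
  match l with
  | 0%nat => (- k1 / PI, - ((k2 - k0) / 2))
  | 1%nat => (0, - (1 + ((k2 + k0) / 2 - k3 / 4)))
  | 3%nat => (0, - (1 + k3 / 4))
  | _ => (0, - 1)
  end.

Definition coef_lower (l : nat) : C := match l with 0%nat => (0, 0) | _ => (0, - 1) end.

Definition small_degree (m : nat) (k3 : R) : Prop :=
  m = 3%nat \/ (k3 = 0 /\ (m = 1%nat \/ m = 2%nat)).

Lemma Rpoly_small_degree m k3 b x0 y0 y1 z : small_degree m k3 ->
  b 0%nat = (x0, - y0) -> b 1%nat = (0, - y1) -> b 2%nat = RtoC 0 -> b 3%nat = (0, - (k3 / 4)) ->
  Rpoly m b z = ((x0, y0) + (0, y1) * z + (0, (k3 / 4)%R) * z ^ 3)%C.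
Proof.
intros Hm B0 B1 B2 B3. unfold Rpoly.
destruct Hm as [->|[-> [->| ->]]]; rewrite ?sum_Sn, sum_O; change (@plus C_AbelianMonoid) with Cplus;
  rewrite ?B0, ?B1, ?B2, ?B3; destruct z as [u v]; apply C_eq; simpl; field.
Qed.

Lemma M1_coef m k0 k1 k2 k3 r : small_degree m k3 -> 0 < r < 1 ->
  M1 m (coef_upper k0 k1 k2 k3) coef_lower r = shape k0 k1 k2 k3 r.
Proof.
intros Hm Hr. assert (HP := PI_RGT_0). rewrite M1_RInt by trivial.
rewrite (cubic_integral (- k1 / PI) ((k2 - k0) / 2) ((k2 + k0) / 2 - k3 / 4) (k3 / 4)); trivial.
- unfold shape. field. lra.
- intros w _. unfold Ppert. f_equal. apply (Rpoly_small_degree m k3); trivial; apply C_eq; simpl; field; lra.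
Qed.

(** For N1 the combination at degree [l] is [(-1)^l] times the conjugate of the one for M1. Here
    this only flips the imaginary part at [l = 0], that is, exchanges [k0] and [k2]. *)
Lemma N1_coef m k0 k1 k2 k3 r : small_degree m k3 -> 0 < r < 1 ->
  N1 m (coef_upper k0 k1 k2 k3) coef_lower r = shape k2 k1 k0 k3 r.
Proof.
intros Hm Hr. assert (HP := PI_RGT_0). unfold N1. rewrite M1_RInt by trivial.
rewrite (cubic_integral (- k1 / PI) ((k0 - k2) / 2) ((k2 + k0) / 2 - k3 / 4) (k3 / 4)); trivial.
- unfold shape. field. lra.
- intros w _. unfold Ppert. f_equal. apply (Rpoly_small_degree m k3); trivial; apply C_eq; simpl; field; lra.
Qed.

Lemma has_simple_zeros_ext (f g : R -> R) n : (forall r, 0 < r < 1 -> f r = g r) ->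
  has_simple_zeros g n -> has_simple_zeros f n.
Proof.
intros E [s [H1 [H2 H3]]]. exists s. repeat split; trivial.
- apply H3 in H. tauto.
- apply H3 in H. tauto.
- apply H3 in H. destruct H as [Hr [Hz _]]. now rewrite E.
- apply H3 in H. destruct H as [Hr [_ [d [Hd Hd0]]]]. exists d. split; trivial.
  apply (is_derive_ext_loc g); trivial.
  apply (filter_imp (fun x => 0 < x /\ x < 1)); [intros x Hx; symmetry; apply E; lra|].
  apply filter_and; [apply (open_gt 0)|apply (open_lt 1)]; lra.
- intros [Hr [Hz [d [Hd Hd0]]]]. apply H3. split; trivial. split; [now rewrite <- E|].
  exists d. split; trivial. apply (is_derive_ext_loc f); trivial.
  apply (filter_imp (fun x => 0 < x /\ x < 1)); [intros x Hx; apply E; lra|].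
  apply filter_and; [apply (open_gt 0)|apply (open_lt 1)]; lra.
Qed.

Lemma configuration_of_shapes m k0 k1 k2 k3 i j :
  small_degree m k3 -> 1 + k3 / 4 <> 0 -> 1 + ((k2 + k0) / 2 - k3 / 4) <> 0 ->
  has_simple_zeros (shape k0 k1 k2 k3) i -> has_simple_zeros (shape k2 k1 k0 k3) j ->
  configuration_occurs m i j.
Proof.
intros Hm H3 H1 Hi Hj. exists (coef_upper k0 k1 k2 k3), coef_lower.
split; [|split].
- intros E. assert (K := f_equal Im E). destruct Hm as [->|[_ [->| ->]]]; simpl in K; lra.
- intros E. assert (K := f_equal Im E). destruct Hm as [->|[_ [->| ->]]]; simpl in K; lra.
- left. assert (Ha : averaged_configuration m (coef_upper k0 k1 k2 k3) coef_lower i j).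
  { split.
    - apply (has_simple_zeros_ext _ (shape k0 k1 k2 k3)); trivial. intros r Hr. now apply M1_coef.
    - apply (has_simple_zeros_ext _ (shape k2 k1 k0 k3)); trivial. intros r Hr. now apply N1_coef. }
  split; trivial. now apply averaged_limit_cycles.
Qed.

(** Division by [r] leaves a constant in front of the logarithm, so one differentiation makes the
    function rational. The factor [r > 0] affects neither the zeros nor their simplicity. *)
Definition ratio (k0 k1 k2 k3 r : R) : R := k0 / r + k1 + k2 * r + k3 * ln ((1 - r) / (1 + r)).

Definition ratio' (k0 k2 k3 r : R) : R := - k0 / r ^ 2 + k2 - 2 * k3 / (1 - r ^ 2).

Lemma is_derive_ratio k0 k1 k2 k3 r : 0 < r < 1 ->
  is_derive (ratio k0 k1 k2 k3) r (ratio' k0 k2 k3 r).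
Proof.
intros Hr. unfold ratio, ratio'. assert (0 < (1 - r) / (1 + r)) by (apply Rdiv_lt_0_compat; lra).
evar_last.
- auto_derive; [|reflexivity]. repeat split; lra.
- field. repeat split; try lra. nra.
Qed.

Lemma shape_zero k0 k1 k2 k3 r : 0 < r < 1 ->
  (shape k0 k1 k2 k3 r = 0 <-> ratio k0 k1 k2 k3 r = 0).
Proof.
intros Hr. assert (E : shape k0 k1 k2 k3 r = r * ratio k0 k1 k2 k3 r) by (unfold shape, ratio; field; lra).
rewrite E. split; intros H; [|rewrite H; ring]. apply Rmult_integral in H. destruct H; [lra|trivial].
Qed.

Lemma is_derive_shape k0 k1 k2 k3 r : 0 < r < 1 -> ratio k0 k1 k2 k3 r = 0 ->
  is_derive (shape k0 k1 k2 k3) r (r * ratio' k0 k2 k3 r).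
Proof.
intros Hr Hz.
apply (is_derive_ext_loc (fun x => x * ratio k0 k1 k2 k3 x)).
- apply (filter_imp (fun x => 0 < x)); [intros x Hx; change (x * ratio k0 k1 k2 k3 x = shape k0 k1 k2 k3 x); unfold shape, ratio; field; lra|].
  apply (open_gt 0); lra.
- evar_last.
  + apply (is_derive_mult (K := R_AbsRing)); [exact (is_derive_id (K := R_AbsRing) r)|now apply is_derive_ratio|].
    intros; apply Rmult_comm.
  + rewrite Hz. unfold plus, mult, one; simpl. ring.
Qed.

Lemma shape_simple_zeros k0 k1 k2 k3 (s : list R) : NoDup s ->
  (forall r, In r s -> 0 < r < 1 /\ ratio k0 k1 k2 k3 r = 0 /\ ratio' k0 k2 k3 r <> 0) ->
  (forall r, 0 < r < 1 -> ratio k0 k1 k2 k3 r = 0 -> In r s) ->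
  has_simple_zeros (shape k0 k1 k2 k3) (length s).
Proof.
intros Hnd H1 H2. exists s. split; [trivial|split; [reflexivity|]]. intros r. split.
- intros Hr. destruct (H1 r Hr) as [K1 [K2 K3]]. split; trivial. split; [now apply shape_zero|].
  exists (r * ratio' k0 k2 k3 r). split; [now apply is_derive_shape|].
  apply Rmult_integral_contrapositive. split; [lra|trivial].
- intros [Hr [Hz _]]. apply H2; trivial. now apply shape_zero in Hz.
Qed.

Definition monotone_zero (k0 k1 k2 k3 p q z : R) : Prop :=
  p < z < q /\ ratio k0 k1 k2 k3 z = 0 /\ ratio' k0 k2 k3 z <> 0 /\
  forall r, p < r < q -> ratio k0 k1 k2 k3 r = 0 -> r = z.

(** The interval of monotonicity may reach 0 or 1, where [ratio] may be singular, so the sign change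
    is tested at separate points [a] and [b]. *)
Lemma increasing_zero k0 k1 k2 k3 p q a b :
  0 <= p -> q <= 1 -> p <= a -> 0 < a -> a < b -> b <= q -> b < 1 ->
  (forall r, p < r < q -> 0 < ratio' k0 k2 k3 r) ->
  ratio k0 k1 k2 k3 a < 0 -> 0 < ratio k0 k1 k2 k3 b ->
  exists z, monotone_zero k0 k1 k2 k3 p q z.
Proof.
intros Hp Hq Hpa Ha Hab Hbq Hb Hd Ka Kb.
set (f := ratio k0 k1 k2 k3) in *.
assert (Hinc : forall x y, p < x -> x < y -> y < q -> f x < f y).
{ intros x y Hx Hxy Hy.
  destruct (MVT_cor2 f (ratio' k0 k2 k3) x y Hxy) as [c [Hc1 Hc2]].
  - intros c Hc. apply is_derive_Reals, is_derive_ratio. lra.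
  - assert (K := Hd c ltac:(lra)). nra. }
destruct (IVT_interv f a b) as [z [Hz Hz0]]; trivial.
{ intros x Hx. apply continuity_pt_filterlim, (ex_derive_continuous (V := R_NormedModule)).
  exists (ratio' k0 k2 k3 x). apply is_derive_ratio. lra. }
assert (Hza : z <> a) by (intros E; rewrite E in Hz0; lra).
assert (Hzb : z <> b) by (intros E; rewrite E in Hz0; lra).
exists z. split; [lra|]. split; [trivial|]. split; [assert (K := Hd z ltac:(lra)); lra|].
intros r Hr Hr0. destruct (Rtotal_order r z) as [K|[K|K]]; trivial.
- assert (K' := Hinc r z ltac:(lra) K ltac:(lra)). unfold f in *. lra.
- assert (K' := Hinc z r ltac:(lra) K ltac:(lra)). unfold f in *. lra.
Qed.

Lemma ratio_opp k0 k1 k2 k3 r : ratio (- k0) (- k1) (- k2) (- k3) r = - ratio k0 k1 k2 k3 r.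
Proof. unfold ratio, Rdiv. ring. Qed.

Lemma ratio'_opp k0 k2 k3 r : ratio' (- k0) (- k2) (- k3) r = - ratio' k0 k2 k3 r.
Proof. unfold ratio', Rdiv. ring. Qed.

Lemma decreasing_zero k0 k1 k2 k3 p q a b :
  0 <= p -> q <= 1 -> p <= a -> 0 < a -> a < b -> b <= q -> b < 1 ->
  (forall r, p < r < q -> ratio' k0 k2 k3 r < 0) ->
  0 < ratio k0 k1 k2 k3 a -> ratio k0 k1 k2 k3 b < 0 ->
  exists z, monotone_zero k0 k1 k2 k3 p q z.
Proof.
intros Hp Hq Hpa Ha Hab Hbq Hb Hd Ka Kb.
destruct (increasing_zero (- k0) (- k1) (- k2) (- k3) p q a b) as [z [Z1 [Z2 [Z3 Z4]]]]; trivial.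
- intros r Hr. rewrite ratio'_opp. specialize (Hd r Hr). lra.
- rewrite ratio_opp. lra.
- rewrite ratio_opp. lra.
- rewrite ratio_opp in Z2. rewrite ratio'_opp in Z3.
  exists z. repeat split; try lra. intros r Hr Hr0. apply Z4; trivial. rewrite ratio_opp. lra.
Qed.

(** With q = r^2 the numerator is [- k0 + (k0 + k2 - 2 k3) q - k2 q^2]. Exchanging [k0] and [k2]
    reverses this polynomial and inverts its roots, so the parameters below come from a choice of
    roots: both in (0, 1) allow three zeros at one center and leave a monotone function at the
    other. *)
Lemma ratio'_numerator k0 k2 k3 r : 0 < r < 1 ->
  ratio' k0 k2 k3 r =
  (- k0 * (1 - r ^ 2) + k2 * (r ^ 2 * (1 - r ^ 2)) - 2 * k3 * r ^ 2) / (r ^ 2 * (1 - r ^ 2)).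
Proof. intros Hr. unfold ratio'. field. split; nra. Qed.

Lemma ratio'_pos k0 k2 k3 r : 0 < r < 1 ->
  0 < - k0 * (1 - r ^ 2) + k2 * (r ^ 2 * (1 - r ^ 2)) - 2 * k3 * r ^ 2 -> 0 < ratio' k0 k2 k3 r.
Proof.
intros Hr H. rewrite ratio'_numerator by trivial. apply Rdiv_lt_0_compat; trivial.
apply Rmult_lt_0_compat; nra.
Qed.

Lemma ratio'_neg k0 k2 k3 r : 0 < r < 1 ->
  - k0 * (1 - r ^ 2) + k2 * (r ^ 2 * (1 - r ^ 2)) - 2 * k3 * r ^ 2 < 0 -> ratio' k0 k2 k3 r < 0.
Proof.
intros Hr H. assert (K := ratio'_pos (- k0) (- k2) (- k3) r Hr). rewrite ratio'_opp in K. lra.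
Qed.

Lemma ln_le_minus_1 x : 0 < x -> ln x <= x - 1.
Proof.
intros Hx. destruct (Req_dec (ln x) 0) as [E|E].
- assert (x = 1); [|lra]. rewrite <- (exp_ln x Hx), E. apply exp_0.
- assert (K := exp_ineq1 (ln x) E). rewrite exp_ln in K by trivial. lra.
Qed.

(** The upper bound is dictated by [zeros_31_left], where positivity at 1/2 amounts to
    [297/800 * ln 3 < 43/100]. *)
Lemma ln_3_bounds : 1 <= ln 3 <= 1158 / 1000.
Proof.
split.
- rewrite <- (ln_exp 1) at 1. apply ln_le; [apply exp_pos|apply exp_le_3].
- rewrite <- (ln_exp (1158 / 1000)). apply ln_le; [lra|].
  (* [exp (1158/1000)] is the 12th power of [exp (965/10000)], and [(1 + 965/10000)^12] already
     exceeds 3. *)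
  replace (1158 / 1000) with (12 * (965 / 10000)) by field.
  assert (K := exp_ineq1 (965 / 10000) ltac:(lra)).
  assert (E : forall n x, exp (INR n * x) = exp x ^ n).
  { intros n x. induction n as [|n IH]; [rewrite Rmult_0_l; apply exp_0|].
    rewrite S_INR, Rmult_plus_distr_r, exp_plus, IH, Rmult_1_l. simpl. ring. }
  replace 12 with (INR 12) at 1 by (simpl; ring).
  rewrite E. apply Rle_trans with ((1 + 965 / 10000) ^ 12); [lra|]. apply pow_incr. lra.
Qed.

Lemma ln_inv_3 : ln ((1 - 1 / 2) / (1 + 1 / 2)) = - ln 3.
Proof. rewrite <- ln_Rinv by lra. f_equal. field. Qed.

(** 98/100 stands for the end 1, where the logarithm dominates. The quotient there is 1/99, and
    [3^4 < 99] with [ln 3 >= 1] gives the bound. *)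
Lemma ln_inv_99 : ln ((1 - 98 / 100) / (1 + 98 / 100)) < - 4.
Proof.
replace ((1 - 98 / 100) / (1 + 98 / 100)) with (/ 99) by field. rewrite ln_Rinv by lra.
assert (K : ln (3 ^ 4) < ln 99) by (apply ln_increasing; lra).
assert (K3 := ln_3_bounds).
replace (ln (3 ^ 4)) with (4 * ln 3) in K; [lra|].
simpl. rewrite Rmult_1_r, !ln_mult by lra. ring.
Qed.

(** [ln x <= x - 1] for the quotient and for its inverse; sharp enough at the small radii 1/4, 1/10
    and 1/100. *)
Lemma ln_ratio_bounds r : 0 < r < 1 ->
  - (2 * r / (1 - r)) <= ln ((1 - r) / (1 + r)) <= - (2 * r / (1 + r)).
Proof.
intros Hr. split.
- assert (K := ln_le_minus_1 ((1 + r) / (1 - r)) ltac:(apply Rdiv_lt_0_compat; lra)).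
  replace ((1 - r) / (1 + r)) with (/ ((1 + r) / (1 - r))) by (field; lra).
  rewrite ln_Rinv by (apply Rdiv_lt_0_compat; lra).
  replace ((1 + r) / (1 - r) - 1) with (2 * r / (1 - r)) in K by (field; lra). lra.
- assert (K := ln_le_minus_1 ((1 - r) / (1 + r)) ltac:(apply Rdiv_lt_0_compat; lra)).
  replace ((1 - r) / (1 + r) - 1) with (- (2 * r / (1 + r))) in K by (field; lra). lra.
Qed.

Lemma one_simple_zero k0 k1 k2 k3 z : monotone_zero k0 k1 k2 k3 0 1 z ->
  has_simple_zeros (shape k0 k1 k2 k3) 1.
Proof.
intros [Z1 [Z2 [Z3 Z4]]]. apply (shape_simple_zeros k0 k1 k2 k3 (z :: nil)).
- repeat constructor; simpl; tauto.
- intros r [<-|[]]. auto.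
- intros r Hr Hz. left. symmetry. now apply Z4.
Qed.

Lemma two_simple_zeros k0 k1 k2 k3 p z1 z2 : ratio k0 k1 k2 k3 p <> 0 -> 0 < p < 1 ->
  monotone_zero k0 k1 k2 k3 0 p z1 -> monotone_zero k0 k1 k2 k3 p 1 z2 ->
  has_simple_zeros (shape k0 k1 k2 k3) 2.
Proof.
intros Hp Hp' [Y1 [Y2 [Y3 Y4]]] [Z1 [Z2 [Z3 Z4]]].
apply (shape_simple_zeros k0 k1 k2 k3 (z1 :: z2 :: nil)).
- repeat constructor; simpl; try tauto. intros [E|[]]. lra.
- intros r [<-|[<-|[]]]; repeat split; trivial; lra.
- intros r Hr Hz. destruct (Rtotal_order r p) as [K|[K|K]].
  + left. symmetry. apply Y4; trivial. lra.
  + rewrite K in Hz. contradiction.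
  + right; left. symmetry. apply Z4; trivial. lra.
Qed.

Lemma three_simple_zeros k0 k1 k2 k3 p q z1 z2 z3 :
  ratio k0 k1 k2 k3 p <> 0 -> ratio k0 k1 k2 k3 q <> 0 -> 0 < p -> p < q -> q < 1 ->
  monotone_zero k0 k1 k2 k3 0 p z1 -> monotone_zero k0 k1 k2 k3 p q z2 ->
  monotone_zero k0 k1 k2 k3 q 1 z3 ->
  has_simple_zeros (shape k0 k1 k2 k3) 3.
Proof.
intros Hp Hq H0 H1 H2 [X1 [X2 [X3 X4]]] [Y1 [Y2 [Y3 Y4]]] [Z1 [Z2 [Z3 Z4]]].
apply (shape_simple_zeros k0 k1 k2 k3 (z1 :: z2 :: z3 :: nil)).
- repeat constructor; simpl; try tauto.
  + intros [E|[E|[]]]; lra.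
  + intros [E|[]]; lra.
- intros r [<-|[<-|[<-|[]]]]; repeat split; trivial; lra.
- intros r Hr Hz. destruct (Rtotal_order r p) as [K|[K|K]].
  + left. symmetry. apply X4; trivial. lra.
  + rewrite K in Hz. contradiction.
  + destruct (Rtotal_order r q) as [K'|[K'|K']].
    * right; left. symmetry. apply Y4; trivial. lra.
    * rewrite K' in Hz. contradiction.
    * right; right; left. symmetry. apply Z4; trivial. lra.
Qed.

(** Without the logarithm the function is [(2 r - 1) (r - 2)], with the only zero 1/2 in (0, 1). As
    [k0 = k2] it serves both centers, and [k3 = 0] makes it available in degrees 1 to 3. *)
Lemma zeros_11 : has_simple_zeros (shape 2 (-5) 2 0) 1.
Proof.
destruct (decreasing_zero 2 (-5) 2 0 0 1 (1 / 4) (3 / 4)) as [z Hz]; try lra.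
- intros r Hr. apply ratio'_neg; [lra|]. assert (0 < r ^ 2 < 1) by nra. nra.
- unfold ratio. lra.
- unfold ratio. lra.
- exact (one_simple_zero _ _ _ _ z Hz).
Qed.

(* With q = r^2 the numerator of the derivative is -(q - 1/4)(q - 4). *)
Lemma zeros_22 : has_simple_zeros (shape 1 (-4) 1 (- 9 / 8)) 2.
Proof.
assert (L3 := ln_3_bounds). assert (Lh := ln_inv_3). assert (L99 := ln_inv_99).
(* 1/2 is the minimum of [ratio], and [k1] makes its value negative. By [k0 = k2] the count holds at
   both centers. *)
assert (Hh : ratio 1 (-4) 1 (- 9 / 8) (1 / 2) < 0) by (unfold ratio; rewrite Lh; lra).
destruct (decreasing_zero 1 (-4) 1 (- 9 / 8) 0 (1 / 2) (1 / 4) (1 / 2)) as [z1 Hz1]; try lra.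
{ intros r Hr. apply ratio'_neg; [lra|]. set (q := r ^ 2). assert (0 < q < 1 / 4) by (unfold q; nra). nra. }
{ unfold ratio. assert (K := ln_ratio_bounds (1 / 4) ltac:(lra)). lra. }
destruct (increasing_zero 1 (-4) 1 (- 9 / 8) (1 / 2) 1 (1 / 2) (98 / 100)) as [z2 Hz2]; try lra.
{ intros r Hr. apply ratio'_pos; [lra|]. set (q := r ^ 2). assert (1 / 4 < q < 1) by (unfold q; nra). nra. }
{ unfold ratio. lra. }
apply (two_simple_zeros _ _ _ _ (1 / 2) z1 z2); trivial; lra.
Qed.

(* The numerator of the derivative is 4 (q - 1/4)(q + 1). *)
Lemma zeros_21_left : has_simple_zeros (shape 1 (-4) (-4) (-3)) 2.
Proof.
assert (L3 := ln_3_bounds). assert (Lh := ln_inv_3). assert (L99 := ln_inv_99).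
assert (Hh : ratio 1 (-4) (-4) (-3) (1 / 2) < 0) by (unfold ratio; rewrite Lh; lra).
destruct (decreasing_zero 1 (-4) (-4) (-3) 0 (1 / 2) (1 / 10) (1 / 2)) as [z1 Hz1]; try lra.
{ intros r Hr. apply ratio'_neg; [lra|]. set (q := r ^ 2). assert (0 < q < 1 / 4) by (unfold q; nra). nra. }
{ unfold ratio. assert (K := ln_ratio_bounds (1 / 10) ltac:(lra)). lra. }
destruct (increasing_zero 1 (-4) (-4) (-3) (1 / 2) 1 (1 / 2) (98 / 100)) as [z2 Hz2]; try lra.
{ intros r Hr. apply ratio'_pos; [lra|]. set (q := r ^ 2). assert (1 / 4 < q < 1) by (unfold q; nra). nra. }
{ unfold ratio. lra. }
apply (two_simple_zeros _ _ _ _ (1 / 2) z1 z2); trivial; lra.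
Qed.

(** With q = r^2 the numerator of the derivative is [(4 - q) (1 + q)], positive throughout. *)
Lemma zeros_21_right : has_simple_zeros (shape (-4) (-4) 1 (-3)) 1.
Proof.
assert (L3 := ln_3_bounds). assert (Lh := ln_inv_3). assert (L99 := ln_inv_99).
destruct (increasing_zero (-4) (-4) 1 (-3) 0 1 (1 / 2) (98 / 100)) as [z Hz]; try lra.
- intros r Hr. apply ratio'_pos; [lra|]. set (q := r ^ 2). assert (0 < q < 1) by (unfold q; nra). nra.
- unfold ratio. rewrite Lh. lra.
- unfold ratio. lra.
- exact (one_simple_zero _ _ _ _ z Hz).
Qed.

(* The numerator of the derivative is -(q - 1/100)(q - 1/4). *)
Lemma zeros_31_left : has_simple_zeros (shape (1 / 400) (- 3 / 40) 1 (297 / 800)) 3.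
Proof.
assert (L3 := ln_3_bounds). assert (Lh := ln_inv_3). assert (L99 := ln_inv_99).
assert (K10 := ln_ratio_bounds (1 / 10) ltac:(lra)). assert (K100 := ln_ratio_bounds (1 / 100) ltac:(lra)).
set (f := ratio (1 / 400) (- 3 / 40) 1 (297 / 800)).
(* [k1 = -3/40] puts the zero level between the local minimum at 1/10 and the local maximum at
   1/2. *)
assert (F1 : f (1 / 10) < 0) by (unfold f, ratio; lra).
assert (F2 : 0 < f (1 / 2)) by (unfold f, ratio; rewrite Lh; lra).
destruct (decreasing_zero (1 / 400) (- 3 / 40) 1 (297 / 800) 0 (1 / 10) (1 / 100) (1 / 10)) as [z1 Hz1]; try lra; trivial.
{ intros r Hr. apply ratio'_neg; [lra|]. set (q := r ^ 2). assert (0 < q < 1 / 100) by (unfold q; nra). nra. }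
{ unfold ratio. lra. }
destruct (increasing_zero (1 / 400) (- 3 / 40) 1 (297 / 800) (1 / 10) (1 / 2) (1 / 10) (1 / 2)) as [z2 Hz2]; try lra; trivial.
{ intros r Hr. apply ratio'_pos; [lra|]. set (q := r ^ 2). assert (1 / 100 < q < 1 / 4) by (unfold q; nra). nra. }
destruct (decreasing_zero (1 / 400) (- 3 / 40) 1 (297 / 800) (1 / 2) 1 (1 / 2) (98 / 100)) as [z3 Hz3]; try lra; trivial.
{ intros r Hr. apply ratio'_neg; [lra|]. set (q := r ^ 2). assert (1 / 4 < q < 1) by (unfold q; nra). nra. }
{ unfold ratio. lra. }
apply (three_simple_zeros _ _ _ _ (1 / 10) (1 / 2) z1 z2 z3); trivial; fold f; lra.
Qed.

(** With q = r^2 the numerator of the derivative is [- (q - 4) (q - 100) / 400]: the critical radii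
    1/2 and 1/10 of the left function have moved to 2 and 10, outside (0, 1). *)
Lemma zeros_31_right : has_simple_zeros (shape 1 (- 3 / 40) (1 / 400) (297 / 800)) 1.
Proof.
assert (L3 := ln_3_bounds). assert (Lh := ln_inv_3). assert (L99 := ln_inv_99).
destruct (decreasing_zero 1 (- 3 / 40) (1 / 400) (297 / 800) 0 1 (1 / 2) (98 / 100)) as [z Hz]; try lra.
- intros r Hr. apply ratio'_neg; [lra|]. set (q := r ^ 2). assert (0 < q < 1) by (unfold q; nra). nra.
- unfold ratio. rewrite Lh. lra.
- unfold ratio. lra.
- exact (one_simple_zero _ _ _ _ z Hz).
Qed.

Theorem corollary1 :
  (forall m : nat, m = 1%nat \/ m = 2%nat -> configuration_occurs m 1 1) /\
  configuration_occurs 3 1 1 /\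
  configuration_occurs 3 2 1 /\
  configuration_occurs 3 3 1 /\
  configuration_occurs 3 2 2.
Proof.
split; [|split; [|split; [|split]]].
- intros m Hm. apply (configuration_of_shapes m 2 (-5) 2 0); try lra; try exact zeros_11. now right.
- apply (configuration_of_shapes 3 2 (-5) 2 0); try lra; try exact zeros_11. now left.
- apply (configuration_of_shapes 3 1 (-4) (-4) (-3)); try lra; [now left|exact zeros_21_left|exact zeros_21_right].
- apply (configuration_of_shapes 3 (1 / 400) (- 3 / 40) 1 (297 / 800)); try lra; [now left|exact zeros_31_left|exact zeros_31_right].
- apply (configuration_of_shapes 3 1 (-4) 1 (- 9 / 8)); try lra; try exact zeros_22. now left.
Qed.
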